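(* Let $\mathbf{x}\in\Omega$ and assume there is a unique closest point $\mathbf{x}_0$ to $\mathbf{x}$ on $\partial\Omega$. Let $r=\|\mathbf{x}-\mathbf{x}_0\|$, let $\kappa_0$ be the curvature of the boundary at $\mathbf{x}_0$, and write $f=f(\mathbf{x})$, $f^{(0,1)}=f_\eta(\mathbf{x})$, $f^{(0,2)}=f_{\eta\eta}(\mathbf{x})$, $f^{(2,0)}=f_{\xi\xi}(\mathbf{x})$, where $\xi$ is the tangent line direction and $\eta$ the inward normal direction at $\mathbf{x}_0$. Put $c_1=r/\sqrt{\delta_*}$, $c_2=\alpha\sqrt{\delta_*}$ and $$\Phi_\mp=e^{-c_1c_2}\operatorname{erfc}\left(\tfrac{c_1}{2}-c_2\right)\mp e^{c_1c_2}\operatorname{erfc}\left(\tfrac{c_1}{2}+c_2\right),\qquad Z=\frac{4c_2\,e^{-c_1^2/4-c_2^2}}{\sqrt{\pi}},$$ $$P_1=c_1\frac{\Phi_-}{c_2},\qquad Q_m=c_1^m\left[\frac{\Phi_--Z}{c_2^3}+\frac{c_1\Phi_+}{c_2^2}\right]\ (m=0,1),\qquad \lambda=e^{-c_2^2}\operatorname{erfc}\left(\tfrac{c_1}{2}\right),$$ $$W_0=\frac{1}{c_2^2}\left(4-4e^{-c_2^2}+2\lambda-\Phi_+\right),\qquad W_1=\frac{1}{c_2^2}\left(2W_0-P_1+4(\lambda-2e^{-c_2^2})\right).$$ Then the local volume potential $\mathcal{V}_L[f]$ (defined in the context) satisfies $$\begin{aligned}\mathcal{V}_L[f](\mathbf{x})=&\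 \delta_*\frac{f}{4}W_0+\delta_*^{3/2}\,\frac{2f^{(0,1)}-f\kappa_0}{8}Q_0\\&+\delta_*^2\left(\left(\frac{f^{(0,1)}\kappa_0}{8}-\frac{3f\kappa_0^2}{32}-\frac{f^{(0,2)}}{8}\right)Q_1+\frac{f^{(0,2)}+f^{(2,0)}}{8}W_1\right)+\mathcal{O}(\delta_*^{5/2}).\end{aligned}$$
   Context: Setting: $\Omega\subset\mathbb{R}^2$ is an interior or exterior domain whose boundary $\partial\Omega$ is a smooth closed curve; $\alpha>0$ is fixed; $\delta_*>0$; $f$ is a smooth function on $\overline{\Omega}$ (bounded together with its derivatives). $\operatorname{erfc}$ is the complementary error function. The local (short-time) part of the volume potential of the modified Helmholtz operator $-\Delta+\alpha^2$ is $$\mathcal{V}_L[f](\mathbf{x})=\int_0^{\delta_*}\int_{\Omega}\frac{e^{-\frac{\|\mathbf{x}-\mathbf{x}'\|^2}{4t}-\alpha^2t}}{4\pi t}\,f(\mathbf{x}')\,\mathrm{d}\mathbf{x}'\,\mathrm{d}t .$$ Local coordinates: $\mathbf{x}$ is placed at the origin, $\xi$ is the coordinate along a unit tangent $\boldsymbol{\tau}_0$ to $\partial\Omega$ at $\mathbf{x}_0$ and $\eta$ the coordinate along the inward (pointing into $\Omega$) unit normal $\mathbf{n}_0$ at $\mathbf{x}_0$; subscripts on $f$ denote partial derivatives in these coordinates. Near $\mathbf{x}_0=(0,-r)$ the boundary is the graph $\eta=\gamma(\xi)$ with $\gamma(0)=-r$, $\gamma'(0)=0$, and $\kappa_0=\gamma''(0)$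 (so $\kappa_0=1/R$ for a disc $\Omega$ of radius $R$). Asymptotics: $\mathcal{O}(\cdot)$ is as $\delta_*\to0$ with $\alpha$, $\Omega$, $f$ fixed, with implied constant uniform over targets $\mathbf{x}\in\Omega$ within distance $\sqrt{\delta_*}(12+2\alpha\sqrt{\delta_*})$ of $\partial\Omega$; $\delta_*$ is assumed small enough that every such point has a unique closest point on $\partial\Omega$. *)

(* Defs.v *)
(* The plane is R * R with its product topology; its
   library norm is the max norm, hence the explicit Euclidean norm below. *)
From HB Require Import structures.
From mathcomp Require Import all_boot all_order all_algebra.
From mathcomp Require Import all_classical all_reals all_analysis.

Set Implicit Arguments.
Unset Strict Implicit.
Unset Printing Implicit Defensive.

Import Order.TTheory GRing.Theory Num.Theory.
Import numFieldNormedType.Exports.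

Local Open Scope classical_set_scope.
Local Open Scope ring_scope.

Section Plane.
Context {R : realType}.
Implicit Types (A B D Omega : set (R * R)) (x y u v n tau : R * R)
  (f : R * R -> R) (c : R -> R * R).

Definition dotp u v : R := u.1 * v.1 + u.2 * v.2.

Definition enorm u : R := Num.sqrt (dotp u u).

Definition boundary A : set (R * R) := closure A `\` interior A.

Definition is_domain D := [/\ open D, D !=set0 & connected D].

Definition interior_or_exterior_domain Omega :=
  is_domain Omega /\
  (bounded_set Omega \/
   exists D, [/\ is_domain D, bounded_set D & Omega = ~` closure D]).

(* c is an L-periodic C^oo regular parametrization, injective over one period,
   of the set B *)
Definition smooth_closed_curve c (L : R) B :=
  [/\ 0 < L,
      forall (k : nat) (t : R), derivable (derive1n k c) t 1,
      forall t : R, derive1 c t != 0 &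
      [/\ forall t : R, c (t + L) = c t,
      {in `[0, L[ &, injective c} &
      range c = B]].

Definition closest_point B x y :=
  B y /\ forall z, B z -> enorm (x - y) <= enorm (x - z).

Definition unit_tangent Omega x0 tau :=
  enorm tau = 1 /\
  exists c L s, [/\ smooth_closed_curve c L (boundary Omega), c s = x0 &
                    exists a : R, derive1 c s = a *: tau].

Definition inward_unit_normal Omega x0 n :=
  [/\ enorm n = 1,
      forall tau, unit_tangent Omega x0 tau -> dotp n tau = 0 &
      \forall s \near 0^'+, Omega (x0 + s *: n)].

(* In the coordinates y = x + xi tau + eta n, in which x0 = (0, - r), the
   boundary is, near x0, the graph eta = g xi, and kappa = g''(0). The sign is
   fixed by the inward normal n: kappa = 1 / rho for a disc of radius rho. *)
Definition boundary_curvature Omega x x0 tau n (kappa : R) :=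
  let r := enorm (x - x0) in
  exists g : R -> R,
    [/\ \forall xi \near (0 : R), forall k : nat, derivable (derive1n k g) xi 1,
        g 0 = - r,
        derive1 g 0 = 0,
        \forall p \near ((0, - r) : R * R),
          boundary Omega (x + p.1 *: tau + p.2 *: n) <-> p.2 = g p.1 &
        kappa = derive1n 2 g 0].

(* iterated directional derivative D_{v1} (D_{v2} (... f)) for
   vs = [:: v1; v2; ...] *)
Fixpoint iter_derive (vs : seq (R * R)) f : R * R -> R :=
  if vs is v :: vs' then fun x => 'D_v (iter_derive vs' f) x else f.

(* C^oo on the closure of the open set Omega: derivatives of all orders exist
   in Omega and extend continuously to the closure. All of them are moreover
   bounded. *)
Definition smooth_bounded_on_closure Omega f :=
  forall vs : seq (R * R),
    [/\ forall x v, Omega x -> derivable (iter_derive vs f) x v,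
        exists2 h : R * R -> R, {within closure Omega, continuous h} &
          forall x, Omega x -> h x = iter_derive vs f x &
        exists M : R, forall x, Omega x -> `|iter_derive vs f x| <= M].

End Plane.

Section Potential.
Context {R : realType}.

Definition erfc (z : R) : R :=
  2 / Num.sqrt pi * \int[lebesgue_measure]_(s in `[z, +oo[) expR (- s ^+ 2).

Definition local_volume_potential (alpha : R) (Omega : set (R * R))
    (f : R * R -> R) (d : R) (x : R * R) : R :=
  \int[lebesgue_measure]_(t in `]0%R, d[)
    \int[(lebesgue_measure \x lebesgue_measure)%E]_(y in Omega)
      (expR (- (enorm (x - y) ^+ 2 / (4 * t)) - alpha ^+ 2 * t) / (4 * pi * t)
       * f y).

End Potential.

Section Coefficients.
Context {R : realType}.
Context (c1 c2 : R).

Definition Phim : R :=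
  expR (- (c1 * c2)) * erfc (c1 / 2 - c2) - expR (c1 * c2) * erfc (c1 / 2 + c2).

Definition Phip : R :=
  expR (- (c1 * c2)) * erfc (c1 / 2 - c2) + expR (c1 * c2) * erfc (c1 / 2 + c2).

Definition Zc : R := 4 * c2 * expR (- (c1 ^+ 2 / 4) - c2 ^+ 2) / Num.sqrt pi.

Definition P1 : R := c1 * (Phim / c2).

Definition Q (m : nat) : R :=
  c1 ^+ m * ((Phim - Zc) / c2 ^+ 3 + c1 * Phip / c2 ^+ 2).

Definition lambda : R := expR (- c2 ^+ 2) * erfc (c1 / 2).

Definition W0 : R :=
  1 / c2 ^+ 2 * (4 - 4 * expR (- c2 ^+ 2) + 2 * lambda - Phip).

Definition W1 : R :=
  1 / c2 ^+ 2 * (2 * W0 - P1 + 4 * (lambda - 2 * expR (- c2 ^+ 2))).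

End Coefficients.

(* Main.v *)
(* For fixed t = e^2, rescale by y = x + e (a tau + b n): the spatial integral becomes
   exp(- alpha^2 t) times the mean of F(e a, e b), with F = f 1_Omega read in the frame
   (tau, n) at x, against the product of two Gaussian densities of variance 2. Near x the
   function F is a quadratic Taylor polynomial above the graph eta = q(xi) of the boundary and
   0 below it, where q(xi) = - r + kappa xi^2 / 2 + O(xi^3). Integrating in b first and expanding in e,
   all terms odd in a vanish, which leaves
     f N + e (2 f_eta - f kappa) g + e^2 (f_xixi + f_etaeta) N
       + (f_eta kappa - 3/4 f kappa^2 - f_etaeta) r e g + O(e^3),
   where g = gam (r / e) and N = tailg (- (r / e)). The time integrals of exp(- alpha^2 t) times N, e g
   and e^2 N are elementary in erfc and exp, and they are the coefficients W0, Q and W1.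

   For uniformity in the target, the bounds on the boundary graph come from compactness of the curve.
   The domain lies on one side of its boundary: the boundary points interior to the closure
   of Omega are open and closed in the curve, and if there is one, then the closure of Omega is
   the whole plane. The quadratic Taylor polynomial of f is obtained along three-legged
   axis-parallel paths, since segments may leave Omega when Omega is not convex. *)

Require Import Defs.
From HB Require Import structures.
From mathcomp Require Import all_boot all_order all_algebra.
From mathcomp Require Import all_classical all_reals all_analysis.
From mathcomp Require Import measurable_realfun.
From mathcomp Require Import ring lra.

Set Implicit Arguments.
Unset Strict Implicit.
Unset Printing Implicit Defensive.

Import Order.TTheory GRing.Theory Num.Theory.
Import numFieldNormedType.Exports.

Local Open Scope classical_set_scope.
Local Open Scope ring_scope.

(** * Derivatives and integrals of real functions *)

Section RealCalculus.
Context {R : realType}.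
Implicit Types (f df : R -> R) (a b x K : R).
Notation mu := (@lebesgue_measure R).

(** The ratio [r / e] is unbounded as [t] tends to 0 and may be small at later times, so nothing may
    be expanded in it. It stays exact inside [gam] and [tailg], and only the displacement of the
    graph is expanded; the remainders are uniform because [gam z], [z * gam z] and [z ^+ 2 * gam z]
    are bounded on the line. The graph must be known up to O(xi^4): after rescaling, an unspecified
    O(xi^3) would displace it by O(e^2), which is not negligible, whereas an explicit cubic term is
    cancelled by parity. Away from the target neither the graph nor the Taylor polynomial means
    anything; but there the distance is at least a constant, so a cubic remainder absorbs everything
    and the Gaussian weight integrates it. One-sidedness is a genuine obstacle because the boundary
    is closure minus interior, so a curve with the domain on both sides has to be excluded. This is
    done without the Jordan curve theorem, from the existence of a point outside the closure. *)

Lemma is_derive_continuous f x (l : R) : is_derive x 1 f l -> {for x, continuous f}.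
Proof.
by case=> /derivable1_diffP/differentiable_continuous.
Qed.

(** The segment is unordered because displacements of either sign occur later. *)
Lemma mean_value_bound f df a b K :
  (forall s, Num.min a b <= s <= Num.max a b -> is_derive s (1 : R) f (df s)) ->
  (forall s, Num.min a b <= s <= Num.max a b -> `|df s| <= K) ->
  `|f b - f a| <= K * `|b - a|.
Proof.
wlog ab : a b / a <= b => [wl H1 H2|].
  have [/wl|/ltW/wl] := leP a b; first exact.
  by rewrite minC maxC distrC (distrC b); apply.
rewrite (min_idPl ab) (max_idPr ab) => H1 H2.
have [c cab ->] : exists2 c, c \in `[a, b] & f b - f a = df c * (b - a).
  apply: MVT_segment => // [x xab|].
    by apply: H1; rewrite !ltW// (itvP xab).
  apply: continuous_in_subspaceT => x; rewrite inE/= in_itv/= => xab.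
  exact: is_derive_continuous (H1 _ xab).
rewrite normrM ler_wpM2r// H2//.
Qed.

Lemma continuous_measurable_itv f (i : interval R) : continuous f -> measurable_fun [set` i] f.
Proof. by move=> cf; apply: measurable_funTS; exact: continuous_measurable_fun. Qed.

Lemma FTC2_is_derive f F a b : a < b ->
  (forall x, a <= x <= b -> {for x, continuous f}) ->
  (forall x, a <= x <= b -> is_derive x (1 : R) F (f x)) ->
  \int[mu]_(x in `[a, b]) f x = F b - F a.
Proof.
move=> ab cf dF; rewrite /Rintegral (@continuous_FTC2 _ f F)//.
- apply: continuous_in_subspaceT => x; rewrite inE/= in_itv/=; exact: cf.
- split.
  + move=> x; rewrite in_itv/= => /andP[ax xb].
    by have [] := dF x; rewrite ?ltW.
  + apply: cvg_at_right_filter; apply: is_derive_continuous (dF a _).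
    by rewrite lexx ltW.
  + apply: cvg_at_left_filter; apply: is_derive_continuous (dF b _).
    by rewrite lexx ltW.
- move=> x; rewrite in_itv/= => /andP[ax xb]; rewrite derive1E.
  have axb : a <= x <= b by rewrite !ltW.
  by have [_ ->] := dF x axb.
Qed.

(** The integrand may change sign, so integrability is assumed and the limit of the truncations to
    [[a, a + n + 1]] is taken by dominated convergence. *)
Lemma FTC2y_is_derive f F a (l : R) :
  continuous f -> (forall x, is_derive x (1 : R) F (f x)) ->
  F x @[x --> +oo] --> l ->
  mu.-integrable `[a, +oo[ (EFin \o f) ->
  \int[mu]_(x in `[a, +oo[) f x = l - F a.
Proof.
move=> cf dF Fl fi.
pose f_ n : R -> \bar R := EFin \o (f \_ `[a, a + n.+1%:R]).
have H : (fun n => \int[mu]_(x in `[a, +oo[) f_ n x)%E @ \oo -->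
    (\int[mu]_(x in `[a, +oo[) (f x)%:E)%E.
  have [|||||//] := @dominated_convergence _ _ _ mu `[a, +oo[ (measurable_itv _)
    f_ (EFin \o f) (abse \o (EFin \o f)).
  - move=> n; apply/measurable_EFinP; apply/measurable_funTS.
    apply/(measurable_restrictT _ _).1 => //.
    exact: continuous_measurable_itv.
  - by apply/measurable_EFinP; exact: continuous_measurable_itv.
  - apply: aeW => x /=; rewrite in_itv/= andbT => ax.
    apply: cvg_near_cst; near=> n; rewrite /f_ /= /patch mem_set//=.
    rewrite in_itv/= ax/= -lerBlDl.
    rewrite (@le_trans _ _ n%:R)//; last by rewrite ler_nat.
    by near: n; exact: nbhs_infty_ger.
  - exact: integrable_abse.
  - apply: aeW => x n _ /=; rewrite lee_fin /patch; case: ifPn => // _.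
    by rewrite normr0.
have {}H : (fun n => (F (a + n.+1%:R) - F a)%:E) @ \oo -->
    (\int[mu]_(x in `[a, +oo[) (f x)%:E)%E.
  apply: cvg_trans H; apply: near_eq_cvg; near=> n.
  have lta : a < a + n.+1%:R by rewrite ltrDl.
  rewrite /f_ -(FTC2_is_derive lta (f := f))//=; last by move=> x _; exact: cf.
  rewrite /Rintegral fineK; last first.
    apply: integrable_fin_num => //; apply: integrableS fi => //.
    by move=> x/=; rewrite !in_itv/= => /andP[->].
  rewrite [LHS]integral_mkcond [RHS]integral_mkcond; apply: eq_integral => x _.
  rewrite /patch; case: ifPn => xa; last case: ifPn => xb //.
    by case: ifPn.
  move: xa xb; rewrite -[x \in _]/(x \in _) !mem_setE !in_itv/= andbT.
  by move=> /negP + /andP[].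
have Fa : (fun n => (F (a + n.+1%:R) - F a)%:E) @ \oo --> (l - F a)%:E.
  apply: cvg_EFin; first exact: nearW.
  apply: cvgB; last exact: cvg_cst.
  apply: cvg_comp Fl; apply/cvgryPge => A.
  near=> n; rewrite -lerBlDl (@le_trans _ _ n%:R)//; last by rewrite ler_nat.
  by near: n; exact: nbhs_infty_ger.
by rewrite /Rintegral (cvg_unique _ H Fa).
Unshelve. all: by end_near. Qed.

Notation erfc := (@erfc R).

Lemma gauss_integrable D : measurable D -> mu.-integrable D (EFin \o (fun s : R => expR (- s ^+ 2))).
Proof. by move=> mD; apply: integrableS (@integrableT_gauss R). Qed.

(** Splitting off the fixed tail from [z - 1] leaves an integral over [[z - 1, x]], which can be
    differentiated in its upper limit; the base point only has to lie to the left of [z]. *)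
Lemma is_derive_erfc (z : R) : is_derive z (1 : R) erfc (- (2 / Num.sqrt pi * expR (- z ^+ 2))).
Proof.
pose g := fun s : R => expR (- s ^+ 2).
have gi D := @gauss_integrable D.
have E x : z - 1 < x -> erfc x = erfc (z - 1) - 2 / Num.sqrt pi * \int[mu]_(s in `[z - 1, x]) g s.
  move=> zx; rewrite /Defs.erfc -mulrBr; congr (_ * _).
  rewrite -/g (@Rintegral_itvB _ _ _ _ x)//; last 2 first.
  - exact: gi.
  - by rewrite bnd_simp ltW.
  by rewrite Rintegral_itv_obnd_cbnd//; exact: gi.
have [dg dgE] : derivable (fun x => \int[mu]_(s in `[z - 1, x]) g s) z 1 /\
   derive1 (fun x => \int[mu]_(s in `[z - 1, x]) g s) z = g z.
  apply: (@continuous_FTC1_closed _ g (z - 1) z (z + 1)).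
  - by rewrite ltrDl.
  - exact: gi.
  - by rewrite gtrBl.
  - exact: continuous_gauss_fun.
apply: (@near_eq_is_derive _ _ _ (fun x => erfc (z - 1) - 2 / Num.sqrt pi * \int[mu]_(s in `[z - 1, x]) g s)).
- have Hz : \forall x \near z, z - 1 < x by exact: (@cvgr_gt _ _ _ _ id z cvg_id _ (ltac:(by rewrite gtrBl) : z - 1 < z)).
  by apply: filterS Hz => x zx; rewrite -E.
have ? : is_derive z (1 : R) (fun x => \int[mu]_(s in `[z - 1, x]) g s) (g z).
  by apply: DeriveDef; [exact: dg|rewrite -derive1E].
apply: is_derive_eq.
by rewrite add0r mul1r.
Unshelve. all: by end_near. Qed.

Lemma erfc_ge0 z : 0 <= erfc z.
Proof.
rewrite /Defs.erfc mulr_ge0 ?divr_ge0 ?sqrtr_ge0//.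
by apply: Rintegral_ge0 => x _; exact: expR_ge0.
Qed.

Lemma erfc0 : erfc 0 = 1.
Proof.
rewrite /Defs.erfc /Rintegral integral0y_gauss/=.
by rewrite mulrA divfK ?divff// gt_eqF// sqrtr_gt0 pi_gt0.
Qed.

Lemma erfcN z : erfc (- z) = 2 - erfc z.
Proof.
have H x : is_derive x (1 : R) (fun y => erfc y + erfc (- y)) 0.
  have H1 := is_derive_erfc x.
  have H2 := is_derive_erfc (- x).
  have H3 : is_derive x (1 : R) (fun y => erfc (- y)) (2 / Num.sqrt pi * expR (- x ^+ 2)).
    apply: is_derive_eq.
    by rewrite sqrrN mulrN1 opprK.
  by apply: is_derive_eq; rewrite addNr.
have := is_derive_0_is_cst z 0 H; rewrite oppr0 erfc0 => E.
lra.
Qed.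

Lemma erfc_le2 z : erfc z <= 2.
Proof. by have := erfc_ge0 (- z); rewrite erfcN subr_ge0. Qed.

Lemma erfc_cvgy : erfc x @[x --> +oo] --> (0 : R).
Proof.
(* For [s >= 1] one has [s <= s ^+ 2], and the tail of [expR (- s)] integrates exactly to
   [expR (- z)]. *)
have H (z : R) : 1 <= z -> erfc z <= 2 / Num.sqrt pi * expR (- z).
  move=> z1; rewrite /Defs.erfc ler_pM2l; last first.
    by rewrite divr_gt0// sqrtr_gt0 pi_gt0.
  have cexp : continuous (fun s : R => expR (- s)).
    by move=> s; apply: (@is_derive_continuous _ s (- expR (- s))); apply: is_derive_eq; rewrite mulrN1.
  have dexp (s : R) : is_derive s (1 : R) (fun s : R => - expR (- s)) (expR (- s)).
    by apply: is_derive_eq; rewrite mulrN1 opprK.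
  have lexp : (fun s : R => - expR (- s)) x @[x --> +oo] --> (0 : R).
    by rewrite -oppr0; apply: cvgN; exact: cvgr_expR.
  have E : (\int[mu]_(s in `[z, +oo[) (expR (- s))%:E = (expR (- z))%:E)%E.
    rewrite (@ge0_continuous_FTC2y _ _ (fun s : R => - expR (- s)) _ 0)//=.
    - by rewrite add0e opprK.
    - exact: continuous_subspaceT.
    - apply: cvg_at_right_filter; exact: is_derive_continuous (dexp z).
    - by move=> x _; rewrite derive1E; have [_ ->] := dexp x.
  rewrite /Rintegral -lee_fin fineK; last first.
    by apply: integrable_fin_num => //; exact: gauss_integrable.
  rewrite -E; apply: ge0_le_integral => //=.
  - apply/measurable_EFinP; apply: measurable_funTS; exact: measurable_gauss_fun.
  - by apply/measurable_EFinP; exact: continuous_measurable_itv.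
  - move=> x; rewrite in_itv/= andbT => zx; rewrite lee_fin ler_expR lerN2.
    by rewrite expr2 ler_peMl//; lra.
have : 2 / Num.sqrt pi * expR (- x) @[x --> +oo] --> 2 / Num.sqrt pi * (0 : R).
  by apply: cvgMr; exact: cvgr_expR.
rewrite mulr0 => Hc; apply: (@squeeze_cvgr _ _ _ _ (cst 0) (fun x : R => 2 / Num.sqrt pi * expR (- x))) => //; last exact: cvg_cst.
near=> x; rewrite erfc_ge0 H//; near: x; exact: nbhs_pinfty_ge.
Unshelve. all: by end_near. Qed.

(** The pushforward of Lebesgue measure under [c * x + d], scaled by [|c|], gives every interval
    []a, b]] its length, and this characterizes Lebesgue measure. *)
Lemma ge0_integral_affine (c d : R) (f : R -> \bar R) : c != 0 ->
  measurable_fun setT f -> (forall x, 0 <= f x)%E ->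
  (\int[mu]_x f x = `|c|%:E * \int[mu]_x f (c * x + d)%R)%E.
Proof.
move=> c0 mf f0.
pose T0 : R -> measurableTypeR R := fun x => c * x + d.
have mT : measurable_fun setT T0.
  by apply: measurable_funD => //; exact: measurable_funM.
pose m0 : {measure set (measurableTypeR R) -> \bar R} :=
  measure_function_pushforward__canonical__measure_function_Measure mu mT.
pose m := mscale (NngNum (normr_ge0 c)) m0.
have mE : forall A, measurable A -> mu A = m A.
  apply: lebesgue_measure_unique => //= _ [[a b]] _ <-/=.
  rewrite /m /mscale/= /pushforward.
  have [c_lt0|c_gt0|] := ltgtP c 0; last by move/eqP; rewrite (negbTE c0).
  - have -> : T0 @^-1` `]a, b] = `[(b - d) / c, (a - d) / c[%classic.
      apply/seteqP; split => x/=; rewrite !in_itv/= ler_ndivrMr// ltr_ndivlMr//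
        lerBrDr ltrBlDr mulrC andbC//.
    rewrite !lebesgue_measure_itv/= !lte_fin ltr_nM2r ?invr_lt0// ltrD2r.
    case: ifPn; last by rewrite mule0.
    by rewrite ltr0_norm// -!EFinD -EFinM => _; congr EFin; field.
  - have -> : T0 @^-1` `]a, b] = `](a - d) / c, (b - d) / c]%classic.
      apply/seteqP; split => x/=; rewrite !in_itv/= ler_pdivlMr// ltr_pdivrMr//
        lerBrDr ltrBlDr mulrC //.
    rewrite !lebesgue_measure_itv/= !lte_fin ltr_pM2r ?invr_gt0// ltrD2r.
    case: ifPn; last by rewrite mule0.
    by rewrite gtr0_norm// -!EFinD -EFinM => _; congr EFin; field.
rewrite (@eq_measure_integral _ _ _ _ m)//; last by move=> A mA _; exact: mE.
rewrite ge0_integral_mscale//; congr (_ * _)%E.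
have f0' : {in [set: R], forall y, (0 <= f y)%E} by move=> y _.
have H := @ge0_integral_pushforward _ _ (measurableTypeR R) (measurableTypeR R) R T0 mT mu setT f measurableT mf f0'.
exact: H.
Qed.

End RealCalculus.

(** * Changes of variables for signed integrands *)

Section ChangeOfVariables.
Context {R : realType} d1 d2 (T1 : measurableType d1) (T2 : measurableType d2).
Context (m1 : {measure set T1 -> \bar R}) (m2 : {measure set T2 -> \bar R}).
Context (k : R) (phi : T2 -> T1).
Hypothesis ge0_change : forall g : T1 -> \bar R, measurable_fun setT g ->
  (forall x, 0 <= g x)%E -> (\int[m1]_x g x = k%:E * \int[m2]_x g (phi x))%E.

(** The positive and negative parts are transformed separately. The abstract form serves both the
    affine maps of the line and the rescaled frames of the plane. *)
Lemma Rintegral_change (f : T1 -> R) : m1.-integrable setT (EFin \o f) ->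
    m2.-integrable setT (EFin \o (f \o phi)) ->
  \int[m1]_x f x = k * \int[m2]_x f (phi x).
Proof.
move=> fi fi2.
have mf := measurable_int _ fi.
have mp := measurable_funepos mf.
have mn := measurable_funeneg mf.
have pf2 := integrable_pos_fin_num measurableT fi2.
have nf2 := integrable_neg_fin_num measurableT fi2.
rewrite /Rintegral integralE [in RHS]integralE.
rewrite (ge0_change mp)// (ge0_change mn)//.
have aux (A B : \bar R) : A \is a fin_num -> B \is a fin_num ->
    fine (k%:E * A - k%:E * B) = k * fine (A - B).
  by move=> /fineK <- /fineK <-; rewrite -!EFinM -!EFinB/= mulrBr.
have Ep : (\int[m2]_x (EFin \o f)^\+ (phi x) =
    \int[m2]_x (EFin \o (f \o phi))^\+ x)%E.
  by apply: eq_integral => x _; rewrite !funeposE.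
have En : (\int[m2]_x (EFin \o f)^\- (phi x) =
    \int[m2]_x (EFin \o (f \o phi))^\- x)%E.
  by apply: eq_integral => x _; rewrite !funenegE.
by rewrite Ep En aux.
Qed.

End ChangeOfVariables.

(** * Gaussian moments and tails *)

Section Gaussian.
Context {R : realType}.
Notation mu := (@lebesgue_measure R).

Lemma Rintegral_affine (c d : R) (f : R -> R) : c != 0 ->
  mu.-integrable setT (EFin \o f) ->
  mu.-integrable setT (fun x => (f (c * x + d))%:E) ->
  \int[mu]_x f x = `|c| * \int[mu]_x f (c * x + d).
Proof.
move=> c0 fi fi2; apply: (@Rintegral_change _ _ _ _ _ mu mu `|c| (fun x => c * x + d)) => //.
by move=> g mg g0; exact: ge0_integral_affine.
Qed.

(* The heat kernel at time e^2 is gam (a / e) * gam (b / e) / e^2 at (a, b). *)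
Definition gam (a : R) : R := expR (- (a ^+ 2 / 4)) / (2 * Num.sqrt pi).
(** The mass beyond [z] of the centred normal law of variance 2, whose density is [gam]. *)
Definition tailg (z : R) : R := erfc (z / 2) / 2.
(* A weight that dominates all polynomials and that gam still integrates. *)
Definition om (a : R) : R := expR (a ^+ 2 / 8).

Lemma sqrtpi_gt0 : 0 < Num.sqrt (pi : R). Proof. by rewrite sqrtr_gt0 pi_gt0. Qed.
Hint Resolve sqrtpi_gt0 : core.

Lemma gam_gt0 a : 0 < gam a.
Proof. by rewrite divr_gt0 ?expR_gt0 ?mulr_gt0. Qed.

Lemma gam_ge0 a : 0 <= gam a. Proof. exact/ltW/gam_gt0. Qed.

Lemma is_derive_gam (a : R) : is_derive a (1 : R) gam (- (a / 2 * gam a)).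
Proof.
have D : is_derive a (1 : R) (fun a : R => - (a ^+ 2 / 4)) (- (a / 2)).
  by apply: is_derive_eq; rewrite -mulr_natl; unfold GRing.scale; simpl; field.
apply: is_derive_eq; rewrite /GRing.scale/= /gam; field.
by rewrite gt_eqF.
Qed.

Lemma is_derive_tailg (z : R) : is_derive z (1 : R) tailg (- gam z).
Proof.
have D := @is_derive_erfc R (z / 2).
apply: is_derive_eq; rewrite /GRing.scale/= /gam -[(z / 2) ^+ 2]/((z / 2) * (z / 2)).
have -> : z / 2 * (z / 2) = z ^+ 2 / 4 by field.
by field; rewrite gt_eqF.
Qed.

Lemma tailg_ge0 z : 0 <= tailg z. Proof. by rewrite divr_ge0// erfc_ge0. Qed.
Lemma tailg_le1 z : tailg z <= 1.
Proof. by rewrite ler_pdivrMr// mul1r erfc_le2. Qed.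
Lemma tailg0 : tailg 0 = 2^-1. Proof. by rewrite /tailg mul0r erfc0 mul1r. Qed.

Lemma tailg_cvgy : tailg z @[z --> +oo] --> (0 : R).
Proof.
rewrite /tailg -(mul0r 2^-1); apply: cvgMl.
apply: (@cvg_comp _ _ _ (fun z : R => z / 2) erfc) (@erfc_cvgy R).
by apply: gt0_cvgMly; rewrite ?invr_gt0.
Qed.

Lemma continuous_gam : continuous gam.
Proof. by move=> x; exact: is_derive_continuous (is_derive_gam x). Qed.

(** The exponents add up to [- a ^+ 2 / 8], which is, up to a constant, a normal density of standard
    deviation 2. *)
Lemma gam_om_integrable : mu.-integrable setT (fun a => (gam a * om a)%:E).
Proof.
have E a : gam a * om a = normal_pdf 0 2 a * (normal_peak 2)^-1 / (2 * Num.sqrt pi).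
  rewrite normal_pdfE; last by rewrite pnatr_eq0.
  rewrite /normal_fun subr0.
  rewrite [normal_peak 2 * _]mulrC mulfK; last by rewrite gt_eqF// normal_peak_gt0 ?pnatr_eq0.
  rewrite /gam /om mulrAC -expRD; congr (expR _ / _).
  by field.
under [X in _.-integrable _ X]eq_fun do rewrite E -mulrA EFinM.
by apply: integrableZr => //; exact: integrable_normal_pdf.
Qed.

Lemma pow_le_om k : exists2 C : R, 0 <= C & forall a : R, (1 + `|a|) ^+ k <= C * om a.
Proof.
exists (16 ^+ k * (k.+1`!%:R * expR 1)) => [|a].
  by rewrite !mulr_ge0 ?exprn_ge0 ?expR_ge0.
have a0 := normr_ge0 a.
set y := 1 + a ^+ 2 / 8.
have y1 : 1 <= y by rewrite lerDl divr_ge0// sqr_ge0.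
have H1 : 1 + `|a| <= 16 * y.
  rewrite /y -real_normK ?num_real//; nra.
have H2 : (1 + `|a|) ^+ k <= 16 ^+ k * y ^+ k.
  by rewrite -exprMn; apply: lerXn2r; rewrite ?nnegrE; lra.
apply: le_trans H2 _; rewrite -!mulrA ler_pM2l ?exprn_gt0// /om -expRD -/y.
have y0 : 0 <= y by lra.
have := @expR_ge1Dxn R y k y0 => H3.
have H4 : y ^+ k <= y ^+ k.+1 by rewrite exprS ler_peMl ?exprn_ge0.
apply: le_trans H4 _.
rewrite -ler_pdivrMl; last by rewrite ltr0n fact_gt0.
by rewrite mulrC; lra.
Qed.

Lemma gam_le1 a : gam a <= 1.
Proof.
rewrite ler_pdivrMr ?mulr_gt0// mul1r.
have : expR (- (a ^+ 2 / 4)) <= 1 by rewrite -expR0 ler_expR oppr_le0 divr_ge0// sqr_ge0.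
have : 1 <= Num.sqrt (pi : R) by rewrite -[leLHS]sqrtr1 ler_sqrt ?pi_ge0//; have := @pi_ge2 R; lra.
lra.
Qed.

Lemma dominated_integrable_R (D : set R) (f g : R -> R) : measurable D ->
  measurable_fun D f -> mu.-integrable D (EFin \o g) ->
  (forall x, D x -> `|f x| <= g x) -> mu.-integrable D (EFin \o f).
Proof.
move=> mD mf gi fg; apply: le_integrable gi => //; first exact/measurable_EFinP.
move=> x Dx /=; rewrite lee_fin; apply: le_trans (fg x Dx) _; exact: ler_norm.
Qed.

Lemma pow_gam_integrable k : mu.-integrable setT (fun a => (a ^+ k * gam a)%:E).
Proof.
have [C C0 HC] := pow_le_om k.
have Ci : mu.-integrable setT (EFin \o (fun a : R => C * (gam a * om a))).
  apply: (@integrableZl _ _ _ mu setT measurableT C) gam_om_integrable.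
apply: (@dominated_integrable_R setT (fun a => a ^+ k * gam a) _ _ _ Ci) => //.
  apply: measurable_funM; first exact: measurable_funX.
  apply: continuous_measurable_fun; exact: continuous_gam.
move=> a _; rewrite normrM (ger0_norm (gam_ge0 a)) [leRHS]mulrCA [leLHS]mulrC ler_pM2l ?gam_gt0//.
rewrite normrX; apply: le_trans (HC a); apply: lerXn2r; rewrite ?nnegrE ?addr_ge0//.
by rewrite lerDr.
Qed.

Lemma powgam_cvgy k : a ^+ k * gam a @[a --> +oo] --> (0 : R).
Proof.
have [C C0 HC] := pow_le_om k.
have L : C / (2 * Num.sqrt pi) * expR (- a) @[a --> +oo] --> (0 : R).
  by rewrite -(mulr0 (C / (2 * Num.sqrt pi))); apply: cvgMr; exact: cvgr_expR.
apply: (@squeeze_cvgr _ _ _ _ (cst 0) (fun a : R => C / (2 * Num.sqrt pi) * expR (- a))) => //; last exact: cvg_cst.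
(* From 8 on, [- a ^+ 2 / 4 + a ^+ 2 / 8 <= - a]. *)
near=> a; have a8 : 8 <= a by near: a; exact: nbhs_pinfty_ge.
have a0 : 0 <= a by lra.
rewrite mulr_ge0 ?exprn_ge0 ?gam_ge0//=.
apply: (@le_trans _ _ (C * om a * gam a)).
  rewrite ler_wpM2r ?gam_ge0//; apply: le_trans (HC a).
  by apply: lerXn2r; rewrite ?nnegrE ?addr_ge0// ger0_norm// lerDr.
rewrite /gam /om -!mulrA ler_wpM2l// mulrA mulrC ler_wpM2l ?invr_ge0//.
rewrite -expRD ler_expR.
nra.
Unshelve. all: by end_near. Qed.

Lemma gam_integrable D : measurable D -> mu.-integrable D (EFin \o gam).
Proof.
move=> mD; apply: (@integrableS _ _ _ mu setT) => //.
apply: eq_integrable (pow_gam_integrable 0) => // x _ /=.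
by rewrite expr0 mul1r.
Qed.

Lemma tail_moment0 z : \int[mu]_(b in `[z, +oo[) gam b = tailg z.
Proof.
have D (x : R) : is_derive x (1 : R) (fun x => - tailg x) (gam x).
  by have D := is_derive_tailg x; apply: is_derive_eq; rewrite opprK.
have L : - tailg x @[x --> +oo] --> (0 : R).
  by rewrite -oppr0; apply: cvgN; exact: tailg_cvgy.
rewrite (FTC2y_is_derive continuous_gam D L) ?add0r ?opprK//.
exact: gam_integrable.
Qed.

Lemma pow_gam_integrable_itv k z : mu.-integrable `[z, +oo[ (EFin \o (fun b => b ^+ k * gam b)).
Proof. by apply: integrableS (pow_gam_integrable k). Qed.

Lemma continuous_pow_gam k : continuous (fun b : R => b ^+ k * gam b).
Proof.
by move=> x; apply: cvgM; [exact: exprn_continuous|exact: continuous_gam].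
Qed.

(** The antiderivatives in this and the next moments come from [gam' = - (b / 2) * gam]: each
    integration by parts lowers the power by two and ends at [gam] or at [tailg]. *)
Lemma tail_moment1 z : \int[mu]_(b in `[z, +oo[) (b ^+ 1 * gam b) = 2 * gam z.
Proof.
have D (x : R) : is_derive x (1 : R) (fun x => - 2 * gam x) (x ^+ 1 * gam x).
  by have D := is_derive_gam x; apply: is_derive_eq; rewrite /GRing.scale/=; field.
have L : - 2 * gam x @[x --> +oo] --> (0 : R).
  rewrite -(mulr0 (- 2)); apply: cvgMr.
  have := powgam_cvgy 0; apply: cvg_trans; apply: near_eq_cvg; near=> a.
  by rewrite expr0 mul1r.
rewrite (FTC2y_is_derive (@continuous_pow_gam 1) D L); first lra.
exact: pow_gam_integrable_itv.
Unshelve. all: by end_near. Qed.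

Lemma tail_moment2 z :
  \int[mu]_(b in `[z, +oo[) (b ^+ 2 * gam b) = 2 * z * gam z + 2 * tailg z.
Proof.
have D (x : R) : is_derive x (1 : R)
    (fun x => - 2 * (x ^+ 1 * gam x) - 2 * tailg x) (x ^+ 2 * gam x).
  have D := is_derive_gam x; have D' := is_derive_tailg x.
  by apply: is_derive_eq; rewrite /GRing.scale/=; field.
have L : - 2 * (x ^+ 1 * gam x) - 2 * tailg x @[x --> +oo] --> (0 : R).
  rewrite -[X in _ --> X](_ : - 2 * 0 - 2 * 0 = 0); last lra.
  by apply: cvgB; apply: cvgMr; [exact: powgam_cvgy|exact: tailg_cvgy].
rewrite (FTC2y_is_derive (@continuous_pow_gam 2) D L); first lra.
exact: pow_gam_integrable_itv.
Qed.

Lemma tail_moment4 : \int[mu]_(b in `[0, +oo[) (b ^+ 4 * gam b) = 6.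
Proof.
have D (x : R) : is_derive x (1 : R)
    (fun x => - 2 * (x ^+ 3 * gam x) - 12 * (x ^+ 1 * gam x) - 12 * tailg x)
    (x ^+ 4 * gam x).
  have D := is_derive_gam x; have D' := is_derive_tailg x.
  by apply: is_derive_eq; rewrite /GRing.scale/=; field.
have L : - 2 * (x ^+ 3 * gam x) - 12 * (x ^+ 1 * gam x) - 12 * tailg x
    @[x --> +oo] --> (0 : R).
  rewrite -[X in _ --> X](_ : - 2 * 0 - 12 * 0 - 12 * 0 = 0); last lra.
  by apply: cvgB; [apply: cvgB|]; apply: cvgMr;
    [exact: powgam_cvgy|exact: powgam_cvgy|exact: tailg_cvgy].
rewrite (FTC2y_is_derive (@continuous_pow_gam 4) D L).
  by rewrite !expr0n/= tailg0; lra.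
exact: pow_gam_integrable_itv.
Qed.

Lemma gamN a : gam (- a) = gam a. Proof. by rewrite /gam sqrrN. Qed.

Lemma even_moment k : ~~ odd k ->
  \int[mu]_a (a ^+ k * gam a) = 2 * \int[mu]_(a in `[0, +oo[) (a ^+ k * gam a).
Proof.
move=> ke; rewrite /Rintegral ge0_symfun_integralT/=.
- rewrite (_ : [set x | _] = `[0, +oo[%classic); last first.
    by apply/seteqP; split => x/=; rewrite in_itv/= andbT.
  rewrite fineM//; apply: integrable_fin_num => //; exact: pow_gam_integrable_itv.
- by move=> x; rewrite mulr_ge0 ?gam_ge0// exprn_even_ge0.
- exact: continuous_pow_gam.
- by move=> x /=; rewrite gamN exprNn -signr_odd (negbTE ke) mul1r.
Qed.

Lemma odd_moment k : odd k -> \int[mu]_a (a ^+ k * gam a) = 0.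
Proof.
move=> ko; have := @Rintegral_affine (-1) 0 (fun a => a ^+ k * gam a).
have E a : (-1 * a + 0) ^+ k * gam (-1 * a + 0) = - (a ^+ k * gam a).
  by rewrite mulN1r addr0 gamN exprNn -signr_odd ko expr1 -mulrA mulN1r.
have i1 := pow_gam_integrable k.
have i2 : mu.-integrable setT (fun x => ((-1 * x + 0) ^+ k * gam (-1 * x + 0))%:E).
  under [X in _.-integrable _ X]eq_fun do rewrite E EFinN.
  exact: integrableN.
move=> /(_ _ i1 i2); rewrite oppr_eq0 oner_eq0 => /(_ isT).
under [X in _ = _ * X]eq_Rintegral do rewrite E -mulN1r.
rewrite RintegralZl// normrN1; lra.
Qed.

End Gaussian.

(** * Integration in the plane *)

Section PlaneMeasure.
Context {R : realType}.
Notation mu := (@lebesgue_measure R).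
Notation lam := (mu \x mu)%E.

(** The product sigma-algebra is generated by rectangles, so the open set is written as the
    countable union of the rational squares that it contains. The half-side is below [e / 2] so that
    a square around a nearby rational centre stays in the ball of radius [e]. *)
Lemma open_measurable_plane (O : set (R * R)) : open O -> measurable O.
Proof.
move=> oO.
pose S (a b e : rat) : set (R * R) := ball (ratr a : R) (ratr e) `*` ball (ratr b : R) (ratr e).
have -> : O = \bigcup_a \bigcup_b \bigcup_e
    (if `[< S a b e `<=` O >] then S a b e else set0).
  apply/seteqP; split => [[x y] Oxy|]; last first.
    by move=> z [a _ [b _ [e _]]]; case: asboolP => // + Sz; exact.
  have /nbhs_ballP[e /= e0 He] : nbhs (x, y) O by exact: open_nbhs_nbhs.
  have [e2 /andP[e20 e2e]] : exists q : rat, 0 < (ratr q : R) < e / 2.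
    have [q] := rat_in_itvoo (divr_gt0 e0 (ltr0n _ 2)).
    by rewrite in_itv/=; exists q.
  have near_rat (u : R) : exists a : rat, `|u - ratr a| < ratr e2.
    have [a] := @rat_in_itvoo _ (u - ratr e2) (u + ratr e2) ltac:(lra).
    by rewrite in_itv/= => ua; exists a; rewrite ltr_distl; lra.
  have [[a xa] [b yb]] := (near_rat x, near_rat y).
  exists a => //; exists b => //; exists e2 => //.
  rewrite asboolT.
    by split; rewrite /ball/= distrC.
  move=> [x' y'] [/= ax by']; apply: He; split; rewrite /= /ball_/=.
    apply: le_ball (ball_triangle (y := ratr a : R) xa ax); lra.
  apply: le_ball (ball_triangle (y := ratr b : R) yb by'); lra.
apply: bigcupT_measurable_rat => a; apply: bigcupT_measurable_rat => b.
apply: bigcupT_measurable_rat => e; case: asboolP => // _.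
by apply: measurableX; exact: measurable_ball.
Qed.

Lemma open_continuous_measurable_plane (O : set (R * R)) (f : R * R -> R) :
  open O -> (forall p, O p -> {for p, continuous f}) -> measurable_fun O f.
Proof.
move=> oO cf; apply: (measurability _ (RGenOpens.measurableE R)).
move=> _ [_ [a [b ->] <-]]; apply: open_measurable_plane.
rewrite openE => p [Op fp].
have /cf cfp := Op; rewrite /interior; apply: filterI; first exact: open_nbhs_nbhs.
apply: cfp; apply: open_nbhs_nbhs; split => //; exact: interval_open.
Qed.

(** Tonelli's theorem gives the measurability for the positive and the negative part, and the
    integral is their difference; no integrability enters. *)
Lemma measurable_parameter_integral d1 d (T1 : measurableType d1) (T : measurableType d)
    (f : T1 * T -> \bar R)
    (m : {sigma_finite_measure set T -> \bar R}) :
  measurable_fun setT f -> measurable_fun setT (fun t => \int[m]_y f (t, y))%E.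
Proof.
move=> mf.
have -> : (fun t => \int[m]_y f (t, y))%E =
    ((fun t => \int[m]_y (f^\+ (t, y))) \- (fun t => \int[m]_y (f^\- (t, y))))%E.
  apply/funext => t; rewrite integralE.
  by congr (_ - _)%E; apply: eq_integral => y _; rewrite ?funeposE ?funenegE.
apply: emeasurable_funB.
  apply: (measurable_fun_fubini_tonelli_F (m2 := m) (f^\+%E)) => //.
  exact: measurable_funepos.
apply: (measurable_fun_fubini_tonelli_F (m2 := m) (f^\-%E)) => //.
exact: measurable_funeneg.
Qed.

Lemma integral_swap (g : R * R -> \bar R) : measurable_fun setT g ->
  (forall z, 0 <= g z)%E -> (\int[lam]_z g (z.2, z.1) = \int[lam]_z g z)%E.
Proof.
move=> mg g0.
rewrite (fubini_tonelli1 (m1 := mu) (m2 := mu) g)// fubini_tonelli2//=.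
by apply: measurableT_comp mg _; apply: measurable_fun_pair.
Qed.

(** Gaussian elimination with pivot [p]: for a fixed first coordinate the second one is changed
    affinely with factor [D / p], then the first one with factor [p], so that only one-dimensional
    changes of variable are used. *)
Let ge0_integral_linear_aux (x1 x2 p q s w : R) (g : R * R -> \bar R) :
  p != 0 -> p * w - q * s != 0 ->
  measurable_fun setT g -> (forall z, 0 <= g z)%E ->
  (\int[lam]_z g z = `|p * w - q * s|%:E *
    \int[lam]_z g (x1 + p * z.1 + q * z.2, x2 + s * z.1 + w * z.2)%R)%E.
Proof.
move=> p0 D0 mg g0; set D := p * w - q * s.
have Dp0 : D / p != 0 by rewrite mulf_neq0// invr_neq0.
pose g1 (z : R * R) := g (z.1, D / p * z.2 + (x2 + s / p * (z.1 - x1))).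
have mg1 : measurable_fun setT g1.
  apply: measurableT_comp mg _; apply: measurable_fun_pair => //.
  apply: measurable_funD; first exact: measurable_funM.
  by apply: measurable_funD => //; apply: measurable_funM => //; exact: measurable_funB.
pose g2 (z : R * R) := g1 (p * z.1 + (x1 + q * z.2), z.2).
have mg2 : measurable_fun setT g2.
  apply: measurableT_comp mg1 _; apply: measurable_fun_pair => //.
  apply: measurable_funD; first exact: measurable_funM.
  by apply: measurable_funD => //; exact: measurable_funM.
transitivity (`|D / p|%:E * \int[lam]_z g1 z)%E.
  rewrite (fubini_tonelli1 (m1 := mu) (m2 := mu) g)//.
  rewrite (fubini_tonelli1 (m1 := mu) (m2 := mu) g1)//; last by move=> z; exact: g0.
  rewrite -ge0_integralZl//; last 2 first.
  - by apply: measurable_fun_fubini_tonelli_F => // z; exact: g0.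
  - by move=> x _; apply: integral_ge0 => y _; exact: g0.
  apply: eq_integral => x _; rewrite /fubini_F.
  rewrite (@ge0_integral_affine _ (D / p) (x2 + s / p * (x - x1)))//.
  exact: measurableT_comp mg (measurable_pair1 _).
transitivity (`|D / p|%:E * (`|p|%:E * \int[lam]_z g2 z))%E.
  congr (_ * _)%E.
  rewrite (fubini_tonelli2 (m1 := mu) (m2 := mu) g1)//; last by move=> z; exact: g0.
  rewrite (fubini_tonelli2 (m1 := mu) (m2 := mu) g2)//; last by move=> z; exact: g0.
  rewrite -ge0_integralZl//; last 2 first.
  - by apply: measurable_fun_fubini_tonelli_G => // z; exact: g0.
  - by move=> x _; apply: integral_ge0 => y _; exact: g0.
  apply: eq_integral => y _; rewrite /fubini_G.
  rewrite (@ge0_integral_affine _ p (x1 + q * y))//; last by move=> z; exact: g0.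
  exact: measurableT_comp mg1 (measurable_pair2 _).
rewrite muleA -EFinM -normrM divfK//; congr (_ * _)%E.
apply: eq_integral => z _; rewrite /g2 /g1/= /D; congr (g (_, _)); first by rewrite addrCA addrA.
by field.
Qed.

Lemma ge0_integral_linear (x1 x2 p q s w : R) (g : R * R -> \bar R) :
  p * w - q * s != 0 ->
  measurable_fun setT g -> (forall z, 0 <= g z)%E ->
  (\int[lam]_z g z = `|p * w - q * s|%:E *
    \int[lam]_z g (x1 + p * z.1 + q * z.2, x2 + s * z.1 + w * z.2)%R)%E.
Proof.
move=> D0 mg g0; have [p0|p0] := eqVneq p 0; last exact: ge0_integral_linear_aux.
(* With a zero pivot the columns are exchanged, which costs a swap of the integration variables. *)
have q0 : q != 0 by apply: contraNneq D0 => ->; rewrite p0 !mul0r subr0.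
have D0' : q * s - p * w != 0 by rewrite -opprB oppr_eq0.
rewrite (@ge0_integral_linear_aux x1 x2 q p w s)// -normrN opprB.
rewrite -[in RHS]integral_swap.
- by congr (_ * _)%E; apply: eq_integral => z _ /=; rewrite addrAC (addrAC x2).
- apply: measurableT_comp mg _; apply: measurable_fun_pair.
    apply: measurable_funD; last exact: measurable_funM.
    by apply: measurable_funD => //; exact: measurable_funM.
  apply: measurable_funD; last exact: measurable_funM.
  by apply: measurable_funD => //; exact: measurable_funM.
- by move=> z; exact: g0.
Qed.

End PlaneMeasure.

(** * Expansion of the Gaussian mean *)

Section LocalExpansion.
Context {R : realType}.
Notation mu := (@lebesgue_measure R).
Notation lam := (mu \x mu)%E.
Implicit Types (a b z e r be K M k g f : R).

Lemma ler_normM2 (x y X Y : R) : `|x| <= X -> `|y| <= Y -> `|x * y| <= X * Y.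
Proof. by move=> hx hy; rewrite normrM ler_pM. Qed.

Lemma ler_normD2 (x y X Y : R) : `|x| <= X -> `|y| <= Y -> `|x + y| <= X + Y.
Proof. by move=> hx hy; rewrite (le_trans (ler_normD _ _))// lerD. Qed.

Lemma norm_sub_between (a b x : R) :
  Num.min a b <= x <= Num.max a b -> `|x - a| <= `|b - a|.
Proof.
have [ab|/ltW ab] := leP a b; rewrite ?(min_idPl ab) ?(max_idPr ab) ?(min_idPr ab) ?(max_idPl ab).
  by move=> /andP[ax xb]; rewrite !ger0_norm ?subr_ge0// ?(le_trans ax)// lerD2r.
by move=> /andP[bx xa]; rewrite !ler0_norm ?subr_le0// lerN2 lerD2r.
Qed.

Lemma norm_between (x y : R) : Num.min 0 y <= x <= Num.max 0 y -> `|x| <= `|y|.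
Proof. by move=> /norm_sub_between; rewrite !subr0. Qed.

Lemma norm_mul_gam_le1 z : `|z| * gam z <= 1.
Proof.
have H : `|z| * expR (- (z ^+ 2 / 4)) <= 1.
  rewrite expRN ler_pdivrMr ?expR_gt0// mul1r.
  apply: le_trans (expR_ge1Dx _); rewrite -real_normK ?num_real//.
  by have := sqr_ge0 (`|z| / 2 - 1); nra.
rewrite /gam mulrA ler_pdivrMr ?mulr_gt0 ?sqrtpi_gt0// mul1r.
apply: le_trans H _.
have : 1 <= Num.sqrt (pi : R).
  by rewrite -[leLHS]sqrtr1 ler_sqrt ?pi_ge0//; have := @pi_ge2 R; lra.
lra.
Qed.

Lemma sqr_mul_gam_le4 z : z ^+ 2 * gam z <= 4.
Proof.
have H : z ^+ 2 * expR (- (z ^+ 2 / 4)) <= 4.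
  rewrite expRN ler_pdivrMr ?expR_gt0//.
  by have := expR_ge1Dx (z ^+ 2 / 4); have := sqr_ge0 z; lra.
rewrite /gam mulrA ler_pdivrMr ?mulr_gt0 ?sqrtpi_gt0//.
apply: le_trans H _.
have : 1 <= Num.sqrt (pi : R).
  by rewrite -[leLHS]sqrtr1 ler_sqrt ?pi_ge0//; have := @pi_ge2 R; lra.
lra.
Qed.

Lemma is_derive_mulgam (x : R) :
  is_derive x (1 : R) (fun x => x / 2 * gam x) (2^-1 * gam x - x ^+ 2 / 4 * gam x).
Proof.
have D := is_derive_gam x.
by apply: is_derive_eq; rewrite /GRing.scale/=; field.
Qed.

(** The bound covers all displacements up to [p] because it is used as a derivative bound along the
    segment from 0 to [p] in [tailg_taylor2]. *)
Lemma gam_taylor1 (z p s' : R) : `|s'| <= `|p| ->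
  `|gam (z + s') - (gam z - s' * (z / 2 * gam z))| <= 2 * `|p| * `|p|.
Proof.
have H2 s : `|s| <= `|p| -> `|(z + s) / 2 * gam (z + s) - z / 2 * gam z| <= 2 * `|p|.
    have : `|(z + s) / 2 * gam (z + s) - z / 2 * gam z| <= 2 * `|z + s - z|.
    apply: (@mean_value_bound R (fun x => x / 2 * gam x)
      (fun x => 2^-1 * gam x - x ^+ 2 / 4 * gam x) z (z + s)) => x _.
      exact: is_derive_mulgam.
    have := @sqr_mul_gam_le4 x; have := gam_ge0 x; have := gam_le1 x; have := sqr_ge0 x.
    move=> x0 g1 g0 h4.
    have : 0 <= x ^+ 2 * gam x by exact: mulr_ge0.
    by rewrite ler_norml; lra.
  have -> : z + s - z = s by ring.
  lra.
move: s' => s sp.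
  have : `|(gam (z + s) + s * (z / 2 * gam z)) - (gam (z + 0) + 0 * (z / 2 * gam z))| <= 2 * `|p| * `|s - 0|.
    apply: (@mean_value_bound R (fun x => gam (z + x) + x * (z / 2 * gam z))
      (fun x => - ((z + x) / 2 * gam (z + x)) + z / 2 * gam z) 0 s) => x xs.
      have D := is_derive_gam (z + x).
      by apply: is_derive_eq; rewrite /GRing.scale/=; field.
    rewrite addrC distrC; apply: H2; apply: le_trans sp.
    exact: norm_between.
  rewrite subr0 mul0r !addr0 opprB addrA => H; apply: le_trans H _.
  by rewrite ler_wpM2l// mulr_ge0.
Qed.

(** Only [gam <= 1] and [x ^+ 2 * gam x <= 4] enter, so the constant does not depend on [z]; this
    gives uniformity in [r / e], for [z] will be [- (r / e)]. *)
Lemma tailg_taylor2 (z p : R) :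
  `|tailg (z + p) - (tailg z - p * gam z + p ^+ 2 / 2 * (z / 2 * gam z))| <= 2 * `|p| ^+ 3.
Proof.
have : `|(tailg (z + p) + p * gam z - p ^+ 2 / 2 * (z / 2 * gam z)) -
        (tailg (z + 0) + 0 * gam z - 0 ^+ 2 / 2 * (z / 2 * gam z))| <= 2 * `|p| * `|p| * `|p - 0|.
  apply: (@mean_value_bound R
    (fun x => tailg (z + x) + x * gam z - x ^+ 2 / 2 * (z / 2 * gam z))
    (fun x => - (gam (z + x) - (gam z - x * (z / 2 * gam z)))) 0 p) => x xs.
    have D := is_derive_tailg (z + x).
    by apply: is_derive_eq; rewrite /GRing.scale/=; field.
  by rewrite normrN; apply: gam_taylor1; exact: norm_between.
rewrite subr0 !addr0 mul0r expr0n/= !mul0r addr0 subr0.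
have -> : tailg (z + p) - (tailg z - p * gam z + p ^+ 2 / 2 * (z / 2 * gam z)) =
  tailg (z + p) + p * gam z - p ^+ 2 / 2 * (z / 2 * gam z) - tailg z by ring.
by have -> : 2 * `|p| ^+ 3 = 2 * `|p| * `|p| * `|p| by ring.
Qed.

(** First order is enough here: in [slice] this function carries the factor [e ^+ 2], and the
    displacement is itself of order [e]. *)
Lemma second_moment_tail_lipschitz (z p : R) :
  `|(2 * (z + p) * gam (z + p) + 2 * tailg (z + p)) - (2 * z * gam z + 2 * tailg z)|
    <= 4 * `|p|.
Proof.
have -> : `|p| = `|z + p - z| by congr (`|_|); ring.
apply: (@mean_value_bound R (fun z => 2 * z * gam z + 2 * tailg z)
   (fun z => - (z ^+ 2 * gam z)) z (z + p)) => x _.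
  have D := is_derive_gam x; have D' := is_derive_tailg x.
  by apply: is_derive_eq; rewrite /GRing.scale/=; field.
rewrite normrN ger0_norm ?sqr_mul_gam_le4//.
by rewrite mulr_ge0 ?sqr_ge0 ?gam_ge0.
Qed.

Definition quad (f0 f1 f2 f11 f12 f22 u v : R) :=
  f0 + f1 * u + f2 * v + f11 / 2 * u ^+ 2 + f12 * u * v + f22 / 2 * v ^+ 2.

Section Coefs.
Variables (f0 f1 f2 f11 f12 f22 k g : R).

(* The integral of gam b * quad f0 .. f22 (e * a) (e * b) over b > z. *)
Definition slice e a z :=
  (f0 + e * f1 * a + e ^+ 2 * f11 / 2 * a ^+ 2) * tailg z
  + (e * f2 + e ^+ 2 * f12 * a) * (2 * gam z)
  + e ^+ 2 * f22 / 2 * (2 * z * gam z + 2 * tailg z).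

(** The coefficients of the powers of [a] when [slice] is expanded about [- be], with [be] standing
    for [r / e], and all terms beyond [e ^+ 2] are dropped. Factors [be] are kept although [e * be]
    is just [r]. *)
Definition slice_coef be e : seq R :=
  let N := tailg (- be) in let G := gam be in
  [:: f0 * N + 2 * e * f2 * G + e ^+ 2 * f22 * (N - be * G);
      e * f1 * N + 2 * e ^+ 2 * f12 * G;
      - (e * f0 * k / 2 * G) + e ^+ 2 * f11 / 2 * N + e ^+ 2 * f2 * k * be / 2 * G;
      - (e ^+ 2 * G * (f1 * k / 2 + f0 * g / 6));
      - (e ^+ 2 * f0 * be * G * k ^+ 2 / 16)].

Definition slice_approx be e a :=
  \sum_(i < 5) (slice_coef be e)`_i * a ^+ i.

End Coefs.

(** The exponents 4 and 11 are those of the worst product: the polynomial part [T0], of order [M]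
    and [A ^+ 2], times the cubic remainder of [tailg], of order [M ^+ 3] and [A ^+ 9]. *)
Lemma slice_approx_bound f0 f1 f2 f11 f12 f22 k g M be e a : 1 <= M ->
  `|f0| <= M -> `|f1| <= M -> `|f2| <= M -> `|f11| <= M -> `|f12| <= M ->
  `|f22| <= M -> `|k| <= M -> `|g| <= M -> 0 <= be -> 0 < e <= 1 ->
  `|slice f0 f1 f2 f11 f12 f22 e a
      (- be + (e * k / 2 * a ^+ 2 + e ^+ 2 * g / 6 * a ^+ 3))
     - slice_approx f0 f1 f2 f11 f12 f22 k g be e a|
  <= 100 * M ^+ 4 * e ^+ 3 * (1 + `|a|) ^+ 11.
Proof.
move=> M1 f0b f1b f2b f11b f12b f22b kb gb be0 /andP[e0 e1].
have M0 : 0 <= M by exact: le_trans ler01 M1.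
set p := e * k / 2 * a ^+ 2 + _; pose A : R := 1 + `|a|; rewrite -/A.
have A1 : 1 <= A by rewrite lerDl.
(* [bd x c i j m] records the orders of [x] in [M], [e] and [A]; products add the orders. As [M] and
   [A] are at least 1 and [e] at most 1, orders in [M] and [A] may be raised and those in [e]
   lowered. *)
pose bd (x c : R) i j m := `|x| <= c * (M ^+ i * e ^+ j * A ^+ m).
have bdM x y c c' i j m i' j' m' : bd x c i j m -> bd y c' i' j' m' ->
    bd (x * y) (c * c') (i + i')%N (j + j')%N (m + m')%N.
  move=> hx hy; rewrite /bd; apply: le_trans (ler_normM2 hx hy) _.
  by rewrite !exprD le_eqVlt; apply/orP; left; apply/eqP; ring.
have bdW i j m i' j' m' x c c' : bd x c i j m -> (i <= i')%N -> (j' <= j)%N -> (m <= m')%N ->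
    0 <= c -> c <= c' -> bd x c' i' j' m'.
  move=> hx ii jj mm c0 cc; apply: le_trans hx _.
  have e0' : 0 <= e by exact: ltW.
  have A0 : 0 <= A by exact: le_trans ler01 A1.
  apply: ler_pM => //; first by rewrite !mulr_ge0 ?exprn_ge0.
  apply: ler_pM; rewrite ?mulr_ge0 ?exprn_ge0//; last exact: ler_weXn2l.
  by apply: ler_pM; rewrite ?exprn_ge0//; [exact: ler_weXn2l|exact: ler_wiXn2l].
have bdD x y c c' i j m : bd x c i j m -> bd y c' i j m -> bd (x + y) (c + c') i j m.
  by move=> hx hy; rewrite /bd mulrDl; exact: ler_normD2.
have bdN x c i j m : bd x c i j m -> bd (- x) c i j m by rewrite /bd normrN.
have bdC (x c : R) : `|x| <= c -> bd x c 0%N 0%N 0%N by rewrite /bd !expr0 !mulr1.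
have bdA n : bd (a ^+ n) 1 0%N 0%N n.
  rewrite /bd !expr0 !mul1r normrX; apply: lerXn2r; rewrite ?nnegrE//; first lra.
  by rewrite lerDr.
have bdE n : bd (e ^+ n) 1 0%N n 0%N.
  by rewrite /bd !expr0 !mul1r mulr1 ger0_norm// exprn_ge0// ltW.
have bdP x : `|x| <= M -> bd x 1 1%N 0%N 0%N by rewrite /bd !expr0 !mulr1 mul1r expr1.
have half : bd 2^-1 2^-1 0%N 0%N 0%N by apply: bdC; rewrite ger0_norm.
have bda : bd a 1 0%N 0%N 1%N by rewrite -[a]expr1.
have bde : bd e 1 0%N 1%N 0%N by rewrite -[e]expr1.
set q := e * k / 2 * a ^+ 2.
set h := e ^+ 2 * g / 6 * a ^+ 3.
have qb : bd q (1 * 1 * 2^-1 * 1) 1%N 1%N 2%N.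
  by apply: (bdM _ _ _ _ 1 1 0 0 0 2)%N; [apply: (bdM _ _ _ _ 1 1 0 0 0 0)%N; [apply: (bdM _ _ _ _ 0 1 0 1 0 0)%N => //; exact: bdP|]|].
have hb : bd h (1 * 1 * 6^-1 * 1) 1%N 2%N 3%N.
  apply: (bdM _ _ _ _ 1 2 0 0 0 3)%N => //; apply: (bdM _ _ _ _ 1 2 0 0 0 0)%N.
    by apply: (bdM _ _ _ _ 0 2 0 1 0 0)%N => //; exact: bdP.
  by apply: bdC; rewrite ger0_norm.
have pE : p = q + h by [].
have qb' : bd q 2^-1 1%N 1%N 3%N by apply: (bdW _ _ _ _ _ _ _ _ _ qb) => //; clear; lra.
have hb' : bd h 2^-1 1%N 1%N 3%N by apply: (bdW _ _ _ _ _ _ _ _ _ hb) => //; clear; lra.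
have pb : bd p 1 1%N 1%N 3%N.
  by apply: (bdW _ _ _ _ _ _ _ _ _ (bdD _ _ _ _ _ _ _ qb' hb')) => //; clear; lra.
set N := tailg (- be); set G := gam be.
have G0 : 0 <= G by exact: gam_ge0.
have G1 : G <= 1 by exact: gam_le1.
have bG : be * G <= 1 by have := norm_mul_gam_le1 be; rewrite ger0_norm.
have bG0 : 0 <= be * G by rewrite mulr_ge0.
have Gb : bd G 1 0%N 0%N 0%N by apply: bdC; rewrite ger0_norm.
have BGb : bd (be * G) 1 0%N 0%N 0%N by apply: bdC; rewrite ger0_norm.
have := tailg_taylor2 (- be) p; have := @gam_taylor1 (- be) p p (lexx _).
have := second_moment_tail_lipschitz (- be) p.
rewrite gamN -/N -/G.
set R2 := (X in `|X| <= 4 * _); set R1 := (X in `|X| <= 2 * _ * _).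
set R0 := (X in `|X| <= 2 * _ ^+ 3) => H2 H1 H0.
have R2b : bd R2 (4 * 1) 1%N 1%N 3%N.
  by apply: le_trans H2 _; rewrite -mulrA ler_pM2l.
have p2b := bdM _ _ _ _ _ _ _ _ _ _ pb pb.
have p3b := bdM _ _ _ _ _ _ _ _ _ _ pb p2b.
have R1b : bd R1 (2 * (1 * 1)) 2%N 2%N 6%N.
  apply: le_trans H1 _; rewrite -[2 * _ * _]mulrA.
  by rewrite -[2 * (1 * 1) * _]mulrA ler_pM2l// -normrM.
have R0b : bd R0 (2 * (1 * (1 * 1))) 3%N 3%N 9%N.
  apply: le_trans H0 _; rewrite -[2 * _ * _]mulrA ler_pM2l// -normrX.
  by rewrite (_ : p ^+ 3 = p * (p * p)) //; ring.
set T0 := f0 + e * f1 * a + e ^+ 2 * f11 / 2 * a ^+ 2.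
set T1 := e * f2 + e ^+ 2 * f12 * a.
(* An exact identity: [R0], [R1], [R2] are the remainders of [tailg], [gam] and the second tail
   moment, and the other terms are the products that [slice_approx] discards. Each summand is of
   order at least 3 in [e]. *)
rewrite -/p; have -> : slice f0 f1 f2 f11 f12 f22 e a (- be + p)
    - slice_approx f0 f1 f2 f11 f12 f22 k g be e a =
  T0 * R0 + T1 * (2 * R1) + e ^+ 2 * f22 / 2 * R2
  - G * (e * f1 * a * h + e ^+ 2 * f11 / 2 * a ^+ 2 * p)
  - be * G / 4 * (f0 * (h * (p + q)) + (T0 - f0) * p ^+ 2)
  + be * G * (e * f2 * h + e ^+ 2 * f12 * a * p).
  rewrite /slice /slice_approx !big_ord_recl big_ord0/= /R0 /R1 /R2 /T0 /T1 pE /q /h -/N -/G.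
  by field.
have T0b' : bd (T0 - f0) 2 1%N 1%N 2%N.
  have -> : T0 - f0 = e * f1 * a + e ^+ 2 * f11 * 2^-1 * a ^+ 2 by rewrite /T0; ring.
  have h1 := bdM _ _ _ _ _ _ _ _ _ _ (bdM _ _ _ _ _ _ _ _ _ _ bde (bdP _ f1b)) bda.
  have h2 := bdM _ _ _ _ _ _ _ _ _ _ (bdM _ _ _ _ _ _ _ _ _ _ (bdM _ _ _ _ _ _ _ _ _ _ (bdE 2%N) (bdP _ f11b)) half) (bdA 2%N).
  rewrite -[2]/(1 + 1).
  by apply: bdD; [apply: (bdW _ _ _ _ _ _ _ _ _ h1)|apply: (bdW _ _ _ _ _ _ _ _ _ h2)] => //; clear; lra.
have T0b : bd T0 3 1%N 0%N 2%N.
  have -> : T0 = f0 + (T0 - f0) by ring.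
  have -> : 3 = 1 + 2 :> R by ring.
  by apply: bdD; [apply: (bdW _ _ _ _ _ _ _ _ _ (bdP _ f0b))|apply: (bdW _ _ _ _ _ _ _ _ _ T0b')] => //; clear; lra.
have T1b : bd T1 2 1%N 1%N 1%N.
  have h1 := bdM _ _ _ _ _ _ _ _ _ _ bde (bdP _ f2b).
  have h2 := bdM _ _ _ _ _ _ _ _ _ _ (bdM _ _ _ _ _ _ _ _ _ _ (bdE 2%N) (bdP _ f12b)) bda.
  rewrite -[2]/(1 + 1).
  by apply: bdD; [apply: (bdW _ _ _ _ _ _ _ _ _ h1)|apply: (bdW _ _ _ _ _ _ _ _ _ h2)] => //; clear; lra.
have two : bd 2 2 0%N 0%N 0%N by apply: bdC; rewrite ger0_norm.
have quart : bd 4^-1 4^-1 0%N 0%N 0%N by apply: bdC; rewrite ger0_norm.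
have t1 := bdM _ _ _ _ _ _ _ _ _ _ T0b R0b.
have t2 := bdM _ _ _ _ _ _ _ _ _ _ T1b (bdM _ _ _ _ _ _ _ _ _ _ two R1b).
have t3 := bdM _ _ _ _ _ _ _ _ _ _ (bdM _ _ _ _ _ _ _ _ _ _ (bdM _ _ _ _ _ _ _ _ _ _ (bdE 2%N) (bdP _ f22b)) half) R2b.
have t4 := bdM _ _ _ _ _ _ _ _ _ _ (bdM _ _ _ _ _ _ _ _ _ _ (bdM _ _ _ _ _ _ _ _ _ _ bde (bdP _ f1b)) bda) hb.
have t5 := bdM _ _ _ _ _ _ _ _ _ _ (bdM _ _ _ _ _ _ _ _ _ _ (bdM _ _ _ _ _ _ _ _ _ _ (bdM _ _ _ _ _ _ _ _ _ _ (bdE 2%N) (bdP _ f11b)) half) (bdA 2%N)) pb.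
have pqb := bdD _ _ _ _ _ _ _ pb qb'.
have t6 := bdM _ _ _ _ _ _ _ _ _ _ (bdP _ f0b) (bdM _ _ _ _ _ _ _ _ _ _ hb pqb).
have t7 := bdM _ _ _ _ _ _ _ _ _ _ T0b' p2b.
have t8 := bdM _ _ _ _ _ _ _ _ _ _ (bdM _ _ _ _ _ _ _ _ _ _ bde (bdP _ f2b)) hb.
have t9 := bdM _ _ _ _ _ _ _ _ _ _ (bdM _ _ _ _ _ _ _ _ _ _ (bdM _ _ _ _ _ _ _ _ _ _ (bdE 2%N) (bdP _ f12b)) bda) pb.
have u1 : bd (T0 * R0) 6 4%N 3%N 11%N by apply: (bdW _ _ _ _ _ _ _ _ _ t1) => //; clear; lra.
have u2 : bd (T1 * (2 * R1)) 8 4%N 3%N 11%N by apply: (bdW _ _ _ _ _ _ _ _ _ t2) => //; clear; lra.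
have u3 : bd (e ^+ 2 * f22 / 2 * R2) 2 4%N 3%N 11%N by apply: (bdW _ _ _ _ _ _ _ _ _ t3) => //; clear; lra.
have u4 : bd (e * f1 * a * h) 1 4%N 3%N 11%N by apply: (bdW _ _ _ _ _ _ _ _ _ t4) => //; clear; lra.
have u5 : bd (e ^+ 2 * f11 / 2 * a ^+ 2 * p) 1 4%N 3%N 11%N by apply: (bdW _ _ _ _ _ _ _ _ _ t5) => //; clear; lra.
have u6 : bd (f0 * (h * (p + q))) 1 4%N 3%N 11%N by apply: (bdW _ _ _ _ _ _ _ _ _ t6) => //; clear; lra.
have u7 : bd ((T0 - f0) * p ^+ 2) 2 4%N 3%N 11%N by apply: (bdW _ _ _ _ _ _ _ _ _ t7) => //; clear; lra.
have u8 : bd (e * f2 * h) 1 4%N 3%N 11%N by apply: (bdW _ _ _ _ _ _ _ _ _ t8) => //; clear; lra.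
have u9 : bd (e ^+ 2 * f12 * a * p) 1 4%N 3%N 11%N by apply: (bdW _ _ _ _ _ _ _ _ _ t9) => //; clear; lra.
have v1 := bdD _ _ _ _ _ _ _ (bdD _ _ _ _ _ _ _ u1 u2) u3.
have v2 := bdN _ _ _ _ _ (bdM _ _ _ _ _ _ _ _ _ _ Gb (bdD _ _ _ _ _ _ _ u4 u5)).
have v3 := bdN _ _ _ _ _ (bdM _ _ _ _ _ _ _ _ _ _ (bdM _ _ _ _ _ _ _ _ _ _ BGb quart) (bdD _ _ _ _ _ _ _ u6 u7)).
have v4 := bdM _ _ _ _ _ _ _ _ _ _ BGb (bdD _ _ _ _ _ _ _ u8 u9).
have v := bdD _ _ _ _ _ _ _ (bdD _ _ _ _ _ _ _ (bdD _ _ _ _ _ _ _ v1 v2) v3) v4.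
have W : forall x, bd x 100 4%N 3%N 11%N -> `|x| <= 100 * M ^+ 4 * e ^+ 3 * A ^+ 11.
  by move=> x; rewrite /bd !mulrA.
by apply: W; apply: (bdW _ _ _ _ _ _ _ _ _ v) => //; clear; lra.
Qed.

Lemma integrable_scale (D : set R) c (h : R -> R) : measurable D ->
  mu.-integrable D (EFin \o h) -> mu.-integrable D (EFin \o (fun x => c * h x)).
Proof. by move=> mD hi; apply: (@integrableZl _ _ _ mu D mD c) hi. Qed.

Lemma integrable_add (D : set R) (h1 h2 : R -> R) : measurable D ->
  mu.-integrable D (EFin \o h1) -> mu.-integrable D (EFin \o h2) ->
  mu.-integrable D (EFin \o (fun x => h1 x + h2 x)).
Proof. by move=> mD hi1 hi2; apply: (@integrableD _ _ _ mu D mD) hi1 hi2. Qed.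

Lemma Rintegral_norm_le (D : set R) (f G : R -> R) : measurable D ->
  measurable_fun D f -> mu.-integrable D (EFin \o G) ->
  (forall x, D x -> `|f x| <= G x) ->
  `|\int[mu]_(x in D) f x| <= \int[mu]_(x in D) G x.
Proof.
move=> mD mf Gi fG.
have fi := dominated_integrable_R mD mf Gi fG.
apply: (@le_trans _ _ (\int[mu]_(x in D) `|f x|)).
  exact: (@le_normr_Rintegral _ _ _ mu D f mD fi).
apply: (@le_Rintegral _ _ _ mu) => //.
exact: (integrable_norm fi).
Qed.

Lemma integral_slice f0 f1 f2 f11 f12 f22 e a z :
  \int[mu]_(b in `]z, +oo[) (gam b * quad f0 f1 f2 f11 f12 f22 (e * a) (e * b))
  = slice f0 f1 f2 f11 f12 f22 e a z.
Proof.
have i0 : mu.-integrable `[z, +oo[ (EFin \o gam) by exact: gam_integrable.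
have i1 := @pow_gam_integrable_itv R 1 z.
have i2 := @pow_gam_integrable_itv R 2 z.
set A0 := f0 + e * f1 * a + e ^+ 2 * f11 / 2 * a ^+ 2.
set A1 := e * f2 + e ^+ 2 * f12 * a.
set A2 := e ^+ 2 * f22 / 2.
have E b : gam b * quad f0 f1 f2 f11 f12 f22 (e * a) (e * b) =
    A0 * gam b + A1 * (b ^+ 1 * gam b) + A2 * (b ^+ 2 * gam b).
  by rewrite /quad /A0 /A1 /A2; field.
have j0 : mu.-integrable `[z, +oo[ (EFin \o (fun b => A0 * gam b)).
  exact: integrable_scale.
have j1 : mu.-integrable `[z, +oo[ (EFin \o (fun b => A1 * (b ^+ 1 * gam b))).
  exact: integrable_scale.
have j2 : mu.-integrable `[z, +oo[ (EFin \o (fun b => A2 * (b ^+ 2 * gam b))).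
  exact: integrable_scale.
have j01 : mu.-integrable `[z, +oo[ (EFin \o (fun b => A0 * gam b + A1 * (b ^+ 1 * gam b))).
  exact: integrable_add.
under eq_Rintegral do rewrite E.
rewrite Rintegral_itv_obnd_cbnd; last first.
  apply: integrableS (integrable_add (measurable_itv _) j01 j2) => //.
  by apply: subset_itvr; rewrite bnd_simp.
rewrite RintegralD// RintegralD// !RintegralZl//.
by rewrite tail_moment0 tail_moment1 tail_moment2 /slice -/A0 -/A1 -/A2.
Qed.

Lemma gaussian_moments (c : nat -> R) :
  \int[mu]_a (gam a * \sum_(i < 5) c i * a ^+ i) = c 0%N + 2 * c 2%N + 12 * c 4%N.
Proof.
have i (k : nat) : mu.-integrable setT (EFin \o (fun a => c k * (a ^+ k * gam a))).
  by apply: integrable_scale => //; exact: pow_gam_integrable.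
have m (k : nat) : \int[mu]_a (c k * (a ^+ k * gam a)) = c k * \int[mu]_a (a ^+ k * gam a).
  by rewrite RintegralZl//; exact: pow_gam_integrable.
have i01 := integrable_add measurableT (i 0%N) (i 1%N).
have i012 := integrable_add measurableT i01 (i 2%N).
have i0123 := integrable_add measurableT i012 (i 3%N).
have E a : gam a * \sum_(i < 5) c i * a ^+ i =
   c 0%N * (a ^+ 0 * gam a) + c 1%N * (a ^+ 1 * gam a) + c 2%N * (a ^+ 2 * gam a)
   + c 3%N * (a ^+ 3 * gam a) + c 4%N * (a ^+ 4 * gam a).
  by rewrite !big_ord_recl big_ord0/=; ring.
under eq_Rintegral do rewrite E.
rewrite RintegralD// RintegralD// RintegralD// RintegralD// !m.
rewrite (@odd_moment R 1)// (@odd_moment R 3)// !even_moment// tail_moment2 tail_moment4 tailg0.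
rewrite (_ : \int[mu]_(b in `[0, +oo[) (b ^+ 0 * gam b) = 2^-1); first by field.
by rewrite -tailg0 -tail_moment0; apply: eq_Rintegral => b _; rewrite expr0 mul1r.
Qed.

Lemma quad_bound f0 f1 f2 f11 f12 f22 M u v : `|f0| <= M -> `|f1| <= M -> `|f2| <= M ->
  `|f11| <= M -> `|f12| <= M -> `|f22| <= M ->
  `|quad f0 f1 f2 f11 f12 f22 u v| <= M * (1 + (`|u| + `|v|)) ^+ 2.
Proof.
move=> h0 h1 h2 h11 h12 h22.
have M0 : 0 <= M by apply: le_trans h0.
have half : `|2^-1 : R| <= 2^-1 by rewrite ger0_norm.
have u2 : `|u ^+ 2| <= `|u| ^+ 2 by rewrite normrX.
have v2 : `|v ^+ 2| <= `|v| ^+ 2 by rewrite normrX.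
have := ler_normD2 (ler_normD2 (ler_normD2 (ler_normD2 (ler_normD2 h0
  (ler_normM2 h1 (lexx `|u|))) (ler_normM2 h2 (lexx `|v|)))
  (ler_normM2 (ler_normM2 h11 half) u2))
  (ler_normM2 (ler_normM2 h12 (lexx `|u|)) (lexx `|v|)))
  (ler_normM2 (ler_normM2 h22 half) v2).
rewrite -/(quad _ _ _ _ _ _ u v) => H; apply: le_trans H _.
have := normr_ge0 u; have := normr_ge0 v.
move: `|u| `|v| => x y y0 x0.
rewrite -subr_ge0 (_ : _ - _ = M * ((x + y) + (x + y) ^+ 2 / 2)); last by field.
by rewrite mulr_ge0// addr_ge0 ?addr_ge0// divr_ge0// sqr_ge0.
Qed.

(* A cubic in fact; the cubic term contributes only to terms odd in the first variable
   and to the remainder. *)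
Definition parabola r k g u := - r + k / 2 * u ^+ 2 + g / 6 * u ^+ 3.

(** Within the box the function and its model are both smooth or both 0, unless the point lies
    between the two graphs, where only a constant bound is available but [v] is within [M * u ^+ 4]
    of the model graph. Outside the box [|u| + |v|] is at least [rho], so its cube dominates the
    quadratic growth of the model. *)
Lemma jump_remainder (M rho : R) : 1 <= M -> 0 < rho -> exists2 C : R, 0 <= C &
  forall (F : R -> R -> R) (q : R -> R) f0 f1 f2 f11 f12 f22 k g r,
  `|f0| <= M -> `|f1| <= M -> `|f2| <= M -> `|f11| <= M -> `|f12| <= M ->
  `|f22| <= M ->
  (forall u v : R, `|F u v| <= M) ->
  (forall u v : R, `|u| <= rho -> `|v| <= rho -> q u < v ->
     `|F u v - quad f0 f1 f2 f11 f12 f22 u v| <= M * (`|u| + `|v|) ^+ 3) ->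
  (forall u v : R, `|u| <= rho -> `|v| <= rho -> v <= q u -> F u v = 0) ->
  (forall u, `|u| <= rho -> `|q u - parabola r k g u| <= M * u ^+ 4) ->
  forall u v, `|F u v - (if parabola r k g u < v then quad f0 f1 f2 f11 f12 f22 u v else 0)|
    <= C * (`|u| + `|v|) ^+ 3
       + (if `|v - parabola r k g u| <= M * u ^+ 4 then C else 0).
Proof.
move=> M1 rho0; have M0 : 0 <= M by lra.
(* [C2] serves the points outside the box, by [1 <= s / rho]; [C3] bounds the quadratic polynomial
   inside it. *)
pose C2 := 2 * M * (1 + rho^-1) ^+ 2 / rho.
pose C3 := M * (1 + 2 * rho) ^+ 2.
have ri0 : 0 < rho^-1 by rewrite invr_gt0.
have C20 : 0 <= C2 by rewrite !mulr_ge0 ?sqr_ge0//; lra.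
have C30 : 0 <= C3 by rewrite mulr_ge0 ?sqr_ge0.
exists (M + C2 + C3); first lra.
move=> F q f0 f1 f2 f11 f12 f22 k g r h0 h1 h2 h11 h12 h22 FM FT F0 qp u v.
have Tb := quad_bound u v h0 h1 h2 h11 h12 h22.
set T := quad _ _ _ _ _ _ u v in Tb *; set p := parabola r k g u.
pose s : R := `|u| + `|v|; rewrite -/s in Tb *.
set I := (if `|v - p| <= _ then _ else _).
have I0 : 0 <= I by rewrite /I; case: ifP; lra.
have I1 : `|v - p| <= M * u ^+ 4 -> I = M + C2 + C3 by rewrite /I => ->.
have s0 : 0 <= s by rewrite addr_ge0.
have s30 : 0 <= s ^+ 3 by rewrite exprn_ge0.
have [/andP[ur vr]|far] := boolP ((`|u| <= rho) && (`|v| <= rho)).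
  have sr : s <= 2 * rho by rewrite /s; lra.
  have TC : `|T| <= C3.
    apply: le_trans Tb _; rewrite ler_wpM2l//; apply: lerXn2r; rewrite ?nnegrE; lra.
  have := qp u ur; rewrite -/p => qpu.
  have [qv|vq] := ltP (q u) v; have [pv|vp] := ltP p v.
  - have H := FT u v ur vr qv; rewrite -/T -/s in H.
    apply: le_trans H _.
    have : 0 <= (C2 + C3) * s ^+ 3 by rewrite mulr_ge0//; lra.
    lra.
  - rewrite I1; last first.
      by move: qpu; rewrite !ler_norml; lra.
    rewrite subr0; have := FM u v.
    have : 0 <= (M + C2 + C3) * s ^+ 3 by rewrite mulr_ge0//; lra.
    lra.
  - rewrite I1; last first.
      by move: qpu; rewrite !ler_norml; lra.
    rewrite (F0 u v ur vr vq) sub0r normrN.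
    have : 0 <= (M + C2 + C3) * s ^+ 3 by rewrite mulr_ge0//; lra.
    lra.
  - rewrite (F0 u v ur vr vq) subrr normr0 addr_ge0//.
    by rewrite mulr_ge0//; lra.
have sr : rho <= s.
  move: far; rewrite negb_and -!ltNge /s => /orP[]; have := normr_ge0 u; have := normr_ge0 v; lra.
have H1 : (1 + s) ^+ 2 <= (1 + rho^-1) ^+ 2 / rho * s ^+ 3.
  have a1 : 1 <= rho^-1 * s by rewrite ler_pdivlMl ?mulr1.
  have b1 : 1 + s <= (1 + rho^-1) * s by lra.
  have : (1 + s) ^+ 2 <= ((1 + rho^-1) * s) ^+ 2 by apply: lerXn2r; rewrite ?nnegrE; lra.
  move=> H; apply: le_trans H _.
  rewrite exprMn -mulrA ler_wpM2l ?sqr_ge0//.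
  by rewrite [s ^+ 3]exprSr mulrCA ler_peMr// sqr_ge0.
have H2 : `|F u v - (if p < v then T else 0)| <= M + M * (1 + s) ^+ 2.
  have : `|if p < v then T else 0| <= M * (1 + s) ^+ 2.
    by case: ifP => // _; rewrite normr0 mulr_ge0 ?sqr_ge0.
  by move=> H; apply: le_trans (ler_normB _ _) _; apply: lerD.
apply: le_trans H2 _.
have H3 : 1 <= (1 + s) ^+ 2 by rewrite -[leLHS](expr1n _ 2); apply: lerXn2r; rewrite ?nnegrE; lra.
have H4 : M + M * (1 + s) ^+ 2 <= C2 * s ^+ 3.
  by rewrite /C2; nra.
have : 0 <= (M + C3) * s ^+ 3 by rewrite mulr_ge0//; lra.
lra.
Qed.

Lemma integrable_indic_itv (x y c : R) :
  mu.-integrable setT (EFin \o (fun b => c * \1_(`[x, y]%classic) b)) /\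
  (x <= y -> \int[mu]_b (c * \1_(`[x, y]%classic) b) = c * (y - x)).
Proof.
have i1 : mu.-integrable setT (EFin \o \1_(`[x, y]%classic)).
  apply/integrableP; split.
    by apply/measurable_EFinP; exact: measurable_indic.
  under eq_integral do rewrite /= ger0_norm//.
  rewrite integral_indic//= setIT lebesgue_measure_itv/=.
  by case: ifPn => _; rewrite ltry.
split=> [|xy]; first exact: integrable_scale.
rewrite RintegralZl// /Rintegral integral_indic//= setIT lebesgue_measure_itv/= lte_fin.
move: xy; rewrite le_eqVlt => /orP[/eqP ->|->//].
by rewrite ltxx subrr.
Qed.

Lemma measurable_gam (D : set R) : measurable_fun D gam.
Proof. apply: measurable_funTS; apply: continuous_measurable_fun; exact: continuous_gam. Qed.

(** The cubic remainder is integrable against [gam] after the splitting [(|a| + |b|) ^+ 3 <= (1 +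
    |a|) ^+ 3 * (1 + |b|) ^+ 3]; the strip between the two graphs contributes at most its length, as
    [gam <= 1]. All growth in [a] is put into [om a], which the outer integral can bear. *)
Lemma slice_error (M rho : R) : 1 <= M -> 0 < rho -> exists2 C : R, 0 <= C &
  forall (F : R -> R -> R) (q : R -> R) f0 f1 f2 f11 f12 f22 k g r e,
  `|f0| <= M -> `|f1| <= M -> `|f2| <= M -> `|f11| <= M -> `|f12| <= M ->
  `|f22| <= M -> `|k| <= M -> `|g| <= M -> 0 <= r -> 0 < e <= 1 ->
  (forall u, measurable_fun setT (F u)) ->
  (forall u v : R, `|F u v| <= M) ->
  (forall u v : R, `|u| <= rho -> `|v| <= rho -> q u < v ->
     `|F u v - quad f0 f1 f2 f11 f12 f22 u v| <= M * (`|u| + `|v|) ^+ 3) ->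
  (forall u v : R, `|u| <= rho -> `|v| <= rho -> v <= q u -> F u v = 0) ->
  (forall u, `|u| <= rho -> `|q u - parabola r k g u| <= M * u ^+ 4) ->
  forall a, `|\int[mu]_b (gam b * F (e * a) (e * b)) -
      slice_approx f0 f1 f2 f11 f12 f22 k g (r / e) e a| <= C * e ^+ 3 * om a.
Proof.
move=> M1 rho0; have M0 : 0 <= M by lra.
have [C1 C10 HC1] := jump_remainder M1 rho0.
have [D3 D30 HD3] := @pow_le_om R 3; have [D4 D40 HD4] := @pow_le_om R 4.
have [D11 D110 HD11] := @pow_le_om R 11.
pose W := \int[mu]_b (gam b * om b).
have W0 : 0 <= W by apply: Rintegral_ge0 => b _; rewrite mulr_ge0 ?gam_ge0 ?expR_ge0.
have Wi := @gam_om_integrable R.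
exists (C1 * D3 * D3 * W + C1 * (2 * M) * D4 + 100 * M ^+ 4 * D11).
  by rewrite !addr_ge0 ?mulr_ge0 ?exprn_ge0.
move=> F q f0 f1 f2 f11 f12 f22 k g r e h0 h1 h2 h11 h12 h22 kM gM r0 /andP[e0 e1].
move=> mF FM FT F0 qp a.
have HJ := HC1 F q f0 f1 f2 f11 f12 f22 k g r h0 h1 h2 h11 h12 h22 FM FT F0 qp.
have be0 : 0 <= r / e by rewrite divr_ge0// ltW.
set z := - (r / e) + (e * k / 2 * a ^+ 2 + e ^+ 2 * g / 6 * a ^+ 3).
have zE : e * z = parabola r k g (e * a).
  by rewrite /z /parabola; field; rewrite gt_eqF.
have := slice_approx_bound a M1 h0 h1 h2 h11 h12 h22 kM gM be0 (introT andP (conj e0 e1)).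
rewrite -/z -integral_slice; set T := quad f0 f1 f2 f11 f12 f22 => HS.
pose P b := if z < b then gam b * T (e * a) (e * b) else 0.
have PE : \int[mu]_(b in `]z, +oo[) (gam b * T (e * a) (e * b)) = \int[mu]_b P b.
  rewrite Rintegral_mkcond; apply: eq_Rintegral => b _.
  by rewrite /P /patch mem_setE in_itv/= andbT.
have Fi : mu.-integrable setT (EFin \o (fun b => gam b * F (e * a) (e * b))).
  apply: (@dominated_integrable_R _ setT _ (fun b => M * gam b)) => //.
  - apply: measurable_funM; first exact: measurable_gam.
    by apply: measurableT_comp (mF _) _; exact: measurable_funM.
  - by apply: integrable_scale => //; exact: gam_integrable.
  - by move=> b _; rewrite normrM (ger0_norm (gam_ge0 b)) mulrC ler_wpM2r ?gam_ge0.
have Pi : mu.-integrable setT (EFin \o P).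
  rewrite (_ : P = (fun b => gam b * T (e * a) (e * b)) \_ `]z, +oo[); last first.
    by apply/funext => b; rewrite /P /patch mem_setE in_itv/= andbT.
  rewrite -restrict_EFin; apply/integrable_restrict => //; rewrite setTI.
  have i2 := pow_gam_integrable_itv 2 z; have i1 := pow_gam_integrable_itv 1 z.
  have i0 : mu.-integrable `[z, +oo[ (EFin \o gam) by exact: gam_integrable.
  apply: (@integrableS _ _ _ mu `[z, +oo[) => //.
    by apply: subset_itvr; rewrite bnd_simp.
  have -> : (fun b => gam b * T (e * a) (e * b)) = (fun b =>
    (f0 + e * f1 * a + e ^+ 2 * f11 / 2 * a ^+ 2) * gam b + (
    (e * f2 + e ^+ 2 * f12 * a) * (b ^+ 1 * gam b) +
    (e ^+ 2 * f22 / 2) * (b ^+ 2 * gam b))).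
    by apply/funext => b; rewrite /T /quad; field.
  by apply: integrable_add => //; [|apply: integrable_add => //]; exact: integrable_scale.
(* Half the length in [b] of the strip around the model graph: [M * (e * a) ^+ 4] divided by [e]. *)
pose h := M * e ^+ 3 * a ^+ 4.
have a40 : 0 <= a ^+ 4 by exact: exprn_even_ge0.
have e30 : 0 <= e ^+ 3 by rewrite exprn_ge0// ltW.
have h_ge0 : 0 <= h by rewrite /h mulr_ge0// mulr_ge0.
have [Ii IE] := integrable_indic_itv (z - h) (z + h) C1.
pose G b := C1 * e ^+ 3 * (D3 * om a) * D3 * (gam b * om b) + C1 * \1_(`[z - h, z + h]%classic) b.
have G1i : mu.-integrable setT (EFin \o (fun b => C1 * e ^+ 3 * (D3 * om a) * D3 * (gam b * om b))).
  exact: integrable_scale.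
have H1 : `|\int[mu]_b (gam b * F (e * a) (e * b)) - \int[mu]_b P b| <=
    C1 * e ^+ 3 * (D3 * om a) * D3 * W + C1 * (2 * h).
  rewrite -RintegralB//.
  have -> : C1 * e ^+ 3 * (D3 * om a) * D3 * W + C1 * (2 * h) = \int[mu]_b G b.
    rewrite /G RintegralD// IE; last lra.
    rewrite (RintegralZl (mu := mu))// /W; congr (_ + _ * _); ring.
  apply: Rintegral_norm_le => //.
  - apply: measurable_funB.
      by apply/measurable_EFinP; exact: (measurable_int mu).
    by apply/measurable_EFinP; exact: (measurable_int mu).
  - exact: integrable_add.
  - move=> b _; have := HJ (e * a) (e * b).
    rewrite -zE ltr_pM2l// -mulrBr [`|e * (b - z)|]normrM (gtr0_norm e0) -/T => HH.
    have -> : P b = gam b * (if z < b then T (e * a) (e * b) else 0).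
      by rewrite /P; case: ifP => // _; rewrite mulr0.
    rewrite -mulrBr normrM (ger0_norm (gam_ge0 b)).
    apply: le_trans (ler_wpM2l (gam_ge0 b) HH) _.
    rewrite mulrDr; apply: lerD.
      have : (`|e * a| + `|e * b|) ^+ 3 <= e ^+ 3 * ((D3 * om a) * (D3 * om b)).
        rewrite !normrM (gtr0_norm e0) -mulrDr exprMn ler_pM2l ?exprn_gt0//.
        apply: (@le_trans _ _ ((1 + `|a|) ^+ 3 * (1 + `|b|) ^+ 3)); last first.
          by apply: ler_pM; rewrite ?exprn_ge0 ?addr_ge0//.
        rewrite -exprMn; apply: lerXn2r; rewrite ?nnegrE ?mulr_ge0 ?addr_ge0//.
        have := mulr_ge0 (normr_ge0 a) (normr_ge0 b); lra.
      move=> H3; have := ler_wpM2l (mulr_ge0 (gam_ge0 b) C10) H3.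
      by rewrite -!mulrA => /le_trans; apply; rewrite le_eqVlt; apply/orP; left; apply/eqP; ring.
    have -> : (e * `|b - z| <= M * (e * a) ^+ 4) = (b \in `[z - h, z + h]).
      rewrite in_itv/= -ler_distl.
      have -> : M * (e * a) ^+ 4 = e * h by rewrite /h; ring.
      by rewrite ler_pM2l.
    rewrite indicE mem_setE.
    by case: ifP => _; rewrite ?mulr0// mulr1 ler_piMl// gam_le1.
have := ler_normD2 H1 HS; rewrite -PE.
rewrite subrKA.
move=> H; apply: le_trans H _.
have B1 : a ^+ 4 <= D4 * om a.
  apply: le_trans (HD4 a); rewrite -[a ^+ 4]ger0_norm ?exprn_even_ge0// normrX.
  by apply: lerXn2r; rewrite ?nnegrE ?addr_ge0// lerDr.
have := ler_wpM2l (mulr_ge0 (mulr_ge0 C10 (mulr_ge0 (ler0n R 2) M0)) e30) B1.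
have := ler_wpM2l (mulr_ge0 (mulr_ge0 (ler0n R 100) (exprn_ge0 4 M0)) e30) (HD11 a).
rewrite /h; lra.
Qed.

Lemma plane_integral_iterated (F : R -> R -> R) M e :
  measurable_fun setT (fun z : R * R => F z.1 z.2) -> (forall u v, `|F u v| <= M) ->
  [/\ measurable_fun setT (fun a => \int[mu]_b (gam b * F (e * a) (e * b))),
      forall a, `|\int[mu]_b (gam b * F (e * a) (e * b))| <= M,
      lam.-integrable setT (EFin \o (fun z : R * R => gam z.1 * gam z.2 * F (e * z.1) (e * z.2))) &
  \int[lam]_z (gam z.1 * gam z.2 * F (e * z.1) (e * z.2)) =
  \int[mu]_a (gam a * \int[mu]_b (gam b * F (e * a) (e * b)))].
Proof.
move=> mF FM.
have M0 : 0 <= M by apply: le_trans (FM 0 0).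
pose h (z : R * R) := gam z.1 * gam z.2 * F (e * z.1) (e * z.2).
have mFe : measurable_fun setT (fun z : R * R => F (e * z.1) (e * z.2)).
  apply: (measurableT_comp (f := fun z : R * R => F z.1 z.2) mF
    (g := fun z : R * R => (e * z.1, e * z.2))).
  by apply: measurable_fun_pair; exact: measurable_funM.
have mg1 : measurable_fun setT (fun z : R * R => gam z.1).
  by apply: measurableT_comp => //; exact: measurable_gam.
have mg2 : measurable_fun setT (fun z : R * R => gam z.2).
  by apply: measurableT_comp => //; exact: measurable_gam.
have mh : measurable_fun setT (EFin \o h).
  apply/measurable_EFinP; apply: measurable_funM => //; exact: measurable_funM.
have mg2F : measurable_fun setT (fun z : R * R => gam z.2 * F (e * z.1) (e * z.2)).
  exact: measurable_funM.
have Jm : measurable_fun setT (fun a => \int[mu]_b (gam b * F (e * a) (e * b))).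
  apply: (measurableT_comp (_ : measurable_fun setT fine)) => //.
  have := @measurable_parameter_integral R _ _ (measurableTypeR R) (measurableTypeR R)
    (fun z : R * R => (gam z.2 * F (e * z.1) (e * z.2))%:E) mu.
  apply.
  exact/measurable_EFinP.
have Gi : mu.-integrable setT (EFin \o gam) by exact: gam_integrable.
(* The total mass is read off the moment formula for the constant polynomial 1. *)
have G1 : (\int[mu]_b (gam b)%:E = 1)%E.
  have H := gaussian_moments (fun k : nat => (k == 0%N)%:R : R).
  rewrite /= !mulr0 !addr0 in H.
  rewrite -[LHS]fineK; last exact: integrable_fin_num.
  congr EFin; apply: etrans H; apply: eq_Rintegral => b _.
  by rewrite !big_ord_recl big_ord0/= expr0; ring.
have Ji a : mu.-integrable setT (EFin \o (fun b => gam b * F (e * a) (e * b))).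
  apply: (@dominated_integrable_R _ setT _ (fun b => M * gam b)) => //.
  - apply: (measurableT_comp mg2F (measurable_pair1 a)).
  - exact: integrable_scale.
  - by move=> b _; rewrite normrM (ger0_norm (gam_ge0 b)) mulrC ler_wpM2r ?gam_ge0.
have hi : lam.-integrable setT (EFin \o h).
  apply/integrable12ltyP => //=.
  apply: (@le_lt_trans _ _ (\int[mu]_a (M * gam a)%:E)%E); last first.
    have Mi := integrable_scale M measurableT Gi.
    by rewrite -[ltLHS]fineK ?ltry//; exact: integrable_fin_num.
  apply: ge0_le_integral => //=.
  - by move=> a _; exact: integral_ge0.
  - apply: (@measurable_fun_fubini_tonelli_F _ _ _ _ _ mu (fun z : R * R => `|h z|%:E)) => //=.
    by apply/measurable_EFinP; apply: measurableT_comp => //; exact/measurable_EFinP.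
  - by apply/measurable_EFinP; apply: measurable_funM => //; exact: measurable_gam.
  - move=> a _.
    rewrite -[leRHS]mule1 -G1 -ge0_integralZl//; last 3 first.
    + by apply/measurable_EFinP; exact: measurable_gam.
    + by move=> b _; rewrite lee_fin gam_ge0.
    + by rewrite lee_fin mulr_ge0 ?gam_ge0.
    apply: ge0_le_integral => //=.
    + apply/measurable_EFinP; apply: measurableT_comp => //.
      by move/measurable_EFinP : mh => mh; exact: (measurableT_comp mh (measurable_pair1 a)).
    + by apply/measurable_EFinP; apply: measurable_funM => //; exact: measurable_gam.
    + move=> b _; rewrite -EFinM lee_fin /h/= normrM ger0_norm ?mulr_ge0 ?gam_ge0//.
      by rewrite [leLHS]mulrC -[leRHS]mulrA ler_wpM2r ?mulr_ge0 ?gam_ge0.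
split => //.
  move=> a; have -> : M = \int[mu]_b (M * gam b).
    by rewrite RintegralZl// /Rintegral G1 mulr1.
  apply: Rintegral_norm_le => //.
  - apply: (measurableT_comp mg2F (measurable_pair1 a)).
  - exact: integrable_scale.
  - by move=> b _; rewrite normrM (ger0_norm (gam_ge0 b)) mulrC ler_wpM2r ?gam_ge0.
rewrite /Rintegral -(integral12_prod_meas1 hi)/fubini_F; congr fine.
apply: eq_integral => a _.
rewrite EFinM fineK; last exact: (integrable_fin_num measurableT (Ji a)).
rewrite -(integralZl measurableT (Ji a)); apply: eq_integral => b _.
by rewrite /h/= -mulrA EFinM.
Qed.

Lemma plane_integral_expansion (M rho : R) : 1 <= M -> 0 < rho -> exists2 C : R, 0 <= C &
  forall (F : R -> R -> R) (q : R -> R) f0 f1 f2 f11 f12 f22 k g r e,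
  `|f0| <= M -> `|f1| <= M -> `|f2| <= M -> `|f11| <= M -> `|f12| <= M ->
  `|f22| <= M -> `|k| <= M -> `|g| <= M -> 0 <= r -> 0 < e <= 1 ->
  measurable_fun setT (fun z : R * R => F z.1 z.2) ->
  (forall u v : R, `|F u v| <= M) ->
  (forall u v : R, `|u| <= rho -> `|v| <= rho -> q u < v ->
     `|F u v - quad f0 f1 f2 f11 f12 f22 u v| <= M * (`|u| + `|v|) ^+ 3) ->
  (forall u v : R, `|u| <= rho -> `|v| <= rho -> v <= q u -> F u v = 0) ->
  (forall u, `|u| <= rho -> `|q u - parabola r k g u| <= M * u ^+ 4) ->
  `|\int[lam]_z (gam z.1 * gam z.2 * F (e * z.1) (e * z.2)) -
    (f0 * tailg (- (r / e)) + (2 * f2 - f0 * k) * (e * gam (r / e))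
     + (f11 + f22) * (e ^+ 2 * tailg (- (r / e)))
     + (f2 * k - 3 / 4 * f0 * k ^+ 2 - f22) * r * (e * gam (r / e)))| <= C * e ^+ 3.
Proof.
move=> M1 rho0; have [C C0 HC] := slice_error M1 rho0.
pose W := \int[mu]_b (gam b * om b).
have W0 : 0 <= W by apply: Rintegral_ge0 => b _; rewrite mulr_ge0 ?gam_ge0 ?expR_ge0.
have Wi := @gam_om_integrable R.
exists (C * W); first exact: mulr_ge0.
move=> F q f0 f1 f2 f11 f12 f22 k g r e h0 h1 h2 h11 h12 h22 kM gM r0 e01.
move=> mF FM FT F0 qp; set N := tailg _; set G := gam (r / e).
have /andP[e0 e1] := e01.
have mF1 u : measurable_fun setT (F u) by exact: (measurableT_comp mF (measurable_pair1 u)).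
have H := HC F q f0 f1 f2 f11 f12 f22 k g r e h0 h1 h2 h11 h12 h22 kM gM r0 e01 mF1 FM FT F0 qp.
have [Jm Jb _ ->] := plane_integral_iterated e mF FM.
set J := fun a => \int[mu]_b (gam b * F (e * a) (e * b)) in H Jm Jb *.
set S := slice_approx f0 f1 f2 f11 f12 f22 k g (r / e) e in H *.
(* The moments 1, 2, 12 weight the coefficients of [1], [a ^+ 2], [a ^+ 4], and [e * (r / e) = r]
   turns the terms in [e ^+ 2 * be] into [r * e]; this produces the [3 / 4] as [12 / 16]. *)
have <- : \int[mu]_a (gam a * S a) = f0 * N + (2 * f2 - f0 * k) * (e * G)
     + (f11 + f22) * (e ^+ 2 * N)
     + (f2 * k - 3 / 4 * f0 * k ^+ 2 - f22) * r * (e * G).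
  rewrite /S /slice_approx gaussian_moments/= -/N -/G.
  by field; rewrite gt_eqF.
have Si : mu.-integrable setT (EFin \o (fun a => gam a * S a)).
  have ik (i : nat) c : mu.-integrable setT (EFin \o (fun a => c * (a ^+ i * gam a))).
    by apply: integrable_scale => //; exact: pow_gam_integrable.
  set c := slice_coef f0 f1 f2 f11 f12 f22 k g (r / e) e.
  have -> : (fun a => gam a * S a) = (fun a =>
     c`_0 * (a ^+ 0 * gam a) + (c`_1 * (a ^+ 1 * gam a) + (c`_2 * (a ^+ 2 * gam a) +
     (c`_3 * (a ^+ 3 * gam a) + c`_4 * (a ^+ 4 * gam a))))).
    by apply/funext => a; rewrite /S /slice_approx -/c !big_ord_recl big_ord0 /bump/=; ring.
  by do 4 (apply: integrable_add => //).
have Ji : mu.-integrable setT (EFin \o (fun a => gam a * J a)).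
  apply: (@dominated_integrable_R _ setT _ (fun b => M * gam b)) => //.
  - by apply: measurable_funM => //; exact: measurable_gam.
  - by apply: integrable_scale => //; exact: gam_integrable.
  - by move=> b _; rewrite normrM (ger0_norm (gam_ge0 b)) mulrC ler_wpM2r ?gam_ge0//; exact: Jb.
rewrite -RintegralB//.
have -> : C * W * e ^+ 3 = \int[mu]_a (C * e ^+ 3 * (gam a * om a)).
  by rewrite (RintegralZl (mu := mu))// -/W; ring.
apply: Rintegral_norm_le => //.
- by apply: measurable_funB; apply/measurable_EFinP; exact: (measurable_int mu).
- exact: integrable_scale.
- move=> a _; rewrite -mulrBr normrM (ger0_norm (gam_ge0 a)) mulrCA ler_wpM2l ?gam_ge0//.
Qed.

End LocalExpansion.

(** * The time integrals *)

Section TimeIntegral.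
Context {R : realType}.
Notation mu := (@lebesgue_measure R).

(** The integrand is only known to be continuous for [t > 0], and its antiderivative is a function
    of the square root. The fundamental theorem is used on [[s ^+ 2, d]]; the missing piece costs at
    most [K * s ^+ 2], and [s] tends to 0. *)
Lemma FTC_open_left (h H : R -> R) (K d : R) : 0 < d ->
  (forall t : R, 0 < t -> {for t, continuous h}) ->
  (forall t : R, 0 < t -> is_derive t (1 : R) (fun t => H (Num.sqrt t)) (h t)) ->
  (forall t : R, 0 < t <= d -> `|h t| <= K) ->
  H s @[s --> 0^'+] --> (0 : R) ->
  mu.-integrable `]0, d[ (EFin \o h) /\ \int[mu]_(t in `]0%R, d[) h t = H (Num.sqrt d).
Proof.
move=> d0 ch dH hK H0.
have Ki (i : interval R) (x y : R) : i = `]x, y] -> mu.-integrable [set` i] (EFin \o cst K).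
  move=> ->; apply/integrableP; split; first exact/measurable_EFinP.
  rewrite [ltLHS](_ : _ = (\int[mu]_(t in `]x, y]) (cst (`|K|%:E) t))%E)//.
  rewrite integral_cst//= lebesgue_measure_itv/= lte_fin.
  by case: ifPn => _; rewrite ?mule0 ?ltry// -EFinB -EFinM ltry.
have hi' : mu.-integrable `]0, d] (EFin \o h).
  apply: (@dominated_integrable_R _ _ h (cst K)) => //.
  - have mh : measurable_fun `](0 : R), +oo[%classic h.
      apply: open_continuous_measurable_fun => // t.
      by rewrite inE/= in_itv/= andbT; exact: ch.
    by apply: measurable_funS mh => //; apply: subset_itvl; rewrite bnd_simp.
  - exact: (Ki _ 0 d).
have hi : mu.-integrable `]0, d[ (EFin \o h).
  by apply: integrableS hi' => //; apply: subset_itvl; rewrite bnd_simp.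
split => //.
have K0 : 0 <= K by apply: le_trans (hK d _); rewrite ?normr_ge0// d0 lexx.
have key (s : R) : 0 < s < Num.sqrt d ->
   `|\int[mu]_(t in `]0%R, d[) h t - H (Num.sqrt d)| <= `|H s| + K * s ^+ 2.
  move=> /andP[s0 sd].
  have s20 : 0 < s ^+ 2 by rewrite exprn_gt0.
  have s2d : s ^+ 2 < d.
    by rewrite -[ltRHS]sqr_sqrtr ?ltW// ltr_pXn2r// nnegrE ?sqrtr_ge0// ltW.
  have := @Rintegral_itvB _ h (BRight 0) (BLeft d) (s ^+ 2) hi.
  rewrite !bnd_simp => /(_ (ltW s20) s2d) E.
  have i2 : mu.-integrable `]s ^+ 2, d[ (EFin \o h).
    by apply: integrableS hi => //; apply: subset_itvr; rewrite bnd_simp ltW.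
  have E2 : \int[mu]_(t in `]s ^+ 2, d[) h t = H (Num.sqrt d) - H s.
    rewrite Rintegral_itv_bndo_bndc//.
    have i3 : mu.-integrable `]s ^+ 2, d] (EFin \o h).
      by apply: integrableS hi' => //; apply: subset_itvr; rewrite bnd_simp ltW.
    rewrite Rintegral_itv_obnd_cbnd//.
    have C1 (x : R) : s ^+ 2 <= x <= d -> {for x, continuous h}.
      by move=> /andP[sx _]; apply: ch; exact: lt_le_trans sx.
    have D1 (x : R) : s ^+ 2 <= x <= d -> is_derive x (1 : R) (fun t => H (Num.sqrt t)) (h x).
      by move=> /andP[sx _]; apply: dH; exact: lt_le_trans sx.
    by rewrite (FTC2_is_derive s2d C1 D1) sqrtr_sqr gtr0_norm.
  have E1 : `|\int[mu]_(t in `]0%R, s ^+ 2]) h t| <= K * s ^+ 2.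
    have -> : K * s ^+ 2 = \int[mu]_(t in `]0%R, s ^+ 2]) (cst K t).
      by rewrite Rintegral_cst//= lebesgue_measure_itv/= lte_fin s20/= subr0.
    apply: Rintegral_norm_le => //.
    - apply/measurable_EFinP; apply: (measurable_int mu).
      by apply: integrableS hi' => //; apply: subset_itvl; rewrite bnd_simp ltW.
    - exact: (Ki _ 0 (s ^+ 2)).
    - move=> t /=; rewrite in_itv/= => /andP[t0 ts]; apply: hK.
      by rewrite t0 (le_trans ts)// ltW.
  move: E E1; rewrite E2; move: (\int[mu]_(t in `]0%R, d[) h t) (\int[mu]_(t in `]0%R, s ^+ 2]) h t) => X Y E E1.
  have -> : X - H (Num.sqrt d) = - H s + Y by lra.
  by apply: ler_normD2 => //; rewrite normrN.
apply/eqP; rewrite -subr_eq0 -normr_le0; apply/ler_addgt0Pr => e e0.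
rewrite add0r.
have sd0 : 0 < Num.sqrt d by rewrite sqrtr_gt0.
have [s /andP[/andP[s0 sd] se]] : exists s : R, (0 < s < Num.sqrt d) && (`|H s| + K * s ^+ 2 <= e).
  move/cvgrPdist_le : H0 => /(_ (e / 2)); rewrite divr_gt0// => /(_ isT) H0.
  have : \forall s \near (0:R)^'+, [&& 0 < s, s < Num.sqrt d, s < 1 & s < e / 2 / (K + 1)].
    near=> s; apply/and4P; split; near: s; [exact: nbhs_right_gt|apply: nbhs_right_lt..] => //.
    by rewrite divr_gt0 ?divr_gt0//; lra.
  move=> H1; have [s [/= Hs /and4P[s0 sd s1 sK]]] := @filter_ex _ (0:R)^'+ _ _ (filterI H0 H1).
  exists s; rewrite s0 sd/=.
  move: Hs; rewrite sub0r normrN => Hs.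
  have : (K + 1) * s < e / 2 by rewrite mulrC -ltr_pdivlMr//; lra.
  have : s ^+ 2 <= s by rewrite expr2 ler_piMr// ltW.
  nra.
by apply: le_trans (key s _) se; rewrite s0.
Unshelve. all: by end_near. Qed.

Variables (alpha r : R).
Hypotheses (alpha0 : 0 < alpha) (r0 : 0 < r).

(** With [c1 = r / s] and [c2 = alpha * s] the product [c1 * c2 = alpha * r] is constant, so the
    ingredients of the coefficients become functions of [s] that are easy to differentiate. *)
Definition gaussE (s : R) : R := expR (- ((r / s) ^+ 2 / 4) - (alpha * s) ^+ 2).
Definition phim (s : R) : R := expR (- (alpha * r)) * erfc (r / s / 2 - alpha * s)
  - expR (alpha * r) * erfc (r / s / 2 + alpha * s).
Definition phip (s : R) : R := expR (- (alpha * r)) * erfc (r / s / 2 - alpha * s)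
  + expR (alpha * r) * erfc (r / s / 2 + alpha * s).
Definition lam_fun (s : R) : R := expR (- (alpha * s) ^+ 2) * erfc (r / s / 2).
Definition zc_fun (s : R) : R := 4 * (alpha * s) * gaussE s / Num.sqrt pi.

(** The three functions are antiderivatives in [s] of [2 * s] times [dens0], [dens1], [dens2], the
    factor [2 * s] being the Jacobian of [t = s ^+ 2]. They are the coefficients [W0], [Q], [W1]
    with their powers of [s] multiplied in. *)
Definition H0_fun (s : R) : R :=
  (4 - 4 * expR (- (alpha * s) ^+ 2) + 2 * lam_fun s - phip s) / (4 * alpha ^+ 2).
Definition H1_fun (s : R) : R :=
  ((phim s - zc_fun s) / alpha ^+ 3 + r * phip s / alpha ^+ 2) / 8.
Definition H2_fun (s : R) : R :=
  (8 * H0_fun s - r * phim s / alpha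
   + 4 * s ^+ 2 * (lam_fun s - 2 * expR (- (alpha * s) ^+ 2))) / (8 * alpha ^+ 2).

Lemma coefficient_closed_forms (s : R) : 0 < s ->
  let c1 := r / s in let c2 := alpha * s in
  [/\ s ^+ 2 / 4 * W0 c1 c2 = H0_fun s, s ^+ 3 / 8 * Q c1 c2 0 = H1_fun s,
      s ^+ 4 / 8 * Q c1 c2 1 = r * H1_fun s & s ^+ 4 / 8 * W1 c1 c2 = H2_fun s].
Proof.
move=> s0 /=.
have sn : s != 0 by rewrite gt_eqF.
have an : alpha != 0 by rewrite gt_eqF.
have pn : Num.sqrt (pi : R) != 0 by rewrite gt_eqF// sqrtpi_gt0.
have E1 : r / s * (alpha * s) = alpha * r by field.
have Epm : Phim (r / s) (alpha * s) = phim s by rewrite /Phim E1.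
have Epp : Phip (r / s) (alpha * s) = phip s by rewrite /Phip E1.
have Ez : Zc (r / s) (alpha * s) = zc_fun s by [].
have El : lambda (r / s) (alpha * s) = lam_fun s by [].
have EW0 : W0 (r / s) (alpha * s) = 4 / s ^+ 2 * H0_fun s.
  by rewrite /W0 El Epp /H0_fun; field; rewrite sn an.
split.
- by rewrite EW0; field.
- by rewrite /Q Epm Ez Epp /H1_fun; field; rewrite sn an.
- by rewrite /Q Epm Ez Epp /H1_fun; field; rewrite sn an.
- by rewrite /W1 EW0 El /P1 Epm /H2_fun; field; rewrite sn an.
Qed.

Lemma is_derive_div (s : R) : s != 0 -> is_derive s (1 : R) (fun s => r / s) (- (r / s ^+ 2)).
Proof.
move=> s0; have D : is_derive s (1 : R) (fun s : R => s^-1) (- s ^- 2 *: 1).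
  exact: is_deriveV.
by apply: is_derive_eq; rewrite /GRing.scale/=; field.
Qed.

Local Notation k2 := (2 / Num.sqrt pi : R).

Lemma is_derive_gaussE (s : R) : 0 < s ->
  is_derive s (1 : R) gaussE ((r ^+ 2 / (2 * s ^+ 3) - 2 * alpha ^+ 2 * s) * gaussE s).
Proof.
move=> s0; have sn : s != 0 by rewrite gt_eqF.
have D := is_derive_div sn.
have D2 : is_derive s (1 : R) (fun s => - ((r / s) ^+ 2 / 4) - (alpha * s) ^+ 2)
   (r ^+ 2 / (2 * s ^+ 3) - 2 * alpha ^+ 2 * s).
  by apply: is_derive_eq; rewrite /GRing.scale/=; field.
by rewrite /gaussE; apply: is_derive_eq; rewrite /GRing.scale/=; ring.
Qed.

(** Completing the square: the cross term of the exponent cancels the prefactor, so this term and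
    its companion with the plus sign have derivatives with the common factor [gaussE]. *)
Lemma is_derive_erfc_minus (s : R) : 0 < s ->
  is_derive s (1 : R) (fun s => expR (- (alpha * r)) * erfc (r / s / 2 - alpha * s))
    (k2 * gaussE s * (r / (2 * s ^+ 2) + alpha)).
Proof.
move=> s0; have sn : s != 0 by rewrite gt_eqF.
have pn : Num.sqrt (pi : R) != 0 by rewrite gt_eqF// sqrtpi_gt0.
have D := is_derive_div sn.
have D1 : is_derive s (1 : R) (fun s => r / s / 2 - alpha * s) (- (r / (2 * s ^+ 2)) - alpha).
  by apply: is_derive_eq; rewrite /GRing.scale/=; field.
have D2 := is_derive_erfc (r / s / 2 - alpha * s).
have -> : gaussE s = expR (- (alpha * r)) * expR (- (r / s / 2 - alpha * s) ^+ 2).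
  by rewrite -expRD /gaussE; congr expR; field.
by apply: is_derive_eq; rewrite /GRing.scale/=; field; rewrite pn sn.
Qed.

Lemma is_derive_erfc_plus (s : R) : 0 < s ->
  is_derive s (1 : R) (fun s => expR (alpha * r) * erfc (r / s / 2 + alpha * s))
    (k2 * gaussE s * (r / (2 * s ^+ 2) - alpha)).
Proof.
move=> s0; have sn : s != 0 by rewrite gt_eqF.
have pn : Num.sqrt (pi : R) != 0 by rewrite gt_eqF// sqrtpi_gt0.
have D := is_derive_div sn.
have D1 : is_derive s (1 : R) (fun s => r / s / 2 + alpha * s) (- (r / (2 * s ^+ 2)) + alpha).
  by apply: is_derive_eq; rewrite /GRing.scale/=; field.
have D2 := is_derive_erfc (r / s / 2 + alpha * s).
have -> : gaussE s = expR (alpha * r) * expR (- (r / s / 2 + alpha * s) ^+ 2).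
  by rewrite -expRD /gaussE; congr expR; field.
by apply: is_derive_eq; rewrite /GRing.scale/=; field; rewrite pn sn.
Qed.

Lemma is_derive_expsq (s : R) : is_derive s (1 : R) (fun s => expR (- (alpha * s) ^+ 2))
   (- (2 * alpha ^+ 2 * s) * expR (- (alpha * s) ^+ 2)).
Proof.
have D2 : is_derive s (1 : R) (fun s => - (alpha * s) ^+ 2) (- (2 * alpha ^+ 2 * s)).
  by apply: is_derive_eq; rewrite /GRing.scale/=; ring.
by apply: is_derive_eq; rewrite /GRing.scale/=; ring.
Qed.

Lemma is_derive_lam_fun (s : R) : 0 < s -> is_derive s (1 : R) lam_fun
   (k2 * gaussE s * (r / (2 * s ^+ 2)) - 2 * alpha ^+ 2 * s * lam_fun s).
Proof.
move=> s0; have sn : s != 0 by rewrite gt_eqF.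
have pn : Num.sqrt (pi : R) != 0 by rewrite gt_eqF// sqrtpi_gt0.
have D := is_derive_div sn.
have D1 : is_derive s (1 : R) (fun s => r / s / 2) (- (r / (2 * s ^+ 2))).
  by apply: is_derive_eq; rewrite /GRing.scale/=; field.
have D2 := is_derive_erfc (r / s / 2).
have D3 := is_derive_expsq s.
have -> : gaussE s = expR (- (alpha * s) ^+ 2) * expR (- (r / s / 2) ^+ 2).
  by rewrite -expRD /gaussE; congr expR; field.
by rewrite /lam_fun; apply: is_derive_eq; rewrite /GRing.scale/=; field; rewrite pn sn.
Qed.

Definition dens0 (s : R) := expR (- (alpha * s) ^+ 2) * tailg (- (r / s)).
Definition dens1 (s : R) := expR (- (alpha * s) ^+ 2) * (s * gam (r / s)).
Definition dens2 (s : R) := expR (- (alpha * s) ^+ 2) * (s ^+ 2 * tailg (- (r / s))).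

Lemma dens0E (s : R) : dens0 s = expR (- (alpha * s) ^+ 2) - lam_fun s / 2.
Proof. by rewrite /dens0 /tailg mulNr erfcN /lam_fun; field. Qed.

Lemma dens1E (s : R) : dens1 s = s * gaussE s / (2 * Num.sqrt pi).
Proof. by rewrite /dens1 /gaussE addrC expRD /gam; field; rewrite gt_eqF// sqrtpi_gt0. Qed.

Lemma is_derive_H0_fun (s : R) : 0 < s -> is_derive s (1 : R) H0_fun (2 * s * dens0 s).
Proof.
move=> s0; have sn : s != 0 by rewrite gt_eqF.
have an : alpha != 0 by rewrite gt_eqF.
have pn : Num.sqrt (pi : R) != 0 by rewrite gt_eqF// sqrtpi_gt0.
have D1 := is_derive_erfc_minus s0; have D2 := is_derive_erfc_plus s0.
have D3 := is_derive_lam_fun s0; have D4 := is_derive_expsq s.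
rewrite /H0_fun /phip; apply: is_derive_eq.
by rewrite dens0E /GRing.scale/=; field; rewrite pn sn an.
Qed.

Lemma is_derive_H1_fun (s : R) : 0 < s -> is_derive s (1 : R) H1_fun (2 * s * dens1 s).
Proof.
move=> s0; have sn : s != 0 by rewrite gt_eqF.
have an : alpha != 0 by rewrite gt_eqF.
have pn : Num.sqrt (pi : R) != 0 by rewrite gt_eqF// sqrtpi_gt0.
have D1 := is_derive_erfc_minus s0; have D2 := is_derive_erfc_plus s0.
have D3 := is_derive_gaussE s0.
rewrite /H1_fun /phip /phim /zc_fun; apply: is_derive_eq.
by rewrite dens1E /GRing.scale/=; field; rewrite pn sn an.
Qed.

Lemma is_derive_H2_fun (s : R) : 0 < s -> is_derive s (1 : R) H2_fun (2 * s * dens2 s).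
Proof.
move=> s0; have sn : s != 0 by rewrite gt_eqF.
have an : alpha != 0 by rewrite gt_eqF.
have pn : Num.sqrt (pi : R) != 0 by rewrite gt_eqF// sqrtpi_gt0.
have D0 := is_derive_H0_fun s0.
have D1 := is_derive_erfc_minus s0; have D2 := is_derive_erfc_plus s0.
have D3 := is_derive_lam_fun s0; have D4 := is_derive_expsq s.
rewrite /H2_fun /phim; apply: is_derive_eq.
have -> : dens2 s = s ^+ 2 * dens0 s by rewrite /dens2 /dens0; ring.
by rewrite dens0E /GRing.scale/=; field; rewrite pn sn an.
Qed.

Lemma cvg_right0_eq (f : R -> R) (a b : R) :
  f s @[s --> 0^'+] --> a -> a = b -> f s @[s --> 0^'+] --> b.
Proof. by move=> + <-. Qed.

Lemma gaussE_le1 (s : R) : 0 <= gaussE s <= 1.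
Proof.
rewrite expR_ge0/= -expR0 ler_expR.
have := sqr_ge0 (r / s); have := sqr_ge0 (alpha * s); lra.
Qed.

(** As [r > 0], the term [r / s / 2] tends to infinity and dominates [c * s]. Hence every
    complementary error function in the antiderivatives vanishes at time 0. *)
Lemma erfc_arg_cvg (c : R) : erfc (r / s / 2 + c * s) @[s --> 0^'+] --> (0 : R).
Proof.
apply: (@cvg_comp _ _ _ (fun s : R => r / s / 2 + c * s) erfc) (@erfc_cvgy R).
apply/cvgryPge => A; near=> s.
have s0 : 0 < s by near: s; exact: nbhs_right_gt.
have s1 : s < 1 by near: s; exact: nbhs_right_lt.
have s2 : s < r / (2 * (`|A| + `|c|) + 1).
  near: s; apply: nbhs_right_lt; rewrite divr_gt0//.
have An := ler_norm A.
have : - (c * s) <= `|c|.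
  apply: le_trans (ler_norm _) _; rewrite normrN normrM (gtr0_norm s0).
  by rewrite ler_piMr// ltW.
have : (`|A| + `|c|) <= r / s / 2.
  rewrite mulrAC ler_pdivlMr//.
  move: s2; rewrite ltr_pdivlMr; last by rewrite ltr_pwDr// mulr_ge0// addr_ge0.
  lra.
lra.
Unshelve. all: by end_near. Qed.

Lemma expsq_cvg1 : expR (- (alpha * s) ^+ 2) @[s --> 0^'+] --> (1 : R).
Proof.
have <- : expR (- (alpha * 0) ^+ 2) = 1 :> R by rewrite mulr0 expr0n/= oppr0 expR0.
by apply: cvg_at_right_filter; apply: is_derive_continuous (is_derive_expsq 0).
Qed.

Lemma lam_fun_cvg0 : lam_fun s @[s --> 0^'+] --> (0 : R).
Proof.
apply: (@cvg_right0_eq _ (1 * 0)); last by rewrite mulr0.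
apply: cvgM; first exact: expsq_cvg1.
have := erfc_arg_cvg 0; apply: cvg_trans; apply: near_eq_cvg; near=> s.
by rewrite mul0r addr0.
Unshelve. all: by end_near. Qed.

Lemma erfc_minus_cvg0 : erfc (r / s / 2 - alpha * s) @[s --> 0^'+] --> (0 : R).
Proof.
have := erfc_arg_cvg (- alpha); apply: cvg_trans; apply: near_eq_cvg; near=> s.
by rewrite mulNr.
Unshelve. all: by end_near. Qed.

Lemma phim_cvg0 : phim s @[s --> 0^'+] --> (0 : R).
Proof.
apply: (@cvg_right0_eq _ (expR (- (alpha * r)) * 0 - expR (alpha * r) * 0)); last by rewrite !mulr0 subrr.
by apply: cvgB; apply: cvgMr; [exact: erfc_minus_cvg0|exact: erfc_arg_cvg].
Qed.

Lemma phip_cvg0 : phip s @[s --> 0^'+] --> (0 : R).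
Proof.
apply: (@cvg_right0_eq _ (expR (- (alpha * r)) * 0 + expR (alpha * r) * 0)); last by rewrite !mulr0 addr0.
by apply: cvgD; apply: cvgMr; [exact: erfc_minus_cvg0|exact: erfc_arg_cvg].
Qed.

Lemma zc_fun_cvg0 : zc_fun s @[s --> 0^'+] --> (0 : R).
Proof.
have L : 4 * alpha / Num.sqrt pi * s @[s --> 0^'+] --> (0 : R).
  apply: (@cvg_right0_eq _ (4 * alpha / Num.sqrt pi * 0)); last by rewrite mulr0.
  apply: cvgMr.
  by apply: cvg_at_right_filter; exact: cvg_id.
apply: (@squeeze_cvgr _ _ _ _ (cst 0) (fun s : R => 4 * alpha / Num.sqrt pi * s)) => //; last exact: cvg_cst.
near=> s; have s0 : 0 < s by near: s; exact: nbhs_right_gt.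
have /andP[E0 E1] := gaussE_le1 s.
rewrite /zc_fun; apply/andP; split.
  by rewrite divr_ge0 ?mulr_ge0 ?sqrtr_ge0// ltW.
rewrite ler_pdivrMr ?sqrtpi_gt0//.
have -> : 4 * alpha / Num.sqrt pi * s * Num.sqrt pi = 4 * (alpha * s).
  by field; rewrite gt_eqF// sqrtpi_gt0.
by rewrite ler_piMr// !mulr_ge0// ltW.
Unshelve. all: by end_near. Qed.

Lemma H0_fun_cvg0 : H0_fun s @[s --> 0^'+] --> (0 : R).
Proof.
apply: (@cvg_right0_eq _ ((4 - 4 * 1 + 2 * 0 - 0) / (4 * alpha ^+ 2))); last by rewrite mulr1 mulr0; ring.
apply: cvgMl; apply: cvgB; last exact: phip_cvg0.
apply: cvgD; last by apply: cvgMr; exact: lam_fun_cvg0.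
by apply: cvgB; [exact: cvg_cst|apply: cvgMr; exact: expsq_cvg1].
Qed.

Lemma H1_fun_cvg0 : H1_fun s @[s --> 0^'+] --> (0 : R).
Proof.
apply: (@cvg_right0_eq _ (((0 - 0) / alpha ^+ 3 + r * 0 / alpha ^+ 2) / 8)); last by rewrite mulr0; ring.
apply: cvgMl; apply: cvgD; apply: cvgMl.
  by apply: cvgB; [exact: phim_cvg0|exact: zc_fun_cvg0].
by apply: cvgMr; exact: phip_cvg0.
Qed.

Lemma H2_fun_cvg0 : H2_fun s @[s --> 0^'+] --> (0 : R).
Proof.
apply: (@cvg_right0_eq _ ((8 * 0 - r * 0 / alpha + 4 * (0 ^+ 2) * (0 - 2 * 1)) / (8 * alpha ^+ 2))); last by rewrite expr0n/= !mulr0; ring.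
apply: cvgMl; apply: cvgD.
  apply: cvgB; first by apply: cvgMr; exact: H0_fun_cvg0.
  by apply: cvgMl; apply: cvgMr; exact: phim_cvg0.
apply: cvgM.
  apply: cvgMr; apply: cvg_at_right_filter; exact: exprn_continuous.
apply: cvgB; first exact: lam_fun_cvg0.
by apply: cvgMr; exact: expsq_cvg1.
Qed.

Lemma time_integral (x0 x1 x2 d : R) : 0 < d ->
  mu.-integrable `]0, d[ (EFin \o (fun t => x0 * dens0 (Num.sqrt t)
      + x1 * dens1 (Num.sqrt t) + x2 * dens2 (Num.sqrt t))) /\
  \int[mu]_(t in `]0%R, d[) (x0 * dens0 (Num.sqrt t) + x1 * dens1 (Num.sqrt t)
      + x2 * dens2 (Num.sqrt t)) =
  x0 * H0_fun (Num.sqrt d) + x1 * H1_fun (Num.sqrt d) + x2 * H2_fun (Num.sqrt d).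
Proof.
move=> d0.
pose H s := x0 * H0_fun s + x1 * H1_fun s + x2 * H2_fun s.
pose h t := x0 * dens0 (Num.sqrt t) + x1 * dens1 (Num.sqrt t) + x2 * dens2 (Num.sqrt t).
have F1 (t : R) : 0 < t -> {for t, continuous h}.
  move=> t0; have s0 : 0 < Num.sqrt t by rewrite sqrtr_gt0.
  have sn : Num.sqrt t != 0 by rewrite gt_eqF.
  have cs : {for t, continuous (fun t : R => Num.sqrt t)} by exact: sqrt_continuous.
  have cr : {for Num.sqrt t, continuous (fun s : R => r / s)}.
    exact: is_derive_continuous (is_derive_div sn).
  have cN : {for Num.sqrt t, continuous (fun s : R => tailg (- (r / s)))}.
    apply: (@continuous_comp _ _ _ (fun s : R => - (r / s)) tailg); first by apply: continuousN.
    exact: is_derive_continuous (is_derive_tailg _).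
  have cg : {for Num.sqrt t, continuous (fun s : R => gam (r / s))}.
    apply: (@continuous_comp _ _ _ (fun s : R => r / s) gam) => //.
    exact: continuous_gam.
  have ce := is_derive_continuous (is_derive_expsq (Num.sqrt t)).
  have c0 : {for Num.sqrt t, continuous dens0} by exact: continuousM ce cN.
  have c1 : {for Num.sqrt t, continuous dens1}.
    by apply: continuousM ce _; apply: continuousM cg; exact: cvg_id.
  have c2 : {for Num.sqrt t, continuous dens2}.
    by apply: continuousM ce _; apply: continuousM cN; exact: exprn_continuous.
  have C (c : R) (D : R -> R) : {for Num.sqrt t, continuous D} ->
      {for t, continuous (fun t => c * D (Num.sqrt t))}.
    move=> cD; apply: cvgMr.
    exact: (@continuous_comp _ _ _ (fun t : R => Num.sqrt t) D).
  by apply: continuousD; [apply: continuousD|]; apply: C.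
have F2 (t : R) : 0 < t -> is_derive t (1 : R) (fun t => H (Num.sqrt t)) (h t).
  move=> t0; have s0 : 0 < Num.sqrt t by rewrite sqrtr_gt0.
  have sn : Num.sqrt t != 0 by rewrite gt_eqF.
  have D0 := is_derive_H0_fun s0; have D1 := is_derive_H1_fun s0; have D2 := is_derive_H2_fun s0.
  have Ds := is_derive1_sqrt t0.
  rewrite /H; apply: is_derive_eq; rewrite /GRing.scale/= /h.
  by field.
have F3 (t : R) : 0 < t <= d -> `|h t| <= `|x0| + `|x1| * (1 + d) + `|x2| * d.
  move=> /andP[t0 td].
  pose s : R := Num.sqrt t; have s0 : 0 < s by rewrite sqrtr_gt0.
  have s2 : s ^+ 2 = t by rewrite sqr_sqrtr// ltW.
  have [E0 E1] : 0 <= expR (- (alpha * s) ^+ 2) /\ expR (- (alpha * s) ^+ 2) <= 1.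
    by rewrite expR_ge0 -expR0 ler_expR oppr_le0 sqr_ge0.
  have [N0 N1] := (tailg_ge0 (- (r / s)), tailg_le1 (- (r / s))).
  have [G0 G1] := (gam_ge0 (r / s), gam_le1 (r / s)).
  have b0 : `|dens0 s| <= 1 by rewrite /dens0 ger0_norm; [exact: mulr_ile1|exact: mulr_ge0].
  have b1 : `|dens1 s| <= 1 + d.
    rewrite ger0_norm; last by rewrite !mulr_ge0// ltW.
    have : dens1 s <= s by rewrite /dens1; have : s * gam (r / s) <= s by [rewrite ler_piMr// ltW]; have : 0 <= s * gam (r / s) by [rewrite mulr_ge0// ltW]; nra.
    have := sqr_ge0 (s - 1); nra.
  have b2 : `|dens2 s| <= d.
    rewrite /dens2 s2 ger0_norm; last by rewrite mulr_ge0// mulr_ge0// ltW.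
    have tN : t * tailg (- (r / s)) <= t by rewrite ler_piMr// ltW.
    have tN0 : 0 <= t * tailg (- (r / s)) by rewrite mulr_ge0// ltW.
    by apply: le_trans td; apply: le_trans tN; rewrite ler_piMl.
  have := ler_normD2 (ler_normD2 (ler_normM2 (lexx `|x0|) b0) (ler_normM2 (lexx `|x1|) b1)) (ler_normM2 (lexx `|x2|) b2).
  by rewrite /h -/s mulr1.
have F4 : H s @[s --> 0^'+] --> (0 : R).
  apply: (@cvg_right0_eq _ (x0 * 0 + x1 * 0 + x2 * 0)); last ring.
  by apply: cvgD; [apply: cvgD|]; apply: cvgMr; [exact: H0_fun_cvg0|exact: H1_fun_cvg0|exact: H2_fun_cvg0].
exact: (FTC_open_left d0 F1 F2 F3 F4).
Qed.

End TimeIntegral.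

(** * A planar curve as a graph *)

Section LocalGraph.
Context {R : realType}.

(** [W k] plays the role of the derivative of order [k] of [W 0]. The mean value inequality is
    applied from the top derivative downwards; the factorial of Taylor's formula is given up since
    only the order counts. *)
Lemma vanishing_order (N : nat) (W : nat -> R -> R) (a b K : R) : 0 <= K ->
  (forall k s, (k < N)%N -> Num.min a b <= s <= Num.max a b ->
     is_derive s (1 : R) (W k) (W k.+1 s)) ->
  (forall s, Num.min a b <= s <= Num.max a b -> `|W N s| <= K) ->
  (forall k, (k < N)%N -> W k a = 0) ->
  `|W 0%N b| <= K * `|b - a| ^+ N.
Proof.
move=> K0 dW WK W0.
have between (s x : R) : Num.min a b <= s <= Num.max a b -> Num.min a s <= x <= Num.max a s ->
    Num.min a b <= x <= Num.max a b.
  move=> /andP[s1 s2] /andP[x1 x2]; apply/andP; split.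
    by apply: le_trans x1; rewrite le_min s1 ge_min lexx.
  by apply: (le_trans x2); rewrite ge_max s2 le_max lexx.
suff H j : (j <= N)%N -> forall s, Num.min a b <= s <= Num.max a b ->
    `|W (N - j)%N s| <= K * `|s - a| ^+ j.
  have := H N (leqnn N) b; rewrite subnn; apply.
  by rewrite ge_min le_max lexx !orbT.
elim: j => [_ s sab|j IH jN s sab]; first by rewrite subn0 expr0 mulr1; exact: WK.
have E : (N - j = (N - j.+1).+1)%N by rewrite subnS prednK// subn_gt0.
have := @mean_value_bound R (W (N - j.+1)%N) (W (N - j)%N) a s (K * `|s - a| ^+ j).
rewrite W0 ?ltn_subrL ?(leq_trans _ jN)// subr0 -mulrA -exprSr; apply.
  move=> x /(between _ _ sab) xab; rewrite E; apply: dW => //.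
  by rewrite ltn_subrL ?(leq_trans _ jN).
move=> x xs; apply: le_trans (IH (ltnW jN) x (between _ _ sab xs)) _.
rewrite ler_wpM2l//; apply: lerXn2r; rewrite ?nnegrE//.
exact: norm_sub_between.
Qed.

(** [U] and [V] are the tangential and normal coordinates of a curve, with their derivatives. No
    inverse function is differentiated: [V - k / 2 * U ^+ 2 - g / 6 * U ^+ 3] has vanishing
    derivatives up to order 3 in the curve parameter, and [|s - s0| <= 2 / m * |U|] turns the
    resulting fourth-order bound into one in [U]. *)
Lemma graph_expansion (m M : R) : 0 < m -> 1 <= M -> exists2 C : R, 0 <= C &
  forall (U V : nat -> R -> R) (s0 d : R), 0 < d <= 1 -> d <= m / (2 * M) ->
  (forall k s, is_derive s (1 : R) (U k) (U k.+1 s)) ->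
  (forall k s, is_derive s (1 : R) (V k) (V k.+1 s)) ->
  (forall k s, (k <= 4)%N -> `|s - s0| <= d -> `|U k s| <= M /\ `|V k s| <= M) ->
  U 0%N s0 = 0 -> V 0%N s0 = 0 -> V 1%N s0 = 0 -> m <= `|U 1%N s0| ->
  [/\ forall s s', `|s - s0| <= d -> `|s' - s0| <= d ->
       `|U 0%N s - U 0%N s' - U 1%N s0 * (s - s')| <= m / 2 * `|s - s'|,
     forall s s', `|s - s0| <= d -> `|s' - s0| <= d ->
       m / 2 * `|s - s'| <= `|U 0%N s - U 0%N s'| &
  exists k g : R, [/\ `|k| <= C, `|g| <= C & forall s, `|s - s0| <= d ->
    `|V 0%N s - k / 2 * U 0%N s ^+ 2 - g / 6 * U 0%N s ^+ 3| <= C * `|U 0%N s| ^+ 4]].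
Proof.
move=> m0 M1; have M0 : 0 < M by lra.
pose Ck := M / m ^+ 2.
pose Cg := (M + 3 * Ck * M * M) / m ^+ 3.
(* A bound for the fourth derivative of the combination below, with [16 = 6 + 8 + 2] and
   [81 = 36 + 18 + 24 + 3] from the derivatives of the square and the cube. *)
pose K := M + Ck / 2 * (16 * M ^+ 2) + Cg / 6 * (81 * M ^+ 3).
have M0' := ltW M0; have m0' := ltW m0.
have Ck0 : 0 <= Ck by rewrite divr_ge0 ?exprn_ge0.
have Cg0 : 0 <= Cg.
  apply: divr_ge0; last exact: exprn_ge0.
  apply: addr_ge0 => //; do 2 (apply: mulr_ge0 => //); exact: mulr_ge0.
have K0 : 0 <= K.
  have := mulr_ge0 Ck0 (exprn_ge0 2 M0'); have := mulr_ge0 Cg0 (exprn_ge0 3 M0').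
  by rewrite /K; clearbody Ck Cg; move: M0'; clear; lra.
have Km0 : 0 <= K * (2 / m) ^+ 4 by rewrite mulr_ge0// exprn_ge0// divr_ge0.
exists (Ck + Cg + K * (2 / m) ^+ 4); first by rewrite !addr_ge0.
move=> U V s0 d /andP[d0 d1] dm dU dV UV U0 V0 V1 mU.
have U1n : U 1%N s0 != 0 by rewrite -normr_gt0 (lt_le_trans m0).
have lin s s' : `|s - s0| <= d -> `|s' - s0| <= d ->
    `|U 0%N s - U 0%N s' - U 1%N s0 * (s - s')| <= m / 2 * `|s - s'|.
  move=> sd sd'.
  have between (x : R) : Num.min s' s <= x <= Num.max s' s -> `|x - s0| <= d.
    move: sd sd'; rewrite !ler_norml => /andP[s1 s2] /andP[s3 s4].
    rewrite ge_min le_max => /andP[/orP[xs|xs] /orP[xs'|xs']]; apply/andP; split; lra.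
  have := @mean_value_bound R (fun s => U 0%N s - U 1%N s0 * s) (fun s => U 1%N s - U 1%N s0) s' s (m / 2).
  move=> /(_ _ _) H.
  rewrite (_ : U 0%N s - U 0%N s' - _ =
    (U 0%N s - U 1%N s0 * s) - (U 0%N s' - U 1%N s0 * s')); last by ring.
    apply: H => x /between xd.
      by have D := dU 0%N x; apply: is_derive_eq; rewrite /GRing.scale/= mulr1.
    have := @mean_value_bound R (U 1%N) (U 2%N) s0 x M.
    move=> /(_ _ _) H.
    have {}H : `|U 1%N x - U 1%N s0| <= M * `|x - s0|.
      apply: H => y yx.
      apply: (UV _ _ _ _).1 => //; apply: le_trans xd.
      exact: norm_sub_between.
    apply: le_trans H _.
    have : M * `|x - s0| <= M * (m / (2 * M)).
      by apply: ler_wpM2l => //; exact: le_trans xd dm.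
    by rewrite (_ : M * (m / (2 * M)) = m / 2)//; field; rewrite gt_eqF.
have mono s s' : `|s - s0| <= d -> `|s' - s0| <= d ->
    m / 2 * `|s - s'| <= `|U 0%N s - U 0%N s'|.
  move=> sd sd'; have := lin s s' sd sd'.
  have := lerB_normD (U 1%N s0 * (s - s')) (U 0%N s - U 0%N s' - U 1%N s0 * (s - s')).
  rewrite subrKC normrM.
  have : m * `|s - s'| <= `|U 1%N s0| * `|s - s'| by rewrite ler_wpM2r.
  lra.
split => //.
(* [k] and [g] solve the equations that the second and the third derivative of the combination
   vanish at [s0], where [U = V = V' = 0]. *)
pose k := V 2%N s0 / U 1%N s0 ^+ 2.
pose g := (V 3%N s0 - 3 * k * U 1%N s0 * U 2%N s0) / U 1%N s0 ^+ 3.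
have s0d : `|s0 - s0| <= d by rewrite subrr normr0 ltW.
have UB j s : (j <= 4)%N -> `|s - s0| <= d -> `|U j s| <= M by move=> j4 sd; have [] := UV j s j4 sd.
have VB j s : (j <= 4)%N -> `|s - s0| <= d -> `|V j s| <= M by move=> j4 sd; have [] := UV j s j4 sd.
have kC : `|k| <= Ck.
  rewrite /k normrM normfV normrX; apply: ler_pM => //; first exact: VB.
  rewrite lef_pV2 ?posrE ?exprn_gt0// ?normr_gt0//.
  by apply: lerXn2r; rewrite ?nnegrE// ltW.
have three : `|3 : R| <= 3 by rewrite ger0_norm.
have gC : `|g| <= Cg.
  rewrite /g normrM normfV normrX; apply: ler_pM => //.
    apply: ler_normD2; first exact: VB.
    rewrite normrN; apply: ler_normM2; last exact: UB.
    apply: ler_normM2; last exact: UB.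
    exact: ler_normM2.
  rewrite lef_pV2 ?posrE ?exprn_gt0// ?normr_gt0//.
  by apply: lerXn2r; rewrite ?nnegrE// ltW.
exists k, g; split.
- by apply: le_trans kC _; rewrite -addrA lerDl addr_ge0.
- by apply: le_trans gC _; rewrite addrAC lerDr addr_ge0.
move=> s sd.
pose W (j : nat) : R -> R := match j with
  | 0 => fun s => V 0%N s - k / 2 * U 0%N s ^+ 2 - g / 6 * U 0%N s ^+ 3
  | 1 => fun s => V 1%N s - k / 2 * (2 * U 0%N s * U 1%N s) - g / 6 * (3 * U 0%N s ^+ 2 * U 1%N s)
  | 2 => fun s => V 2%N s - k / 2 * (2 * U 1%N s ^+ 2 + 2 * U 0%N s * U 2%N s)
      - g / 6 * (6 * U 0%N s * U 1%N s ^+ 2 + 3 * U 0%N s ^+ 2 * U 2%N s)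
  | 3 => fun s => V 3%N s - k / 2 * (6 * U 1%N s * U 2%N s + 2 * U 0%N s * U 3%N s)
      - g / 6 * (6 * U 1%N s ^+ 3 + 18 * U 0%N s * U 1%N s * U 2%N s + 3 * U 0%N s ^+ 2 * U 3%N s)
  | _ => fun s => V 4%N s - k / 2 * (6 * U 2%N s ^+ 2 + 8 * U 1%N s * U 3%N s + 2 * U 0%N s * U 4%N s)
      - g / 6 * (36 * U 1%N s ^+ 2 * U 2%N s + 18 * U 0%N s * U 2%N s ^+ 2
                 + 24 * U 0%N s * U 1%N s * U 3%N s + 3 * U 0%N s ^+ 2 * U 4%N s)
  end.
have dW j x : (j < 4)%N -> `|x - s0| <= d -> is_derive x (1 : R) (W j) (W j.+1 x).
  move=> j4 _.
  have D0 := dU 0%N x.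
  have D1 := dU 1%N x.
  have D2 := dU 2%N x.
  have D3 := dU 3%N x.
  have E0 := dV 0%N x.
  have E1 := dV 1%N x.
  have E2 := dV 2%N x.
  have E3 := dV 3%N x.
  by case: j j4 => [|[|[|[|//]]]] _; rewrite /W/=; apply: is_derive_eq; rewrite /GRing.scale/=; field.
have WK x : `|x - s0| <= d -> `|W 4%N x| <= K.
  move=> xd.
  have sq (f : R) : `|f| <= M -> `|f ^+ 2| <= M ^+ 2 by move=> fM; rewrite normrX; apply: lerXn2r; rewrite ?nnegrE.
  have [[[b0 b1] b2] b3] := (UB 0%N x isT xd, UB 1%N x isT xd, UB 2%N x isT xd, UB 3%N x isT xd).
  have [b4 v4] := (UB 4%N x isT xd, VB 4%N x isT xd).
  have nn (n : nat) : `|n%:R : R| <= n%:R by rewrite ger0_norm.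
  have half : `|2^-1 : R| <= 2^-1 by rewrite ger0_norm.
  have sixth : `|6^-1 : R| <= 6^-1 by rewrite ger0_norm.
  have A1 := ler_normD2 (ler_normD2 (ler_normM2 (nn 6%N) (sq _ b2))
    (ler_normM2 (ler_normM2 (nn 8%N) b1) b3)) (ler_normM2 (ler_normM2 (nn 2%N) b0) b4).
  have A2 := ler_normD2 (ler_normD2 (ler_normD2
    (ler_normM2 (ler_normM2 (nn 36%N) (sq _ b1)) b2)
    (ler_normM2 (ler_normM2 (nn 18%N) b0) (sq _ b2)))
    (ler_normM2 (ler_normM2 (ler_normM2 (nn 24%N) b0) b1) b3))
    (ler_normM2 (ler_normM2 (nn 3%N) (sq _ b0)) b4).
  have B1 := ler_normM2 (ler_normM2 kC half) A1.
  have B2 := ler_normM2 (ler_normM2 gC sixth) A2.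
  rewrite -normrN in B1; rewrite -normrN in B2.
  have := ler_normD2 (ler_normD2 v4 B1) B2.
  move=> H; apply: (le_trans H); rewrite le_eqVlt; apply/orP; left; apply/eqP.
  by rewrite /K; ring.
have W0 j : (j < 4)%N -> W j s0 = 0.
  by case: j => [|[|[|[|//]]]] _; rewrite /W /= ?U0 ?V0 ?V1 /g /k; field.
have ball x : Num.min s0 s <= x <= Num.max s0 s -> `|x - s0| <= d.
  by move=> /norm_sub_between h; exact: le_trans h sd.
have := @vanishing_order 4 W s0 s K K0 (fun k x k4 xs => dW k x k4 (ball x xs))
  (fun x xs => WK x (ball x xs)) W0.
move=> /= H; apply: le_trans H _.
have := mono s s0 sd s0d; rewrite U0 subr0 => H.
have H1 : `|s - s0| <= 2 / m * `|U 0%N s|.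
  by rewrite mulrAC ler_pdivlMr//; lra.
have H2 : `|s - s0| ^+ 4 <= (2 / m * `|U 0%N s|) ^+ 4.
  by apply: lerXn2r => //; rewrite nnegrE// (le_trans _ H1).
have := ler_wpM2l K0 H2; rewrite exprMn mulrA => H3; apply: le_trans H3 _.
by rewrite mulrA; apply: ler_wpM2r; rewrite ?exprn_ge0// lerDr addr_ge0.
Qed.

End LocalGraph.

(** * Paths that avoid a boundary, and orthonormal frames *)

Section PathsAndBoundaries.
Context {R : realType}.

(** Along the path membership in [A], in its closure and in its interior agree, so the parameters
    with [p t] in [A] are open and closed in the segment. The space is general because the lemma
    also serves sets of parameters of the curve. *)
Lemma path_avoiding_boundary (T : topologicalType) (A : set T) (p : R -> T) (a b : R) :
  a <= b -> continuous p ->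
  (forall t, a <= t <= b -> closure A (p t) -> interior A (p t)) ->
  A (p a) <-> A (p b).
Proof.
move=> ab cp inter.
pose B := [set t | t \in `[a, b] /\ A (p t)].
suff H : B !=set0 -> B = [set` `[a, b]].
  have ha : a \in `[a, b] by rewrite in_itv/= lexx.
  have hb : b \in `[a, b] by rewrite in_itv/= lexx andbT.
  split => h.
    have E := H (ex_intro _ a (conj ha h)).
    by have : [set` `[a, b]] b := hb; rewrite -E => -[].
  have E := H (ex_intro _ b (conj hb h)).
  by have : [set` `[a, b]] a := ha; rewrite -E => -[].
move=> B0; apply: (@segment_connected R a b) => //.
- exists (p @^-1` (interior A)); first by apply: open_comp => //; exact: open_interior.
  apply/seteqP; split => t /=.
    move=> [tab At]; split => //; apply: inter; last exact: subset_closure.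
    by move: tab; rewrite in_itv.
  by move=> [tab /interior_subset At].
- exists (p @^-1` (closure A)); first by apply: closed_comp => //; exact: closed_closure.
  apply/seteqP; split => t /=.
    by move=> [tab At]; split => //; exact: subset_closure.
  move=> [tab At]; split => //; apply: interior_subset; apply: inter; last exact: At.
  by move: tab; rewrite in_itv.
Qed.

Lemma domain_closure_neqT (Omega : set (R * R)) :
  interior_or_exterior_domain Omega -> exists y, ~ closure Omega y.
Proof.
move=> [_ [[M [Mr HM]]|[D [[oD [y Dy] _] _ ->]]]].
  have M1 : M < Num.max M 0 + 1 by rewrite ltr_pwDr// le_max lexx.
  have M0 : 0 <= Num.max M 0 by rewrite le_max lexx orbT.
  (* Points of the bounded set have norm at most [Num.max M 0 + 1], so the ball of radius 1 around
     [y] misses them. *)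
  pose y : R * R := (Num.max M 0 + 2, 0).
  exists y => /(_ _ (nbhsx_ballx y (1 : R) ltr01))[z [Oz]].
  rewrite /ball/= /prod_ball/= => -[+ _]; rewrite /ball/=.
  have := HM _ M1 z Oz; rewrite /= prod_normE/= ge_max => /andP[+ _].
  by rewrite ltr_norml ler_norml => /andP[_ h] /andP[h1 h2]; lra.
exists y => /(_ _ (open_nbhs_nbhs (conj oD Dy)))[z [/= nDz Dz]].
by apply: nDz; exact: subset_closure.
Qed.

Implicit Types (tau n u v x y : R * R) (p q r : R).

Definition orthonormal_pair tau n := [/\ dotp tau tau = 1, dotp n n = 1 & dotp tau n = 0].

Lemma orthonormal_det tau n : orthonormal_pair tau n ->
  (tau.1 * n.2 - tau.2 * n.1) ^+ 2 = 1.
Proof.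
move=> []; rewrite /dotp => h1 h2 h3.
have -> : (tau.1 * n.2 - tau.2 * n.1) ^+ 2 = (tau.1 * tau.1 + tau.2 * tau.2) *
  (n.1 * n.1 + n.2 * n.2) - (tau.1 * n.1 + tau.2 * n.2) ^+ 2 by ring.
by rewrite h1 h2 h3; ring.
Qed.

(** Orthonormal rows give orthonormal columns: [n] is [tau] turned by a right angle, times the
    determinant, whose square is 1. *)
Lemma orthonormal_sym tau n : orthonormal_pair tau n ->
  [/\ tau.1 ^+ 2 + n.1 ^+ 2 = 1, tau.2 ^+ 2 + n.2 ^+ 2 = 1 & tau.1 * tau.2 + n.1 * n.2 = 0].
Proof.
move=> on; have d2 := orthonormal_det on.
case: on; rewrite /dotp => h1 h2 h3.
set D := tau.1 * n.2 - tau.2 * n.1 in d2.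
have e1 : n.2 = D * tau.1.
  have -> : n.2 = n.2 * 1 by ring.
  rewrite -h1 /D; transitivity (n.2 * (tau.1 * tau.1 + tau.2 * tau.2) - tau.2 * (tau.1 * n.1 + tau.2 * n.2)); last by ring.
  by rewrite h3; ring.
have e2 : n.1 = - D * tau.2.
  have -> : n.1 = n.1 * 1 by ring.
  rewrite -h1 /D; transitivity (n.1 * (tau.1 * tau.1 + tau.2 * tau.2) - tau.1 * (tau.1 * n.1 + tau.2 * n.2)); last by ring.
  by rewrite h3; ring.
rewrite e1 e2; split.
- by rewrite exprMn sqrrN d2 mul1r -h1; ring.
- by rewrite exprMn d2 mul1r -h1; ring.
by transitivity ((1 - D ^+ 2) * (tau.1 * tau.2)); [ring|rewrite d2; ring].
Qed.

Lemma orthonormal_expand tau n v : orthonormal_pair tau n ->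
  v = dotp v tau *: tau + dotp v n *: n.
Proof.
move=> /orthonormal_sym[h1 h2 h3].
case: v => v1 v2; rewrite /dotp; apply/pair_equal_spec; split => /=; rewrite /GRing.scale/=.
  transitivity (v1 * (tau.1 ^+ 2 + n.1 ^+ 2) + v2 * (tau.1 * tau.2 + n.1 * n.2)); last by ring.
  by rewrite h1 h3; ring.
transitivity (v2 * (tau.2 ^+ 2 + n.2 ^+ 2) + v1 * (tau.1 * tau.2 + n.1 * n.2)); last by ring.
by rewrite h2 h3; ring.
Qed.

Definition frame x tau n p q : R * R := x + p *: tau + q *: n.

Lemma frame_dotp x tau n p q : orthonormal_pair tau n ->
  dotp (frame x tau n p q - x) tau = p /\ dotp (frame x tau n p q - x) n = q.
Proof.
move=> []; rewrite /dotp /frame /= /GRing.scale/= => h1 h2 h3.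
split; [transitivity (p * (tau.1 * tau.1 + tau.2 * tau.2) + q * (tau.1 * n.1 + tau.2 * n.2)) |
   transitivity (q * (n.1 * n.1 + n.2 * n.2) + p * (tau.1 * n.1 + tau.2 * n.2))]; try ring.
  by rewrite h1 h3; ring.
by rewrite h2 h3; ring.
Qed.

Lemma frame_onto x tau n y : orthonormal_pair tau n ->
  y = frame x tau n (dotp (y - x) tau) (dotp (y - x) n).
Proof.
by move=> on; rewrite /frame -addrA -orthonormal_expand// addrC subrK.
Qed.

Lemma orthonormal_le1 tau n : orthonormal_pair tau n ->
  [/\ `|tau.1| <= 1, `|tau.2| <= 1, `|n.1| <= 1 & `|n.2| <= 1].
Proof.
move=> /orthonormal_sym[h1 h2 _].
have sq (a b : R) : a ^+ 2 + b ^+ 2 = 1 -> `|a| <= 1.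
  move=> h; rewrite -(ler_sqr (x := `|a|)) ?nnegrE// real_normK ?num_real// expr1n -h.
  by rewrite lerDl sqr_ge0.
by split; [exact: sq h1|exact: sq h2| |]; [apply: (@sq _ tau.1)|apply: (@sq _ tau.2)]; rewrite addrC.
Qed.

Lemma dotp_bound v w : `|w.1| <= 1 -> `|w.2| <= 1 -> `|dotp v w| <= `|v.1| + `|v.2|.
Proof.
move=> w1 w2; rewrite /dotp.
apply: (le_trans (ler_normD _ _)); rewrite !normrM.
by apply: lerD; rewrite ler_piMr.
Qed.

End PathsAndBoundaries.

(** * Closed curves: periodicity, compactness and separation of arcs *)

Section ClosedCurve.
Context {R : realType}.
Implicit Types (c : R -> R * R) (L s t : R) (B : set (R * R)) (tau n v w x y : R * R).

Lemma continuous_dotpl w : continuous (fun v => dotp v w).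
Proof.
move=> v; apply: cvgD; apply: cvgM; try exact: cvg_cst.
  exact: cvg_fst.
exact: cvg_snd.
Qed.

Lemma is_derive_dotp (f : R -> R * R) t w : derivable f t 1 ->
  is_derive t (1 : R) (fun s => dotp (f s) w) (dotp (derive1 f t) w).
Proof.
move=> df.
have H : h^-1 *: (((fun s => dotp (f s) w) \o shift t) (h *: 1) - dotp (f t) w) @[h --> 0^'] --> dotp (derive1 f t) w.
  have := cvg_comp _ _ df (@continuous_dotpl w _).
  rewrite derive1E /derive; apply: cvg_trans; apply: near_eq_cvg.
  apply: nearW => h; rewrite /= /dotp /= /GRing.scale/= /GRing.scale/=.
  clear; ring.
by apply: DeriveDef; [exact: cvgP H|exact: cvg_lim H].
Qed.

Lemma derivable_continuous (f : R -> R * R) : (forall t, derivable f t 1) -> continuous f.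
Proof. by move=> df t; move/derivable1_diffP : (df t) => /differentiable_continuous. Qed.

Lemma curve_period c L B : smooth_closed_curve c L B ->
  forall (k : int) s, c (s + k%:~R * L) = c s.
Proof.
move=> [L0 _ _ [per _ _]].
have pern (k : nat) s : c (s + k%:R * L) = c s.
  by elim: k => [|k IH]; rewrite ?mul0r ?addr0// -natr1 mulrDl mul1r addrA per.
move=> [k|k] s; first exact: pern.
by rewrite -(pern k.+1) NegzE mulrNz mulNr subrK.
Qed.

Lemma curve_reduce c L B : smooth_closed_curve c L B -> forall s0 s,
  exists2 w : R, 0 <= w < L & exists k : int, s = s0 + w + k%:~R * L.
Proof.
move=> [L0 _ _ _] s0 s.
pose k := Num.floor ((s - s0) / L).
exists (s - s0 - k%:~R * L).
  have /andP[h1 h2] := mem_rg1_floor ((s - s0) / L).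
  rewrite subr_ge0 -ler_pdivlMr// h1/= ltrBlDr -[X in _ < X + _]mul1r -mulrDl -ltr_pdivrMr// [X in _ < X]addrC.
  by move: h2; rewrite /= -?intrD1.
by exists k; ring.
Qed.

(** Injectivity is available on [[0, L[] only, so both parameters are reduced modulo [L]; equality
    would make [w] a multiple of [L] strictly between 0 and [L]. *)
Lemma curve_eq c L B : smooth_closed_curve c L B -> forall s (w : R),
  0 < w < L -> c (s + w) != c s.
Proof.
move=> sc s w /andP[w0 wL]; apply/eqP => E.
have [L0 _ _ [_ inj _]] := sc.
have [a /andP[a0 aL] [k ka]] := curve_reduce sc 0 s.
have [b /andP[b0 bL] [l lb]] := curve_reduce sc 0 (s + w).
rewrite lb {1}ka !(curve_period sc) !add0r in E.
have ia : a \in `[0, L[ by rewrite in_itv/= a0.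
have ib : b \in `[0, L[ by rewrite in_itv/= b0.
have ba := inj b a ib ia E.
rewrite ka ba !add0r in lb.
have wE : w = (l - k)%:~R * L by rewrite intrB mulrBl; lra.
have : 0 < ((l - k)%:~R : R) < 1.
  by rewrite -(pmulr_lgt0 _ L0) -wE w0/= -(ltr_pM2r L0) mul1r -wE.
by rewrite ltr0z ltrz1 gtz0_ge1 => /andP[/le_lt_trans h /h]; rewrite ltxx.
Qed.

Lemma continuous_bounded_segment (g : R -> R * R) (a b : R) : continuous g ->
  exists M : R, forall s, a <= s <= b -> `|g s| <= M.
Proof.
move=> cg; have [ab|ba] := leP a b; last first.
  by exists 0 => s /andP[h1 h2]; have := le_trans h1 h2; rewrite leNgt ba.
have [|m _ H] := @EVT_max R (fun s => `|g s|) a b ab.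
  apply: continuous_subspaceT => s; apply: cvg_norm; exact: cg.
by exists `|g m| => s sab; apply: H; rewrite in_itv.
Qed.

(** The range from [- L] to [2 * L] contains every parameter within [L] of a base point in
    [[0, L]]. *)
Lemma curve_derivatives_bounded c L B (N : nat) : smooth_closed_curve c L B ->
  exists2 M : R, 1 <= M & forall k s, (k <= N)%N -> - L <= s <= 2 * L ->
    `|derive1n k c s| <= M.
Proof.
move=> [L0 dc _ _].
have cc k : continuous (derive1n k c) by apply: derivable_continuous.
elim: N => [|N [M M1 IH]].
  have [M HM] := @continuous_bounded_segment _ (- L) (2 * L) (cc 0%N).
  exists (Num.max M 1); first by rewrite le_max lexx orbT.
  by move=> [|//] s _ sL; rewrite le_max HM.
have [M' HM] := @continuous_bounded_segment _ (- L) (2 * L) (cc N.+1).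
exists (Num.max M' M); first by rewrite le_max M1 orbT.
move=> k s; rewrite leq_eqVlt => /orP[/eqP->|kN] sL; rewrite le_max ?HM//.
by rewrite IH// orbT.
Qed.

Lemma dotp_gt0 v : v != 0 -> 0 < dotp v v.
Proof.
case: v => a b; rewrite /dotp/= -!expr2 => h.
rewrite lt_def addr_ge0 ?sqr_ge0// andbT paddr_eq0 ?sqr_ge0// !sqrf_eq0.
by apply: contra h => /andP[/eqP-> /eqP->].
Qed.

Lemma curve_speed c L B : smooth_closed_curve c L B ->
  exists2 m : R, 0 < m & forall s, 0 <= s <= L -> m ^+ 2 <= dotp (derive1 c s) (derive1 c s).
Proof.
move=> [L0 dc nz _].
have cc : continuous (derive1 c) by apply: derivable_continuous; exact: (dc 1%N).
have [|a _ H] := @EVT_min R (fun s => dotp (derive1 c s) (derive1 c s)) 0 L (ltW L0).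
  apply: continuous_subspaceT => s; apply: cvgD; apply: cvgM.
  - by apply: continuous_comp; [exact: cc|exact: cvg_fst].
  - by apply: continuous_comp; [exact: cc|exact: cvg_fst].
  - by apply: continuous_comp; [exact: cc|exact: cvg_snd].
  - by apply: continuous_comp; [exact: cc|exact: cvg_snd].
exists (Num.sqrt (dotp (derive1 c a) (derive1 c a))).
  by rewrite sqrtr_gt0; apply: dotp_gt0.
move=> s sL; rewrite sqr_sqrtr; last by apply/ltW/dotp_gt0.
by apply: H; rewrite in_itv.
Qed.

(* Keeps other arcs of the curve away from the one through c s0. *)
Lemma curve_separation c L B (d : R) : smooth_closed_curve c L B -> 0 < d ->
  exists2 e : R, 0 < e & forall s0 s, 0 <= s0 <= L -> `|c s - c s0| < e ->
    exists2 s' : R, `|s' - s0| <= d & c s' = c s.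
Proof.
move=> sc d0; have [L0 dc _ _] := sc.
have cc : continuous c by apply: derivable_continuous; exact: (dc 0%N).
have cG : continuous (fun z : R * R => `|c (z.1 + z.2) - c z.1|).
  move=> z; apply: cvg_norm; apply: cvgB.
    apply: (@continuous_comp _ _ _ (fun z : R * R => z.1 + z.2) c); last exact: cc.
    by apply: cvgD; [exact: cvg_fst|exact: cvg_snd].
  by apply: (@continuous_comp _ _ _ (fun z : R * R => z.1) c); [exact: cvg_fst|exact: cc].
have near_end s0 s (w : R) : 0 <= w < L -> (exists k : int, s = s0 + w + k%:~R * L) ->
    w <= d \/ L - d <= w -> exists2 s' : R, `|s' - s0| <= d & c s' = c s.
  move=> /andP[w0 wL] [k ->] [h|h].
    exists (s0 + w); last by rewrite (curve_period sc).
    by rewrite addrAC subrr add0r ger0_norm.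
  exists (s0 + w + (-1)%:~R * L); last by rewrite !(curve_period sc).
  by rewrite mulrN1z mulN1r ler_norml; apply/andP; split; lra.
have [dL|dL] := leP d (L - d); last first.
  exists 1 => // s0 s _ _.
  have [w wL k] := curve_reduce sc s0 s; apply: near_end wL k _.
  by have [wd|wd] := leP w d; [left|right; lra].
(* Pairs of a base point and an offset away from 0 and [L]. On this compact set the distance is
   positive by [curve_eq], and its minimum is the separation wanted. *)
pose K : set (R * R) := [set` `[0, L]] `*` [set` `[d, L - d]].
have cK : compact K by apply: compact_setX; exact: segment_compact.
have K0 : K !=set0 by exists (0, d); split; rewrite /= in_itv/= lexx// ltW.
have [|z /set_mem[z1 z2] Hz] := compact_EVT_min K0 cK (f := fun z : R * R => `|c (z.1 + z.2) - c z.1|).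
  exact: continuous_subspaceT.
exists `|c (z.1 + z.2) - c z.1|.
  rewrite normr_gt0 subr_eq0; apply: (curve_eq sc).
  by move: z2; rewrite /= in_itv/= => /andP[h1 h2]; apply/andP; split; lra.
move=> s0 s s0L close.
have [w wL [k ks]] := curve_reduce sc s0 s; apply: (near_end _ _ w wL); first by exists k.
have [|dw] := leP w d; first by left.
have [|wd] := leP (L - d) w; first by right.
have zK : (s0, w) \in K.
  apply/mem_set; split; rewrite /= in_itv/=; first exact: s0L.
  by rewrite (ltW dw) (ltW wd).
exfalso; have := Hz _ zK; rewrite leNgt /= => /negP; apply.
by move: close; rewrite ks (curve_period sc).
Qed.

End ClosedCurve.

Section BoundaryGraph.
Context {R : realType}.
Implicit Types (c : R -> R * R) (L s t : R) (B : set (R * R)) (tau n x y : R * R).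

(** [C] and [rho] precede the base point: bounds on derivatives, minimal speed and separation are
    obtained by compactness over whole periods. The graph itself comes from the intermediate value
    theorem for the tangential coordinate. *)
Lemma curve_local_graph c L B : smooth_closed_curve c L B ->
  exists2 C : R, 1 <= C & exists2 rho : R, 0 < rho <= 1 &
  forall s0 tau n, 0 <= s0 <= L -> orthonormal_pair tau n -> dotp (derive1 c s0) n = 0 ->
  exists k g q, [/\ `|k| <= C, `|g| <= C,
    forall u : R, `|u| <= rho -> `|q u - k / 2 * u ^+ 2 - g / 6 * u ^+ 3| <= C * u ^+ 4 &
    forall u v : R, `|u| <= rho -> `|v| <= rho ->
      (B (frame (c s0) tau n u v) <-> v = q u)].
Proof.
move=> sc; have [L0 dc _ [_ _ rB]] := sc.
have [M0 M01 HM] := curve_derivatives_bounded 4 sc.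
have [m m0 Hm] := curve_speed sc.
(* One factor 2 for subtracting the base point, another for the product with a unit vector, which is
   estimated by the sum of two coordinates. *)
pose M := 4 * M0.
have M1 : 1 <= M by rewrite /M; lra.
have [C C0 HC] := graph_expansion m0 M1.
pose d : R := Num.min (Num.min 1 L) (m / (2 * M)).
have mM : 0 < m / (2 * M) by rewrite divr_gt0//; lra.
have d0 : 0 < d by rewrite !lt_min ltr01 L0.
have d1 : d <= 1 by rewrite /d !ge_min lexx.
have dL : d <= L by rewrite /d !ge_min lexx orbT.
have dm : d <= m / (2 * M) by rewrite /d ge_min lexx orbT.
have [e e0 He] := curve_separation sc d0.
(* [m * d / 2] is a height that the tangential coordinate reaches in both directions within [d];
   [e / 4] puts the whole box within [e] of the base point, where the separation excludes other
   arcs. *)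
pose rho : R := Num.min (Num.min 1 (m * d / 2)) (e / 4).
have md0 : 0 < m * d / 2 by rewrite divr_gt0// mulr_gt0.
exists (C + 1); first by rewrite lerDr.
exists rho.
  rewrite !lt_min ltr01 md0 divr_gt0//=; by rewrite !ge_min lexx.
have rho_d : rho <= m * d / 2 by rewrite /rho !ge_min lexx orbT.
have rho_e : rho <= e / 4 by rewrite /rho ge_min lexx orbT.
move=> s0 tau n /andP[s00 s0L] on c1n.
pose V (w : R * R) (k : nat) s := dotp (derive1n k c s - (if k is 0 then c s0 else 0)) w.
have dV w k s : is_derive s (1 : R) (V w k) (V w k.+1 s).
  have D : is_derive s (1 : R) (fun s => dotp (derive1n k c s) w) (dotp (derive1n k.+1 c s) w).
    by rewrite derive1nS; exact: is_derive_dotp.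
  have -> : V w k = (fun s => dotp (derive1n k c s) w - dotp (if k is 0 then c s0 else 0) w).
    by apply/funext => x; rewrite /V /dotp/=; ring.
  by apply: is_derive_eq; rewrite /V /dotp/=; ring.
have sL s : `|s - s0| <= d -> - L <= s <= 2 * L.
  by rewrite ler_distl => /andP[h1 h2]; apply/andP; split; lra.
have VM w k s : `|w.1| <= 1 -> `|w.2| <= 1 -> (k <= 4)%N -> `|s - s0| <= d -> `|V w k s| <= M.
  move=> w1 w2 k4 sd; apply: (le_trans (dotp_bound _ w1 w2)).
  have nb (y : R * R) : `|y.1| <= `|y| /\ `|y.2| <= `|y|.
    by rewrite prod_normE !le_max !lexx orbT.
  have [h1 h2] := nb (derive1n k c s - (if k is 0 then c s0 else 0)).
  have h3 : `|derive1n k c s - (if k is 0 then c s0 else 0)| <= 2 * M0.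
    apply: (le_trans (ler_normB _ _)); rewrite mulr_natl mulr2n; apply: lerD.
      by apply: HM => //; exact: sL.
    case: (k) => [|?]; last by rewrite normr0; lra.
    by apply: (HM 0%N) => //; apply: sL; rewrite subrr normr0 ltW.
  by rewrite /M; lra.
have [t1 t2 n1 n2] := orthonormal_le1 on.
have V00 w : V w 0%N s0 = 0 by rewrite /V/= subrr /dotp !mul0r addr0.
have U1 : m <= `|V tau 1%N s0|.
  have m0' := ltW m0.
  suff H : m ^+ 2 <= V tau 1%N s0 ^+ 2.
    by rewrite -(@ler_pXn2r _ 2%N)// real_normK// num_real.
  have s0I : 0 <= s0 <= L by rewrite s00.
  apply: (le_trans (Hm _ s0I)).
  rewrite /V/= subr0 [X in dotp X _](orthonormal_expand _ on) c1n scale0r addr0.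
  rewrite [X in dotp _ X](orthonormal_expand _ on) c1n scale0r addr0.
  by case: on => h _ _; rewrite /dotp/= /GRing.scale/= -[leRHS]mulr1 -h /dotp; lra.
have d01 : 0 < d <= 1 by rewrite d0.
have UV k s : (k <= 4)%N -> `|s - s0| <= d -> `|V tau k s| <= M /\ `|V n k s| <= M.
  by move=> k4 sd; split; exact: VM.
have V10 : V n 1%N s0 = 0 by rewrite /V/= subr0.
have [lin mono [k [g [kC gC kg]]]] :=
  HC (V tau) (V n) s0 d d01 dm (dV tau) (dV n) UV (V00 tau) (V00 n) V10 U1.
have sd0 : `|s0 - s0| <= d by rewrite subrr normr0 ltW.
have ivt u : `|u| <= rho -> exists s, `|s - s0| <= d /\ V tau 0%N s = u.
  move=> ur.
  have hp : `|s0 + d - s0| <= d by rewrite addrC addKr ger0_norm// ltW.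
  have hm : `|s0 - d - s0| <= d by rewrite addrC addKr normrN ger0_norm// ltW.
  have := lin _ _ hp sd0; have := lin _ _ hm sd0.
  rewrite (_ : s0 + d - s0 = d); last by ring.
  rewrite (_ : s0 - d - s0 = - d); last by ring.
  rewrite V00 !subr0 normrN (ger0_norm (ltW d0)) => Lm Lp.
  have mp : Num.min (V tau 0%N (s0 - d)) (V tau 0%N (s0 + d)) <= u <=
            Num.max (V tau 0%N (s0 - d)) (V tau 0%N (s0 + d)).
    have ur' : `|u| <= m / 2 * d by rewrite mulrAC (le_trans ur).
    move: ur' Lm Lp; rewrite ge_min le_max !ler_norml => /andP[u1 u2] /andP[a1 a2] /andP[b1 b2].
    move: U1; have [V1p|V1n] := ger0P (V tau 1%N s0).
      move/(ler_wpM2r (ltW d0)) => h; apply/andP; split; apply/orP; [left|right]; move: h a1 a2 b1 b2 u1 u2; clear; lra.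
    move/(ler_wpM2r (ltW d0)) => h; apply/andP; split; apply/orP; [right|left]; move: h a1 a2 b1 b2 u1 u2; clear; lra.
  have [||s sI <-] := @IVT R (V tau 0%N) (s0 - d) (s0 + d) u _ _ mp.
  - by lra.
  - by apply: continuous_subspaceT => s; exact: is_derive_continuous (dV tau 0%N s).
  exists s; split => //; rewrite ler_distl.
  by move: sI; rewrite in_itv.
(* The parameter of the curve point with tangential coordinate [u]; the default 0 concerns only [u]
   outside the box. *)
pose S u := if pselect (`|u| <= rho) is left h then projT1 (cid (ivt u h)) else 0.
have SP u : `|u| <= rho -> `|S u - s0| <= d /\ V tau 0%N (S u) = u.
  by move=> ur; rewrite /S; case: pselect => // h; case: cid.
have cS s : c s = frame (c s0) tau n (V tau 0%N s) (V n 0%N s) by exact: frame_onto.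
exists k, g, (fun u => V n 0%N (S u)); split.
- by lra.
- by lra.
- move=> u ur; have [Sd Su] := SP u ur.
  have := kg _ Sd; rewrite Su => h; apply: (le_trans h).
  rewrite -normrX ger0_norm; last by rewrite -[4%N]/(2 * 2)%N exprM sqr_ge0.
  by apply: ler_wpM2r; [rewrite -[4%N]/(2 * 2)%N exprM sqr_ge0|lra].
move=> u v ur vr; have [Sd Su] := SP u ur; split.
  rewrite -rB => -[s _ cs].
  have close : `|c s - c s0| < e.
    rewrite cs /frame prod_normE/= /GRing.scale/= gt_max.
    have h (a b : R) : `|a| <= 1 -> `|b| <= 1 -> forall z, `|z + u * a + v * b - z| < e.
      move=> a1 b1 z; rewrite (_ : z + u * a + v * b - z = u * a + v * b); last by ring.
      have := ler_normD2 (ler_normM2 ur a1) (ler_normM2 vr b1).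
      by move=> h; apply: (le_lt_trans h); lra.
    by rewrite !h.
  have s0I : 0 <= s0 <= L by rewrite s00.
  have [s' s'd cs'] := He _ _ s0I close.
  have [eu ev] : V tau 0%N s' = u /\ V n 0%N s' = v.
    by rewrite /V/= cs' cs; exact: frame_dotp.
  have := mono _ _ s'd Sd; rewrite eu Su subrr normr0 pmulr_rle0 ?divr_gt0// normr_le0 subr_eq0.
  by move=> /eqP <-; rewrite ev.
by move=> ->; rewrite -[X in frame _ _ _ X _]Su -cS -rB; exists (S u).
Qed.

End BoundaryGraph.

(** * The domain lies on one side of its boundary *)

Section OneSidedness.
Context {R : realType}.
Implicit Types (c : R -> R * R) (L s t : R) (A B Omega : set (R * R)) (tau n x y : R * R).

Lemma frame_nbhs x tau n (rho : R) : orthonormal_pair tau n -> 0 < rho ->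
  nbhs x [set y | exists u v : R, [/\ `|u| < rho, `|v| < rho & y = frame x tau n u v]].
Proof.
move=> on rho0.
have near0 w : \forall y \near x, `|dotp (y - x) w| < rho.
  have : (fun y => dotp (y - x) w) @ x --> dotp (x - x) w.
    have h : (y - x) @[y --> x] --> x - x by apply: cvgB; [exact: cvg_id|exact: cvg_cst].
    exact: (cvg_comp _ _ h (@continuous_dotpl _ w _)).
  rewrite subrr (_ : dotp 0 w = 0); last by rewrite /dotp !mul0r addr0.
  by move=> /cvgr0_norm_lt; apply.
near=> y; exists (dotp (y - x) tau), (dotp (y - x) n); split.
- by near: y; exact: near0.
- by near: y; exact: near0.
- exact: frame_onto.
Unshelve. all: by end_near. Qed.

Lemma frameN x tau n (u v : R) : frame x tau (- n) u (- v) = frame x tau n u v.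
Proof. by rewrite /frame scaleNr scalerN opprK. Qed.

Lemma orthonormal_pairN tau n : orthonormal_pair tau n -> orthonormal_pair tau (- n).
Proof.
by case; rewrite /dotp/= => h1 h2 h3; split; rewrite /dotp/= ?mulrNN// !mulrN -opprD h3 oppr0.
Qed.

(** Two points above the graph are joined without touching it: up to the height [rho], along the top
    edge, and down again. The top edge is free because [|q u| < rho]. *)
Lemma same_side A x tau n (rho : R) (q : R -> R) :
  0 < rho -> (forall u : R, `|u| <= rho -> `|q u| < rho) ->
  (forall u v : R, `|u| <= rho -> `|v| <= rho -> boundary A (frame x tau n u v) -> v = q u) ->
  forall u v u' v' : R, `|u| <= rho -> `|v| <= rho -> `|u'| <= rho -> `|v'| <= rho ->
    q u < v -> q u' < v' ->
    A (frame x tau n u v) <-> A (frame x tau n u' v').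
Proof.
move=> rho0 qrho bA.
have rr : `|rho| <= rho by rewrite ger0_norm// ltW.
have inter u v : `|u| <= rho -> `|v| <= rho -> v != q u ->
    closure A (frame x tau n u v) -> interior A (frame x tau n u v).
  move=> ur vr /eqP nq cA; apply: contrapT => nI; apply: nq; exact: bA.
have up u v : `|u| <= rho -> `|v| <= rho -> q u < v ->
    A (frame x tau n u v) <-> A (frame x tau n u rho).
  move=> ur vr qv; have vrho : v <= rho := le_trans (ler_norm v) vr.
  apply: (path_avoiding_boundary (p := fun t => frame x tau n u t)) => //.
    by move=> t; apply: cvgD; [exact: cvg_cst|apply: cvgZl; exact: cvg_id].
  move=> t /andP[vt tr]; apply: inter => //.
    rewrite ler_norml tr andbT; apply: le_trans vt.
    by move: vr; rewrite ler_norml => /andP[].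
  by rewrite gt_eqF// (lt_le_trans qv).
have across u u' : `|u| <= rho -> `|u'| <= rho -> u <= u' ->
    A (frame x tau n u rho) <-> A (frame x tau n u' rho).
  move=> ur ur' uu.
  apply: (path_avoiding_boundary (p := fun t => frame x tau n t rho)) => //.
    move=> t; apply: cvgD; last exact: cvg_cst.
    by apply: cvgD; [exact: cvg_cst|apply: cvgZl; exact: cvg_id].
  move=> t /andP[ut tu].
  have tr : `|t| <= rho.
    move: ur ur'; rewrite !ler_norml => /andP[h1 h2] /andP[h3 h4].
    by rewrite (le_trans h1 ut) (le_trans tu h4).
  apply: inter => //; rewrite gt_eqF//.
  exact: le_lt_trans (ler_norm _) (qrho _ tr).
move=> u v u' v' ur vr ur' vr' qv qv'.
rewrite up// [X in _ <-> X]up//.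
by have [uu|/ltW uu] := leP u u'; [exact: across|apply: iff_sym; exact: across].
Qed.

Lemma same_side_below A x tau n (rho : R) (q : R -> R) :
  0 < rho -> (forall u : R, `|u| <= rho -> `|q u| < rho) ->
  (forall u v : R, `|u| <= rho -> `|v| <= rho -> boundary A (frame x tau n u v) -> v = q u) ->
  forall u v u' v' : R, `|u| <= rho -> `|v| <= rho -> `|u'| <= rho -> `|v'| <= rho ->
    v < q u -> v' < q u' ->
    A (frame x tau n u v) <-> A (frame x tau n u' v').
Proof.
move=> rho0 qrho bA u v u' v' ur vr ur' vr' qv qv'.
rewrite -frameN -[X in _ <-> A X]frameN.
apply: (@same_side A x tau (- n) rho (fun u => - q u)); rewrite ?normrN ?ltrN2//.
  by move=> w wr; rewrite normrN; exact: qrho.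
move=> a b ar br; rewrite -[b]opprK frameN => h.
by congr (- _); apply: bA => //; rewrite normrN.
Qed.

(** If both sides belong to the domain, then the graph between them, consisting of boundary points,
    lies in the closure, and hence so does the whole box. *)
Lemma two_sides_interior_closure Omega x tau n (rho : R) (q : R -> R) :
  orthonormal_pair tau n -> 0 < rho -> (forall u : R, `|u| <= rho -> `|q u| < rho) ->
  (forall u v : R, `|u| <= rho -> `|v| <= rho -> (boundary Omega (frame x tau n u v) <-> v = q u)) ->
  Omega (frame x tau n 0 rho) -> Omega (frame x tau n 0 (- rho)) ->
  interior (closure Omega) x.
Proof.
move=> on rho0 qrho bO Op Om; have := frame_nbhs x on rho0; apply: filterS.
have rr : `|rho| <= rho by rewrite ger0_norm// ltW.
have zr : `|0 : R| <= rho by rewrite normr0 ltW.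
have bO' u v : `|u| <= rho -> `|v| <= rho -> boundary Omega (frame x tau n u v) -> v = q u.
  by move=> ur vr /bO; exact.
have q0 := qrho _ zr; move: (q0); rewrite ltr_norml => /andP[q1 q2].
move=> y [u [v [/ltW ur /ltW vr ->]]].
have [qv|vq|E] := ltgtP (q u) v.
- by apply: subset_closure; apply/(same_side rho0 qrho bO' zr rr ur vr q2 qv).
- apply: subset_closure; apply/(same_side_below rho0 qrho bO' zr _ ur vr q1 vq) => //.
  by rewrite normrN.
- by have /(bO u v ur vr)[] := esym E.
Qed.

(** Otherwise the closure of the domain would also be open, and a segment from a point of the domain
    to a point outside the closure would have to leave an open and closed set. *)
Lemma interior_closure_clopen Omega c L :
  interior_or_exterior_domain Omega -> smooth_closed_curve c L (boundary Omega) ->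
  ~ (forall s, interior (closure Omega) (c s)).
Proof.
move=> dO [_ _ _ [_ _ rB]] H.
have [y ny] := domain_closure_neqT dO; apply: ny.
have [[oO [z Oz] _] _] := dO.
have sub : closure Omega `<=` interior (closure Omega).
  move=> w cw; have [Ow|nOw] := pselect (Omega w).
    by apply: interiorS; [exact: subset_closure|move/interior_id : oO => ->].
  have : boundary Omega w by split => //; move=> /interior_subset.
  by rewrite -rB => -[s _ <-].
have cp : continuous (fun t : R => z + t *: (y - z)).
  by move=> t; apply: cvgD; [exact: cvg_cst|apply: cvgZl; exact: cvg_id].
have := @path_avoiding_boundary R _ (closure Omega) (fun t : R => z + t *: (y - z)) 0 1 ler01 cp.
rewrite scale0r addr0 scale1r (addrC z) subrK => h; apply/h; last exact: subset_closure.
move=> t _; have /closure_id <- := @closed_closure _ Omega.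
exact: sub.
Qed.

Lemma boundary_frame Omega c L :
  interior_or_exterior_domain Omega -> smooth_closed_curve c L (boundary Omega) ->
  exists2 C : R, 1 <= C & exists2 rho : R, 0 < rho <= 1 &
  forall s0 tau n, 0 <= s0 <= L -> orthonormal_pair tau n -> dotp (derive1 c s0) n = 0 ->
  exists k g q, [/\ `|k| <= C, `|g| <= C,
    forall u : R, `|u| <= rho -> `|q u - k / 2 * u ^+ 2 - g / 6 * u ^+ 3| <= C * u ^+ 4,
    forall u : R, `|u| <= rho -> `|q u| <= `|u| / 2 &
    forall u v : R, `|u| <= rho -> `|v| <= rho ->
      (boundary Omega (frame (c s0) tau n u v) <-> v = q u)].
Proof.
move=> dO sc; have [C C1 [rho /andP[rho0 rho1] H]] := curve_local_graph sc.
(* For [|u| <= 1] the expansion gives [|q u| <= 2 * C * |u| ^+ 2], which [|u| <= 1 / (4 * C)] makes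
   at most [|u| / 2]. *)
exists C => //; exists (Num.min rho (1 / (4 * C))).
  by rewrite lt_min rho0 divr_gt0 ?ge_min ?rho1//; lra.
move=> s0 tau n s0L on cn; have [k [g [q [kC gC qe bq]]]] := H s0 tau n s0L on cn.
have le_rho (u : R) : `|u| <= Num.min rho (1 / (4 * C)) -> `|u| <= rho.
  by rewrite le_min => /andP[].
exists k, g, q; split => //.
- by move=> u /le_rho; exact: qe.
- move=> u ur; have ur' := le_rho u ur.
  have u1 := le_trans ur' rho1.
  have {}qe := qe u ur'.
  have uC : C * `|u| <= 1 / 4.
    have : C * `|u| <= C * (1 / (4 * C)).
      by apply: ler_wpM2l; [lra|move: ur; rewrite le_min => /andP[]].
    by rewrite (_ : C * (1 / (4 * C)) = 1 / 4)//; field; rewrite gt_eqF//; lra.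
  have E : q u = (q u - k / 2 * u ^+ 2 - g / 6 * u ^+ 3) + (k / 2 * u ^+ 2 + g / 6 * u ^+ 3) by ring.
  have half : `|2^-1 : R| <= 2^-1 by rewrite ger0_norm.
  have sixth : `|6^-1 : R| <= 6^-1 by rewrite ger0_norm.
  have a0 := normr_ge0 u.
  have p j : `|u ^+ j.+1| <= `|u|.
    by rewrite normrX exprS ler_piMr// exprn_ile1.
  have q2 : `|u ^+ 2| <= `|u| ^+ 2 by rewrite normrX.
  have q3 : `|u ^+ 3| <= `|u| ^+ 2 by rewrite normrX exprS ler_piMl// exprn_ge0.
  have q4 : u ^+ 4 <= `|u| ^+ 2.
    by apply: (le_trans (ler_norm _)); rewrite normrX -[4%N]/(2 + 2)%N exprD ler_piMl ?exprn_ge0// exprn_ile1.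
  have C0 : 0 <= C by lra.
  have := ler_normD2 qe (ler_normD2 (ler_normM2 (ler_normM2 kC half) q2) (ler_normM2 (ler_normM2 gC sixth) q3)).
  rewrite -E.
  have := ler_wpM2l C0 q4; have := ler_wpM2r a0 uC; have : 0 <= C * `|u| ^+ 2 by rewrite mulr_ge0 ?exprn_ge0.
  rewrite expr2; clear; lra.
- by move=> u v /le_rho ur /le_rho vr; exact: bq.
Qed.

(** The parameters with [c t] interior to the closure form an open set; the point is that it is
    closed. If [c w] is not interior, one side of the curve there is free of the domain. A nearby
    curve point interior to the closure would yield, just off the graph on the free side, points of
    the closure outside the domain, that is, boundary points off the graph. *)
Lemma curve_interior_closure Omega c L s :
  interior_or_exterior_domain Omega -> smooth_closed_curve c L (boundary Omega) ->
  ~ interior (closure Omega) (c s).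
Proof.
move=> dO sc cs; apply: (interior_closure_clopen dO sc) => t.
have [C C1 [rho /andP[rho0 rho1] H]] := boundary_frame dO sc.
have [L0 dc nz [_ _ rB]] := sc.
have cc : continuous c by apply: derivable_continuous; exact: (dc 0%N).
pose A := interior (closure Omega).
have [[oO _ _] _] := dO.
suff key (w : R) : closure (c @^-1` A) w -> interior (c @^-1` A) w.
  have cid : continuous (@id R) by move=> ?; exact: cvg_id.
  have [st|/ltW ts] := leP s t.
    by apply/(path_avoiding_boundary st cid (A := c @^-1` A)) => // w _; exact: key.
  by apply/(path_avoiding_boundary ts cid (A := c @^-1` A)) => // w _; exact: key.
have oA : open (c @^-1` A) by apply: open_comp => //; exact: open_interior.
suff : closure (c @^-1` A) w -> A (c w) by move/interior_id : oA => -> h /h.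
apply: contraPP => nA.
have [s0 s0I [k wk]] := curve_reduce sc 0 w.
have cw : c w = c s0 by rewrite wk (curve_period sc) add0r.
have s0L : 0 <= s0 <= L by case/andP: s0I => -> /ltW.
have c'0 := dotp_gt0 (nz s0).
pose tau := (Num.sqrt (dotp (derive1 c s0) (derive1 c s0)))^-1 *: derive1 c s0.
pose n : R * R := (- tau.2, tau.1).
have on : orthonormal_pair tau n.
  have h : dotp tau tau = 1.
    set D := dotp (derive1 c s0) (derive1 c s0) in c'0.
    transitivity ((Num.sqrt D)^-1 ^+ 2 * D); first by rewrite /tau /D /dotp/= /GRing.scale/=; ring.
    by rewrite exprVn sqr_sqrtr ?ltW// mulVf// gt_eqF.
  split => //; last by rewrite /dotp/=; ring.
  by rewrite -[RHS]h /dotp/=; ring.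
have c'n : dotp (derive1 c s0) n = 0 by rewrite /dotp/= /GRing.scale/=; ring.
have rr : `|rho| <= rho by rewrite ger0_norm// ltW.
have [x0 x0E] : exists x0, x0 = c w by exists (c w).
rewrite -x0E in nA.
have qlt (q : R -> R) : (forall u : R, `|u| <= rho -> `|q u| <= `|u| / 2) ->
    forall u : R, `|u| <= rho -> `|q u| < rho.
  by move=> q2 u ur; have := q2 u ur; lra.
(* [m] is the normal, up to sign, that points to a side free of the domain; such a side exists, for
   otherwise [x0] would be interior to the closure. *)
have [m [on' [q [q2 bq nO]]]] : exists m, orthonormal_pair tau m /\ exists q : R -> R,
    [/\ forall u : R, `|u| <= rho -> `|q u| <= `|u| / 2,
    forall u v : R, `|u| <= rho -> `|v| <= rho -> (boundary Omega (frame x0 tau m u v) <-> v = q u) &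
    ~ Omega (frame x0 tau m 0 rho)].
  have [_ [_ [q [_ _ _ q2 bq]]]] := H s0 tau n s0L on c'n.
  rewrite -cw -x0E in bq.
  have [Op|nOp] := pselect (Omega (frame x0 tau n 0 rho)); last by exists n; split => //; exists q.
  have [Om|nOm] := pselect (Omega (frame x0 tau n 0 (- rho))); last first.
    exists (- n); split; first exact: orthonormal_pairN.
    exists (fun u => - q u); split.
    - by move=> u ur; rewrite normrN; exact: q2.
    - move=> u v ur vr; rewrite -[v]opprK frameN bq ?normrN//.
      by split => [->//|/eqP]; rewrite eqr_opp => /eqP.
    - by rewrite -[rho]opprK frameN.
  by exfalso; apply: nA; apply: (two_sides_interior_closure on rho0 (qlt _ q2) bq).
have qrho := qlt _ q2.
have zr : `|0 : R| <= rho by rewrite normr0 ltW.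
have qO (u v : R) : `|u| <= rho -> `|v| <= rho -> q u < v -> ~ Omega (frame x0 tau m u v).
  move=> ur vr qv Ow; apply: nO.
  apply/(same_side (A := Omega) rho0 qrho _ zr rr ur vr _ qv) => //.
    by move=> a b ar br /bq; exact.
  by have := qrho _ zr; rewrite ltr_norml => /andP[].
move=> cl; have := frame_nbhs x0 on' rho0; rewrite {1}x0E => /cc/cl[t' [/= At']].
move=> [u [v [ur vr E]]].
have bv : v = q u.
  by apply/bq; rewrite ?ltW// -E -rB; exists t'.
have qu := qrho u (ltW ur).
have oAx : open A by exact: open_interior.
have cu : continuous (fun e : R => frame x0 tau m u (q u + e)).
  move=> e; apply: cvgD; first exact: cvg_cst.
  by apply: cvgZl; apply: cvgD; [exact: cvg_cst|exact: cvg_id].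
have A0 : A (frame x0 tau m u (q u + 0)) by rewrite addr0 -bv -E.
have nA0 : \forall e \near (0 : R), A (frame x0 tau m u (q u + e)).
  exact: (cu 0 _ (open_nbhs_nbhs (conj oAx A0))).
have gap : 0 < rho - `|q u| by rewrite subr_gt0.
have [e [e0 e1 Ae]] : exists e : R, [/\ 0 < e, e < rho - `|q u| & A (frame x0 tau m u (q u + e))].
  have nr : \forall e \near 0^'+, A (frame x0 tau m u (q u + e)) by apply: filterS nA0 => e' h' _.
  apply: (@filter_ex _ (at_right (0 : R))); near=> e; split; near: e => //.
  - exact: nbhs_right_gt.
  - exact: nbhs_right_lt.
have ve : `|q u + e| <= rho.
  by have := ler_normD (q u) e; rewrite (gtr0_norm e0); lra.
have qe : q u < q u + e by rewrite ltrDl.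
have Oc := interior_subset Ae.
have /bq : boundary Omega (frame x0 tau m u (q u + e)).
  split => //; move=> /interior_subset; exact: qO (ltW ur) ve qe.
move=> /(_ (ltW ur) ve) /eqP; rewrite -subr_eq0 addrC addKr.
by rewrite gt_eqF.
Unshelve. all: by end_near. Qed.

(** One point on the inward normal puts the whole upper part of the box into the domain. A domain
    point below the graph would then place the domain on both sides, and points on the graph are
    excluded because the domain is open. *)
Lemma domain_frame Omega c L :
  interior_or_exterior_domain Omega -> smooth_closed_curve c L (boundary Omega) ->
  exists2 C : R, 1 <= C & exists2 rho : R, 0 < rho <= 1 &
  forall s0 tau n, 0 <= s0 <= L -> orthonormal_pair tau n -> dotp (derive1 c s0) n = 0 ->
  (\forall e \near 0^'+, Omega (c s0 + e *: n)) ->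
  exists k g q, [/\ `|k| <= C, `|g| <= C,
    forall u : R, `|u| <= rho -> `|q u - k / 2 * u ^+ 2 - g / 6 * u ^+ 3| <= C * u ^+ 4,
    forall u : R, `|u| <= rho -> `|q u| <= `|u| / 2 &
    forall u v : R, `|u| <= rho -> `|v| <= rho ->
      (boundary Omega (frame (c s0) tau n u v) <-> v = q u) /\
      (Omega (frame (c s0) tau n u v) <-> q u < v)].
Proof.
move=> dO sc; have [C C1 [rho /andP[rho0 rho1] H]] := boundary_frame dO sc.
exists C => //; exists rho; first by rewrite rho0.
move=> s0 tau n s0L on cn nO.
have [k [g [q [kC gC qe q2 bq]]]] := H s0 tau n s0L on cn.
exists k, g, q; split => //.
have [[oO _ _] _] := dO.
have rr : `|rho| <= rho by rewrite ger0_norm// ltW.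
have rrN : `|- rho| <= rho by rewrite normrN.
have zr : `|0 : R| <= rho by rewrite normr0 ltW.
have qrho u : `|u| <= rho -> `|q u| < rho by move=> ur; have := q2 u ur; lra.
have q0 : q 0 = 0 by have := q2 0 zr; rewrite normr0 mul0r normr_le0 => /eqP.
have q0r : q 0 < rho by rewrite q0.
have q0rN : - rho < q 0 by rewrite q0 oppr_lt0.
have bq' u v : `|u| <= rho -> `|v| <= rho -> boundary Omega (frame (c s0) tau n u v) -> v = q u.
  by move=> ur vr /bq; exact.
have [e [e0 er Oe]] : exists e : R, [/\ 0 < e, e < rho & Omega (c s0 + e *: n)].
  apply: (@filter_ex _ (at_right (0 : R))); near=> e; split; near: e => //.
  - exact: nbhs_right_gt.
  - exact: nbhs_right_lt.
have Op : Omega (frame (c s0) tau n 0 rho).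
  apply/(same_side (A := Omega) rho0 qrho bq' zr rr zr (v' := e)) => //.
  - by rewrite ger0_norm ltW.
  - by rewrite q0.
  - by rewrite /frame scale0r addr0.
move=> u v ur vr; split; first exact: bq.
split; last by move=> qv; apply/(same_side (A := Omega) rho0 qrho bq' ur vr zr rr qv q0r).
move=> Ouv; rewrite ltNge; apply/negP; rewrite le_eqVlt => /orP[/eqP /(bq u v ur vr)|vq].
  by move/interior_id : oO => oO -[_]; rewrite oO.
have Om : Omega (frame (c s0) tau n 0 (- rho)).
  by apply/(same_side_below (A := Omega) rho0 qrho bq' zr rrN ur vr q0rN vq).
apply: (curve_interior_closure (s := s0) dO sc).
exact: two_sides_interior_closure on rho0 qrho bq Op Om.
Unshelve. all: by end_near. Qed.

End OneSidedness.

(** * The frame and the curvature at a target point *)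

Section TargetFrame.
Context {R : realType}.
Implicit Types (c : R -> R * R) (L s t r : R) (A B Omega : set (R * R)) (tau n x y : R * R).

(** This identifies the curvature, defined through some graph function, with the coefficient
    obtained from the parametrization: the two graphs are compared by their values alone, and a
    quadratic expansion with cubic error determines the second derivative. *)
Lemma second_derivative_eq (g : R -> R) (k C : R) :
  (\forall u \near (0 : R), derivable g u 1) -> derivable (derive1 g) 0 1 ->
  derive1 g 0 = 0 ->
  (\forall u \near (0 : R), `|g u - g 0 - k / 2 * u ^+ 2| <= C * `|u| ^+ 3) ->
  derive1n 2 g 0 = k.
Proof.
move=> dg ddg g'0 gk; set e := derive1n 2 g 0.
apply: contrapT => ek.
(* The two expansions force [|e - k| <= 4 * eps], which is half of [|e - k|]. *)
pose eps : R := `|e - k| / 8.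
have eps0 : 0 < eps by rewrite divr_gt0// normr_gt0 subr_eq0; apply/eqP.
have near1 : \forall u \near (0 : R), `|derive1 g u - e * u| <= eps * `|u|.
  have H : h^-1 *: ((derive1 g \o shift 0) (h *: 1) - derive1 g 0) @[h --> 0^'] --> e.
    have -> : e = 'D_1 (derive1 g) 0 by rewrite /e -derive1E.
    have := ddg; rewrite /derivable /derive => dd.
    exact: dd.
  have {H} := cvgr_dist_le _ _ H _ eps0; rewrite g'0 /=.
  move=> /(_ _); rewrite near_withinE => /nbhs_ballP[d /= d0 Hd].
  apply: filterS (nbhsx_ballx (0 : R) d d0) => u ud; have [->|u0] := eqVneq u 0.
    by rewrite g'0 !mulr0 normr0 subrr mulr0 normr0.
  have := Hd u ud u0; rewrite /GRing.scale/= mulr1 addr0 subr0 => h.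
  rewrite (_ : derive1 g u - e * u = - (e - u^-1 * derive1 g u) * u); last by field.
  by rewrite normrM normrN ler_wpM2r.
have : \forall u \near (0 : R), [/\ derivable g u 1, `|derive1 g u - e * u| <= eps * `|u| &
    `|g u - g 0 - k / 2 * u ^+ 2| <= C * `|u| ^+ 3].
  by apply: filterS3 dg near1 gk => u; split.
move=> /nbhs_ballP[rho /= rho0 H].
pose u : R := Num.min (rho / 2) (eps / (`|C| + 1)).
have C1 : 0 < `|C| + 1 by rewrite ltr_wpDl.
have u0 : 0 < u by rewrite /u lt_min; apply/andP; split; apply: divr_gt0.
have ur : u < rho.
  by rewrite /u gt_min; apply/orP; left; lra.
have uC : C * u <= eps.
  apply: (@le_trans _ _ ((`|C| + 1) * u)).
    by apply: ler_wpM2r; [exact: ltW|apply: (le_trans (ler_norm C)); rewrite lerDl].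
  by rewrite mulrC -ler_pdivlMr// /u ge_min lexx orbT.
have Hs (s : R) : 0 <= s <= u -> [/\ derivable g s 1, `|derive1 g s - e * s| <= eps * `|s| &
    `|g s - g 0 - k / 2 * s ^+ 2| <= C * `|s| ^+ 3].
  move=> /andP[s0 su]; apply: H; rewrite /ball/= sub0r normrN ger0_norm//.
  exact: le_lt_trans su ur.
have mm (s : R) : Num.min 0 u <= s <= Num.max 0 u -> 0 <= s <= u.
  by rewrite (min_idPl (ltW u0)) (max_idPr (ltW u0)).
have := @mean_value_bound R (fun s => g s - e / 2 * s ^+ 2) (fun s => derive1 g s - e * s) 0 u (eps * u).
move=> /(_ _ _) M; have {}M : `|(g u - e / 2 * u ^+ 2) - (g 0 - e / 2 * 0 ^+ 2)| <= eps * u * `|u - 0|.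
  apply: M => s /mm sI; have [dgs d1 _] := Hs s sI.
    have D : is_derive s (1 : R) g (derive1 g s) by apply: DeriveDef => //; rewrite derive1E.
    by apply: is_derive_eq; rewrite /GRing.scale/=; field.
  apply: (le_trans d1); rewrite ler_wpM2l ?(ltW eps0)//.
  by case/andP: sI => s0 su; rewrite ger0_norm.
have uu : 0 <= u <= u by rewrite ltW//=.
have [_ _ N] := Hs u uu.
rewrite subr0 (gtr0_norm u0) in M; rewrite (gtr0_norm u0) in N.
have u20 : 0 < u ^+ 2 by rewrite exprn_gt0.
have K : `|e - k| * u ^+ 2 <= 4 * eps * u ^+ 2.
  have -> : `|e - k| * u ^+ 2 = `|(e - k) * u ^+ 2| by rewrite normrM (ger0_norm (ltW u20)).
  have -> : (e - k) * u ^+ 2 = 2 * ((g u - g 0 - k / 2 * u ^+ 2) - ((g u - e / 2 * u ^+ 2) - (g 0 - e / 2 * 0 ^+ 2))).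
    by field.
  rewrite normrM ger0_norm//.
  have := le_trans (ler_normB _ _) (lerD N M).
  have : C * u ^+ 3 <= eps * u ^+ 2.
    by rewrite exprS mulrA ler_wpM2r// ltW.
  by rewrite expr2; lra.
rewrite ler_pM2r// in K.
have : eps * 8 = `|e - k| by rewrite /eps; field.
by move: eps0 K; clear; lra.
Qed.

Lemma enorm1_dotp tau : enorm tau = 1 -> dotp tau tau = 1.
Proof.
move=> h; have := @sqr_sqrtr R (dotp tau tau); rewrite -/(enorm tau) h expr1n => -> //.
by rewrite /dotp addr_ge0// -expr2 sqr_ge0.
Qed.

(** The squared distance to [x] along the curve is differentiable and has a minimum at [s0]. *)
Lemma closest_point_orthogonal Omega c L s0 x :
  smooth_closed_curve c L (boundary Omega) ->
  closest_point (boundary Omega) x (c s0) -> dotp (derive1 c s0) (x - c s0) = 0.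
Proof.
move=> [L0 dc _ [_ _ rB]] [_ cl].
pose phi s := dotp (c s - x) (c s - x).
have dphi s : is_derive s (1 : R) phi (2 * dotp (derive1 c s) (c s - x)).
  have D1 := is_derive_dotp (1, 0) (dc 0%N s).
  have D2 := is_derive_dotp (0, 1) (dc 0%N s).
  have -> : phi = (fun s => (dotp (derive1n 0 c s) (1, 0) - x.1) ^+ 2 + (dotp (derive1n 0 c s) (0, 1) - x.2) ^+ 2).
    by apply/funext => u; rewrite /phi /dotp/=; ring.
  by apply: is_derive_eq; rewrite /GRing.scale/= /dotp/=; ring.
have s0I : s0 \in `]s0 - 1, s0 + 1[%R by rewrite in_itv/= ltrDl ltr01 andbT gtrBl ltr01.
have D0 : is_derive s0 (1 : R) phi 0.
  apply: (derive1_at_min _ _ s0I) => [|s _|s _]; first by lra.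
    by have [] := dphi s.
  have : boundary Omega (c s) by rewrite -rB; exists s.
  move=> /cl; rewrite /enorm ler_sqrt; last by rewrite addr_ge0// -expr2 sqr_ge0.
  have E z y : dotp (z - y) (z - y) = dotp (y - z) (y - z) by rewrite /dotp/=; ring.
  by rewrite E (E x).
have [_ E0] := D0; have [_ E1] := dphi s0.
move: E1; rewrite E0 => /eqP; rewrite eq_sym mulf_eq0 pnatr_eq0/= => /eqP h.
by rewrite -opprB; rewrite -[RHS]oppr0 -h /dotp/=; ring.
Qed.

(** The tangent, the normal and the curvature are given through possibly different parametrizations
    and graphs; here all are tied to the fixed curve [c], so that the uniform constants apply to
    them. *)
Lemma target_frame Omega c L (C rho : R) x x0 tau n (kappa : R) s0 :
  open Omega ->
  smooth_closed_curve c L (boundary Omega) -> 0 < rho ->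
  (forall tau' n', orthonormal_pair tau' n' -> dotp (derive1 c s0) n' = 0 ->
    (\forall e \near 0^'+, Omega (c s0 + e *: n')) ->
    exists k g q, [/\ `|k| <= C, `|g| <= C,
      forall u : R, `|u| <= rho -> `|q u - k / 2 * u ^+ 2 - g / 6 * u ^+ 3| <= C * u ^+ 4,
      forall u : R, `|u| <= rho -> `|q u| <= `|u| / 2 &
      forall u v : R, `|u| <= rho -> `|v| <= rho ->
        (boundary Omega (frame (c s0) tau' n' u v) <-> v = q u) /\
        (Omega (frame (c s0) tau' n' u v) <-> q u < v)]) ->
  x0 = c s0 -> Omega x -> closest_point (boundary Omega) x x0 ->
  unit_tangent Omega x0 tau -> inward_unit_normal Omega x0 n ->
  boundary_curvature Omega x x0 tau n kappa ->
  let r := enorm (x - x0) in r < rho ->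
  [/\ orthonormal_pair tau n, 0 < r, x = frame x0 tau n 0 r &
  exists g q, [/\ `|kappa| <= C, `|g| <= C,
      forall u : R, `|u| <= rho -> `|q u - kappa / 2 * u ^+ 2 - g / 6 * u ^+ 3| <= C * u ^+ 4,
      forall u : R, `|u| <= rho -> `|q u| <= `|u| / 2 &
      forall u v : R, `|u| <= rho -> `|v| <= rho ->
        (Omega (frame x0 tau n u v) <-> q u < v)]].
Proof.
move=> oO sc rho0 H x0E Ox cp ut [n1 nt nO] bc r rrho.
have on : orthonormal_pair tau n.
  split; [|exact: enorm1_dotp|].
    by case: ut => /enorm1_dotp.
  by rewrite -(nt tau ut) /dotp/=; ring.
have [L0 dc nz [_ _ rB]] := sc.
have c'0 := dotp_gt0 (nz s0).
set D := dotp _ _ in c'0.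
have sD0 : 0 < Num.sqrt D by rewrite sqrtr_gt0.
(* The normalized velocity of [c] is itself a unit tangent, and the inward normal is orthogonal to
   all unit tangents. *)
have ut' : unit_tangent Omega x0 ((Num.sqrt D)^-1 *: derive1 c s0).
  split; last by exists c, L, s0; split => //; exists (Num.sqrt D); rewrite scalerA divff ?scale1r// gt_eqF.
  rewrite /enorm (_ : dotp _ _ = (Num.sqrt D)^-1 ^+ 2 * D); last by rewrite /D /dotp/= /GRing.scale/=; ring.
  by rewrite exprVn sqr_sqrtr ?(ltW c'0)// mulVf ?sqrtr1// gt_eqF.
have c'n : dotp (derive1 c s0) n = 0.
  have := nt _ ut'; rewrite (_ : dotp n _ = (Num.sqrt D)^-1 * dotp (derive1 c s0) n); last first.
    by rewrite /dotp/= /GRing.scale/=; ring.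
  by move/eqP; rewrite mulf_eq0 invr_eq0 gt_eqF//= => /eqP.
rewrite x0E in nO.
have [k [g [q [kC gC qe q2 bO]]]] := H tau n on c'n nO.
rewrite -x0E in bO.
have zr : `|0 : R| <= rho by rewrite normr0 ltW.
have q0 : q 0 = 0 by have := q2 0 zr; rewrite normr0 mul0r normr_le0 => /eqP.
pose beta := dotp (x - x0) n.
have c't : derive1 c s0 = dotp (derive1 c s0) tau *: tau.
  by rewrite {1}[derive1 c s0](orthonormal_expand _ on) c'n scale0r addr0.
have c't0 : dotp (derive1 c s0) tau != 0.
  by apply/eqP => h; move: (nz s0); rewrite c't h scale0r eqxx.
have xt : dotp (x - x0) tau = 0.
  have h := closest_point_orthogonal sc (eq_ind _ (closest_point (boundary Omega) x) cp _ x0E).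
  move: h; rewrite -x0E c't (_ : dotp _ _ = dotp (derive1 c s0) tau * dotp (x - x0) tau); last first.
    by rewrite /dotp/= /GRing.scale/=; ring.
  by move/eqP; rewrite mulf_eq0 (negbTE c't0)/= => /eqP.
have xE : x = frame x0 tau n 0 beta by rewrite {1}(frame_onto x0 x on) xt.
have rE : r = `|beta|.
  rewrite /r /enorm -sqrtr_sqr; congr Num.sqrt.
  rewrite [X in dotp X _](orthonormal_expand _ on) [X in dotp _ X](orthonormal_expand _ on) xt scale0r add0r -/beta.
  by case: on => _ h _; transitivity (beta ^+ 2 * dotp n n); [rewrite /dotp/= /GRing.scale/=; ring|rewrite h mulr1].
have br : `|beta| <= rho by rewrite -rE ltW.
have beta0 : 0 < beta.
  by move: Ox; rewrite xE (bO _ _ zr br).2 q0.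
have {}rE : r = beta by rewrite rE gtr0_norm.
rewrite -rE in beta0 xE.
suff kE : kappa = k.
  by split => //; exists g, q; rewrite kE; split => // u v ur vr; exact: (bO u v ur vr).2.
have [gm [dg g0 g'0 bg ->]] := bc; rewrite -/r in g0 bg.
(* Near 0 both functions describe the same boundary, one seen from [x] and the other from [x0], so
   they differ by [r]. *)
have gq : \forall u \near (0 : R), `|u| <= rho /\ gm u = q u - r.
  move: bg => /nbhs_ballP[e /= e0 He].
  have m0 : 0 < Num.min e rho by rewrite lt_min e0.
  apply: filterS (nbhsx_ballx (0 : R) _ m0) => u.
  rewrite /ball/= sub0r normrN lt_min => /andP[ue /ltW ur]; split => //.
  have qu := q2 u ur; have u0 := normr_ge0 u.
  have /He : ball ((0, - r) : R * R) e (u, q u - r).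
    split; rewrite /ball/= ?sub0r ?normrN//.
    by rewrite (_ : - r - (q u - r) = - q u); [rewrite normrN; lra|ring].
  rewrite /= (_ : x + _ + _ = frame x0 tau n u (q u)); last first.
    rewrite [in LHS]xE /frame; apply/pair_equal_spec; split => /=; rewrite /GRing.scale/=; ring.
  have qr : `|q u| <= rho by lra.
  have bu : boundary Omega (frame x0 tau n u (q u)) by apply/((bO u (q u) ur qr).1).
  by move=> [/(_ bu)].
apply: (@second_derivative_eq gm k (2 * C)) => //.
- by apply: filterS dg => u /(_ 0%N).
- by have /(_ 1%N) := nbhs_singleton dg.
apply: filterS2 gq (nbhsx_ballx (0 : R) (1 : R) ltr01) => u [ur gu].
rewrite /ball/= sub0r normrN => u1.
have C0 : 0 <= C by exact: le_trans (normr_ge0 k) kC.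
have u3 : 0 <= `|u| ^+ 3 by exact: exprn_ge0.
rewrite gu g0 (_ : q u - r - - r - k / 2 * u ^+ 2 =
  (q u - k / 2 * u ^+ 2 - g / 6 * u ^+ 3) + g / 6 * u ^+ 3); last by ring.
apply: (le_trans (ler_normD _ _)); have := qe u ur.
have : C * u ^+ 4 <= C * `|u| ^+ 3.
  apply: ler_wpM2l => //; apply: (le_trans (ler_norm _)).
  by rewrite normrX exprS ler_piMl// ltW.
have : `|g / 6 * u ^+ 3| <= C * `|u| ^+ 3.
  rewrite normrM normrX ler_wpM2r// normrM [`|6^-1|]ger0_norm//; have := normr_ge0 g; move: gC; clear; lra.
by clear; lra.
Qed.

End TargetFrame.

(** * Taylor expansion inside the domain *)

Section StaircaseTaylor.
Context {R : realType}.

Lemma taylor1_bound (h h1 h2 : R -> R) (a b M : R) : 0 <= M ->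
  (forall s, Num.min a b <= s <= Num.max a b ->
    is_derive s (1 : R) h (h1 s) /\ is_derive s (1 : R) h1 (h2 s)) ->
  (forall s, Num.min a b <= s <= Num.max a b -> `|h2 s| <= M) ->
  `|h b - (h a + h1 a * (b - a))| <= M * `|b - a| ^+ 2.
Proof.
move=> M0 dh hM.
pose W (j : nat) : R -> R := match j with
  | 0 => fun s => h s - (h a + h1 a * (s - a))
  | 1 => fun s => h1 s - h1 a
  | _ => h2
  end.
apply: (@vanishing_order R 2 W) => //.
  move=> k s k2 sab; have [D1 D2] := dh s sab.
  by case: k k2 => [|[|//]] _; rewrite /W; apply: is_derive_eq; rewrite /GRing.scale/=; field.
by case=> [|[|//]] _; rewrite /W; field.
Qed.

Lemma taylor2_bound (h h1 h2 h3 : R -> R) (a b M : R) : 0 <= M ->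
  (forall s, Num.min a b <= s <= Num.max a b ->
    [/\ is_derive s (1 : R) h (h1 s), is_derive s (1 : R) h1 (h2 s) &
        is_derive s (1 : R) h2 (h3 s)]) ->
  (forall s, Num.min a b <= s <= Num.max a b -> `|h3 s| <= M) ->
  `|h b - (h a + h1 a * (b - a) + h2 a / 2 * (b - a) ^+ 2)| <= M * `|b - a| ^+ 3.
Proof.
move=> M0 dh hM.
pose W (j : nat) : R -> R := match j with
  | 0 => fun s => h s - (h a + h1 a * (s - a) + h2 a / 2 * (s - a) ^+ 2)
  | 1 => fun s => h1 s - (h1 a + h2 a * (s - a))
  | 2 => fun s => h2 s - h2 a
  | _ => h3
  end.
apply: (@vanishing_order R 3 W) => //.
  move=> k s k3 sab; have [D1 D2 D3] := dh s sab.
  by case: k k3 => [|[|[|//]]] _; rewrite /W; apply: is_derive_eq; rewrite /GRing.scale/=; field.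
by case=> [|[|[|//]]] _; rewrite /W; field.
Qed.

(* In G w, the word w lists the partial derivatives to be taken, the last letter first:
   true for the first variable and false for the second one. *)
Lemma staircase_taylor (G : seq bool -> R -> R -> R) (D : R -> R -> Prop) (M u v A : R) :
  0 <= M -> `|u| <= A -> `|v| <= A ->
  (forall w x y, (size w <= 2)%N -> D x y ->
     is_derive x (1 : R) (G w ^~ y) (G (true :: w) x y) /\
     is_derive y (1 : R) (G w x) (G (false :: w) x y)) ->
  (forall w x y, (size w <= 3)%N -> D x y -> `|G w x y| <= M) ->
  (forall y, 0 <= y <= A -> D 0 y) ->
  (forall x, `|x| <= `|u| -> D x A) ->
  (forall y, v <= y <= A -> D u y) ->
  `|G [::] u v - (G [::] 0 0 + G [:: true] 0 0 * u + G [:: false] 0 0 * v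
     + G [:: true; true] 0 0 / 2 * u ^+ 2 + G [:: false; false] 0 0 / 2 * v ^+ 2
     + G [:: false; true] 0 0 * (A * u) + G [:: true; false] 0 0 * (u * (v - A)))|
  <= 22 * M * A ^+ 3.
Proof.
move=> M0 uA vA dG GM D1 D2 D3.
have A0 : 0 <= A := le_trans (normr_ge0 u) uA.
have vleA : v <= A := le_trans (ler_norm v) vA.
have I1 s : Num.min 0 A <= s <= Num.max 0 A -> D 0 s.
  by rewrite (min_idPl A0) (max_idPr A0); exact: D1.
have I2 s : Num.min 0 u <= s <= Num.max 0 u -> D s A.
  by move=> /norm_between; exact: D2.
have I3 s : Num.min A v <= s <= Num.max A v -> D u s.
  by rewrite (min_idPr vleA) (max_idPl vleA); exact: D3.
have D00 : D 0 0 by apply: D1; rewrite lexx.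
have dx w x y (w2 : (size w <= 2)%N) (Dxy : D x y) :
    is_derive x (1 : R) (G w ^~ y) (G (true :: w) x y) := (dG w x y w2 Dxy).1.
have dy w x y (w2 : (size w <= 2)%N) (Dxy : D x y) :
    is_derive y (1 : R) (G w x) (G (false :: w) x y) := (dG w x y w2 Dxy).2.
(* The legs go from the origin up to [(0, A)], across to [(u, A)], and down to [(u, v)]. A
   derivative of order [j] is transported along a leg with error of order [3 - j]: [a1], [first] and
   [zeroth] are for the first leg, [b1], [c2], [d2] for the second, [e1] for the third. *)
have a1 : `|G [::] 0 A - (G [::] 0 0 + G [:: false] 0 0 * (A - 0)
    + G [:: false; false] 0 0 / 2 * (A - 0) ^+ 2)| <= M * `|A - 0| ^+ 3.
  apply: (taylor2_bound (h3 := G [:: false; false; false] 0)) => // s /I1 Ds; last exact: GM.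
  by split; exact: dy.
have first w : (size w <= 1)%N -> `|G w 0 A - (G w 0 0 + G (false :: w) 0 0 * (A - 0))| <= M * `|A - 0| ^+ 2.
  move=> w1; apply: (taylor1_bound (h2 := G [:: false, false & w] 0)) => // s /I1 Ds; last exact: GM.
  by split; apply: dy => //; exact: leqW.
have zeroth w : (size w <= 2)%N -> `|G w 0 A - G w 0 0| <= M * `|A - 0|.
  move=> w2; apply: (@mean_value_bound R (G w 0) (G (false :: w) 0)) => s /I1 Ds; last exact: GM.
  exact: dy.
have b1 : `|G [::] u A - (G [::] 0 A + G [:: true] 0 A * (u - 0)
    + G [:: true; true] 0 A / 2 * (u - 0) ^+ 2)| <= M * `|u - 0| ^+ 3.
  apply: (taylor2_bound (h := G [::] ^~ A) (h1 := G [:: true] ^~ A) (h2 := G [:: true; true] ^~ A)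
    (h3 := G [:: true; true; true] ^~ A)) => // s /I2 Ds; last exact: GM.
  by split; exact: dx.
have c2 : `|G [:: false] u A - (G [:: false] 0 A + G [:: true; false] 0 A * (u - 0))| <= M * `|u - 0| ^+ 2.
  apply: (taylor1_bound (h := G [:: false] ^~ A) (h1 := G [:: true; false] ^~ A)
    (h2 := G [:: true; true; false] ^~ A)) => // s /I2 Ds; last exact: GM.
  by split; exact: dx.
have d2 : `|G [:: false; false] u A - G [:: false; false] 0 A| <= M * `|u - 0|.
  apply: (@mean_value_bound R (G [:: false; false] ^~ A) (G [:: true; false; false] ^~ A)) => s /I2 Ds;
    last exact: GM.
  exact: dx.
have e1 : `|G [::] u v - (G [::] u A + G [:: false] u A * (v - A)
    + G [:: false; false] u A / 2 * (v - A) ^+ 2)| <= M * `|v - A| ^+ 3.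
  apply: (taylor2_bound (h3 := G [:: false; false; false] u)) => // s /I3 Ds; last exact: GM.
  by split; exact: dy.
have a2 := first [:: true] isT; have c1 := first [:: false] isT.
have a3 := zeroth [:: true; true] isT; have c3 := zeroth [:: true; false] isT.
have d1 := zeroth [:: false; false] isT.
rewrite !subr0 !(ger0_norm A0) in a1 a2 a3 b1 c1 c2 c3 d1 d2.
have pow (k : nat) : M * `|u| ^+ k <= M * A ^+ k.
  by apply: ler_wpM2l => //; apply: lerXn2r; rewrite ?nnegrE.
have {}b1 := le_trans b1 (pow 3%N); have {}c2 := le_trans c2 (pow 2%N).
have {}d2 := le_trans d2 (pow 1%N).
have vA2 : `|v - A| <= 2 * A.
  by apply: (le_trans (ler_normB _ _)); rewrite (ger0_norm A0); move: vA; clear; lra.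
have {}e1 : `|G [::] u v - (G [::] u A + G [:: false] u A * (v - A)
    + G [:: false; false] u A / 2 * (v - A) ^+ 2)| <= M * (2 * A) ^+ 3.
  apply: (le_trans e1); apply: ler_wpM2l => //; apply: lerXn2r; rewrite ?nnegrE// mulr_ge0//.
have sq (x X : R) : `|x| <= X -> `|x ^+ 2| <= X ^+ 2.
  by move=> xX; rewrite normrX; apply: lerXn2r; rewrite ?nnegrE// (le_trans _ xX).
have half : `|2^-1 : R| <= 2^-1 by rewrite ger0_norm.
have T1 := ler_normD2 (ler_normD2 e1 b1) a1.
have T2 := ler_normM2 a2 uA.
have T3 := ler_normM2 (ler_normM2 a3 half) (sq _ _ uA).
have T4 := ler_normM2 (ler_normD2 (ler_normD2 c2 c1) (ler_normM2 c3 uA)) vA2.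
have T5 := ler_normM2 (ler_normM2 (ler_normD2 d2 d1) half) (sq _ _ vA2).
(* In units of [M * A ^+ 3] the five parts contribute [10 + 1 + 1/2 + 6 + 4], hence the constant
   22. *)
have := ler_normD2 (ler_normD2 (ler_normD2 (ler_normD2 T1 T2) T3) T4) T5.
move=> H; apply: (le_trans _ (le_trans H _)).
  by rewrite le_eqVlt; apply/orP; left; apply/eqP; congr `|_|; field.
have : 0 <= M * A ^+ 3 by rewrite mulr_ge0// exprn_ge0.
by rewrite !exprSr expr0; clear; lra.
Qed.

End StaircaseTaylor.

(** * Directional derivatives of smooth functions *)

Section SmoothFunctions.
Context {R : realType}.
Implicit Types (Omega : set (R * R)) (f g : R * R -> R) (x y v tau n : R * R) (vs : seq (R * R)).

Lemma iter_derive_rcons vs v f : iter_derive (rcons vs v) f = iter_derive vs ('D_v f).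
Proof. by elim: vs => //= u vs ->. Qed.

Lemma smooth_derive Omega f v : smooth_bounded_on_closure Omega f ->
  smooth_bounded_on_closure Omega ('D_v f).
Proof. by move=> sf vs; rewrite -iter_derive_rcons; exact: sf. Qed.

(** Directional derivability alone does not give continuity; it is inherited from the continuous
    extension to the closure. *)
Lemma smooth_continuous Omega f vs x : open Omega -> smooth_bounded_on_closure Omega f ->
  Omega x -> {for x, continuous (iter_derive vs f)}.
Proof.
move=> oO sf Ox; have [_ [h ch hf] _] := sf vs.
have := continuous_subspaceW (@subset_closure _ Omega) ch.
rewrite continuous_open_subspace// => /(_ x); rewrite inE => /(_ Ox).
rewrite /continuous_at hf//; apply: cvg_trans; apply: near_eq_cvg.
by apply: filterS (open_nbhs_nbhs (conj oO Ox)) => y Oy; rewrite hf.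
Qed.

Lemma is_derive_line g x v (s : R) : derivable g (x + s *: v) v ->
  is_derive s (1 : R) (fun t => g (x + t *: v)) ('D_v g (x + s *: v)).
Proof.
move=> dg.
have E : (fun h : R => h^-1 *: (((fun t => g (x + t *: v)) \o shift s) (h *: 1) - g (x + s *: v))) =
         (fun h : R => h^-1 *: ((g \o shift (x + s *: v)) (h *: v) - g (x + s *: v))).
  apply/funext => h; congr (_ *: (g _ - _)).
  by rewrite /= /GRing.scale/= mulr1 -/(GRing.scale _ _) addrCA scalerDl.
by apply: DeriveDef; rewrite /derivable /derive E.
Qed.

Lemma line_increment g x v (t l K : R) :
  (forall s, `|s| <= `|t| -> derivable g (x + s *: v) v /\ `|l - 'D_v g (x + s *: v)| <= K) ->
  `|g (x + t *: v) - g x - l * t| <= K * `|t|.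
Proof.
move=> H.
have ts s : Num.min 0 t <= s <= Num.max 0 t -> `|s| <= `|t|.
  by move=> /norm_between.
have := @mean_value_bound R (fun s => g (x + s *: v) - l * s)
    (fun s => 'D_v g (x + s *: v) - l) 0 t K.
rewrite mulr0 !subr0 scale0r addr0 => M.
rewrite addrAC; apply: M => s /ts /H [dg dK]; last by rewrite distrC.
have D := is_derive_line dg.
by apply: is_derive_eq; rewrite /GRing.scale/= mulr1.
Qed.

Notation e1 := ((1, 0) : R * R).
Notation e2 := ((0, 1) : R * R).

(** The increment along [v] is split into one along each axis; the mean value inequality and the
    continuity of the partial derivatives control both. *)
Lemma derive_coordinates Omega g x v : open Omega -> Omega x ->
  (forall y w, Omega y -> derivable g y w) ->
  {for x, continuous ('D_e1 g)} -> {for x, continuous ('D_e2 g)} ->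
  `|v.1| <= 1 -> `|v.2| <= 1 ->
  'D_v g x = v.1 * 'D_e1 g x + v.2 * 'D_e2 g x.
Proof.
move=> oO Ox dg c1 c2 v1 v2.
set l := RHS.
suff H : h^-1 *: ((g \o shift x) (h *: v) - g x) @[h --> 0^'] --> l by exact: cvg_lim H.
apply/cvgrPdist_le => e e0.
have e20 : 0 < e / 2 by rewrite divr_gt0.
have /nbhs_ballP[d /= d0 Hd] : \forall y \near x,
    [/\ Omega y, `|'D_e1 g x - 'D_e1 g y| <= e / 2 & `|'D_e2 g x - 'D_e2 g y| <= e / 2].
  have n1 : \forall y \near x, `|'D_e1 g x - 'D_e1 g y| <= e / 2.
    by move/cvgr_dist_le : c1 => /(_ _ e20).
  have n2 : \forall y \near x, `|'D_e2 g x - 'D_e2 g y| <= e / 2.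
    by move/cvgr_dist_le : c2 => /(_ _ e20).
  by apply: filterS3 (open_nbhs_nbhs (conj oO Ox)) n1 n2 => y; split.
rewrite near_withinE; apply: filterS (nbhsx_ballx (0 : R) d d0) => h.
rewrite /ball/= sub0r normrN => hd h0.
have in_ball (a b : R) : `|a| <= `|h| -> `|b| <= `|h| -> ball x d (x.1 + a, x.2 + b).
  move=> ah bh; split; rewrite /ball/= opprD addNKr normrN; exact: le_lt_trans hd.
have near_x (a b : R) : `|a| <= `|h| -> `|b| <= `|h| ->
    [/\ Omega (x + a *: e1 + b *: e2), `|'D_e1 g x - 'D_e1 g (x + a *: e1 + b *: e2)| <= e / 2 &
        `|'D_e2 g x - 'D_e2 g (x + a *: e1 + b *: e2)| <= e / 2].
  move=> ah bh; apply: Hd; rewrite (_ : x + a *: e1 + b *: e2 = (x.1 + a, x.2 + b)).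
    exact: in_ball.
  by apply/pair_equal_spec; split; rewrite /= /GRing.scale/=; ring.
have hv a : `|a| <= 1 -> `|h * a| <= `|h| by move=> a1; rewrite normrM ler_piMr.
have L1 : `|g (x + (h * v.1) *: e1) - g x - 'D_e1 g x * (h * v.1)| <= e / 2 * `|h * v.1|.
  apply: line_increment => s sh.
  have z0 : `|0 : R| <= `|h| by rewrite normr0.
  have [] := near_x s 0 (le_trans sh (hv _ v1)) z0.
  by rewrite scale0r addr0 => Oy d1 _; split; [exact: (dg _ _ Oy)|exact: d1].
have L2 : `|g (x + (h * v.1) *: e1 + (h * v.2) *: e2) - g (x + (h * v.1) *: e1) - 'D_e2 g x * (h * v.2)| <= e / 2 * `|h * v.2|.
  apply: line_increment => s sh.
  have [||Oy _ d2] := near_x (h * v.1) s; first exact: hv.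
    exact: le_trans sh (hv _ v2).
  by split; [exact: (dg _ _ Oy)|exact: d2].
have L3 := ler_normD2 L1 L2.
have L4 : `|g (x + (h * v.1) *: e1 + (h * v.2) *: e2) - g x - h * l| <= e * `|h|.
  rewrite (_ : _ - h * l = (g (x + (h * v.1) *: e1) - g x - 'D_e1 g x * (h * v.1)) +
    (g (x + (h * v.1) *: e1 + (h * v.2) *: e2) - g (x + (h * v.1) *: e1) - 'D_e2 g x * (h * v.2))).
    apply: (le_trans L3).
    have := hv _ v1; have := hv _ v2; move: e0; clear => e0 h1 h2.
    have := ler_wpM2l (ltW e0) h1; have := ler_wpM2l (ltW e0) h2; lra.
  by rewrite /l; ring.
have hx : g (h *: v + x) = g (x + (h * v.1) *: e1 + (h * v.2) *: e2).
  congr g; apply/pair_equal_spec; split; rewrite /= /GRing.scale/=; ring.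
rewrite /= hx (_ : l - _ = - (h^-1 * (g (x + (h * v.1) *: e1 + (h * v.2) *: e2) - g x - h * l))); last first.
  by rewrite /GRing.scale/=; field.
by rewrite normrN normrM normfV ler_pdivrMl ?normr_gt0// [leRHS]mulrC.
Qed.

Lemma smooth_derivable Omega f vs x v : smooth_bounded_on_closure Omega f ->
  Omega x -> derivable (iter_derive vs f) x v.
Proof. by move=> sf; have [df _ _] := sf vs; exact: df. Qed.

Lemma smooth_derive_coordinates Omega f v x : open Omega -> smooth_bounded_on_closure Omega f ->
  `|v.1| <= 1 -> `|v.2| <= 1 -> Omega x ->
  'D_v f x = v.1 * 'D_e1 f x + v.2 * 'D_e2 f x.
Proof.
move=> oO sf v1 v2 Ox; apply: (derive_coordinates oO Ox) => //.
- by move=> y w Oy; exact: (@smooth_derivable Omega f [::] y w sf Oy).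
- exact: (@smooth_continuous Omega f [:: e1] x oO sf Ox).
- exact: (@smooth_continuous Omega f [:: e2] x oO sf Ox).
Qed.

Lemma iter_derive_lin Omega f g h (a b : R) vs : open Omega ->
  smooth_bounded_on_closure Omega g -> smooth_bounded_on_closure Omega h ->
  (forall x, Omega x -> f x = a * g x + b * h x) ->
  forall x, Omega x -> iter_derive vs f x = a * iter_derive vs g x + b * iter_derive vs h x.
Proof.
move=> oO sg sh fE; elim: vs => [|v vs IH] x Ox /=; first exact: fE.
have dg := @smooth_derivable Omega g vs x v sg Ox.
have dh := @smooth_derivable Omega h vs x v sh Ox.
rewrite (near_eq_derive (g := (a \*: iter_derive vs g) + (b \*: iter_derive vs h))).
  rewrite deriveD; [|exact: derivableZ|exact: derivableZ].
  by rewrite !deriveZ.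
by apply: filterS (open_nbhs_nbhs (conj oO Ox)) => y Oy; exact: IH.
Qed.

Definition unit_bounded v := `|v.1| <= 1 /\ `|v.2| <= 1.

(** The hypothesis bounds each list of directions separately, while the frame varies with the
    target. Expanding every direction in the coordinate axes leaves finitely many derivatives and a
    bound uniform in the frame. *)
Lemma iter_derive_bounded Omega f (k : nat) : open Omega -> smooth_bounded_on_closure Omega f ->
  exists M : R, forall vs x, size vs = k -> (forall v, v \in vs -> unit_bounded v) ->
    Omega x -> `|iter_derive vs f x| <= M.
Proof.
move=> oO; elim: k f => [|k IH] f sf.
  by have [_ _ [M HM]] := sf [::]; exists M => vs x /size0nil ->; move=> _; exact: HM.
have [M1 H1] := IH _ (smooth_derive e1 sf); have [M2 H2] := IH _ (smooth_derive e2 sf).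
(* The innermost direction is peeled off, so that the induction hypothesis applies to the two
   partial derivatives of [f], which are again smooth. *)
exists (M1 + M2) => vs x; case/lastP: vs => [//|vs v]; rewrite size_rcons => -[vk] vs1 Ox.
have [v1 v2] : `|v.1| <= 1 /\ `|v.2| <= 1 by apply: vs1; rewrite mem_rcons mem_head.
have vs1' w : w \in vs -> `|w.1| <= 1 /\ `|w.2| <= 1.
  by move=> wvs; apply: vs1; rewrite mem_rcons in_cons wvs orbT.
rewrite iter_derive_rcons.
rewrite (iter_derive_lin vs oO (smooth_derive e1 sf) (smooth_derive e2 sf)
  (fun y => smooth_derive_coordinates oO sf v1 v2) Ox).
have := ler_normD2 (ler_normM2 v1 (H1 vs x vk vs1' Ox)) (ler_normM2 v2 (H2 vs x vk vs1' Ox)).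
by rewrite !mul1r.
Qed.

Lemma iter_derive_bounded_le Omega f (N : nat) : open Omega -> smooth_bounded_on_closure Omega f ->
  exists2 M : R, 1 <= M & forall vs x, (size vs <= N)%N ->
    (forall v, v \in vs -> unit_bounded v) ->
    Omega x -> `|iter_derive vs f x| <= M.
Proof.
move=> oO sf; elim: N => [|N [M M1 IH]].
  have [M HM] := iter_derive_bounded 0 oO sf.
  exists (Num.max M 1); first by rewrite le_max lexx orbT.
  by move=> vs x; rewrite leqn0 => /eqP vs0 vs1 Ox; rewrite le_max HM.
have [M' HM] := iter_derive_bounded N.+1 oO sf.
exists (Num.max M' M); first by rewrite le_max M1 orbT.
move=> vs x; rewrite leq_eqVlt => /orP[/eqP vsN|vsN] vs1 Ox; rewrite le_max.
  by rewrite HM.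
by rewrite (IH vs x vsN vs1 Ox) orbT.
Qed.

Definition frame_word tau n (w : seq bool) : seq (R * R) := [seq if b then tau else n | b <- w].

Definition frame_derivative f x tau n (w : seq bool) (u v : R) : R :=
  iter_derive (frame_word tau n w) f (frame x tau n u v).

Lemma frame_derivativeE Omega f x tau n w (u v : R) :
  smooth_bounded_on_closure Omega f -> Omega (frame x tau n u v) ->
  is_derive u (1 : R) (frame_derivative f x tau n w ^~ v) (frame_derivative f x tau n (true :: w) u v) /\
  is_derive v (1 : R) (frame_derivative f x tau n w u) (frame_derivative f x tau n (false :: w) u v).
Proof.
move=> sf Ouv; split.
  have E t : frame x tau n t v = (x + v *: n) + t *: tau by rewrite /frame addrAC.
  rewrite /frame_derivative (_ : (fun t => _) = fun t => iter_derive (frame_word tau n w) f (x + v *: n + t *: tau)); last first.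
    by apply/funext => t; rewrite E.
  by rewrite E in Ouv *; apply: is_derive_line; exact: smooth_derivable sf Ouv.
by apply: is_derive_line; exact: smooth_derivable sf Ouv.
Qed.

Lemma frame_derivative00 f x tau n w :
  frame_derivative f x tau n w 0 0 = iter_derive (frame_word tau n w) f x.
Proof. by rewrite /frame_derivative /frame !scale0r !addr0. Qed.

Lemma frame_staircase Omega f x tau n (M u v A : R) :
  smooth_bounded_on_closure Omega f ->
  (forall vs x, (size vs <= 3)%N -> (forall v, v \in vs -> unit_bounded v) ->
    Omega x -> `|iter_derive vs f x| <= M) ->
  0 <= M -> unit_bounded tau -> unit_bounded n -> `|u| <= A -> `|v| <= A ->
  (forall b, 0 <= b <= A -> Omega (frame x tau n 0 b)) ->
  (forall a, `|a| <= `|u| -> Omega (frame x tau n a A)) ->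
  (forall b, v <= b <= A -> Omega (frame x tau n u b)) ->
  `|f (frame x tau n u v) - (f x + 'D_tau f x * u + 'D_n f x * v
     + 'D_tau ('D_tau f) x / 2 * u ^+ 2 + 'D_n ('D_n f) x / 2 * v ^+ 2
     + 'D_n ('D_tau f) x * (A * u) + 'D_tau ('D_n f) x * (u * (v - A)))| <= 22 * M * A ^+ 3.
Proof.
move=> sf HM M0 t1 n1 uA vA D1 D2 D3.
have dG w a b : (size w <= 2)%N -> Omega (frame x tau n a b) ->
    is_derive a (1 : R) (frame_derivative f x tau n w ^~ b) (frame_derivative f x tau n (true :: w) a b) /\
    is_derive b (1 : R) (frame_derivative f x tau n w a) (frame_derivative f x tau n (false :: w) a b).
  by move=> _; exact: frame_derivativeE sf.
have GM w a b : (size w <= 3)%N -> Omega (frame x tau n a b) -> `|frame_derivative f x tau n w a b| <= M.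
  move=> w3 Oab; apply: HM => //; first by rewrite size_map.
  by move=> z /mapP[[] _ ->].
have := @staircase_taylor _ (frame_derivative f x tau n) (fun a b => Omega (frame x tau n a b))
  M u v A M0 uA vA dG GM D1 D2 D3.
by rewrite !frame_derivative00.
Qed.

Lemma mixed_difference (F a b c e g p q A K : R) :
  `|F - (a + b * A + c * A + e / 2 * A ^+ 2 + g / 2 * A ^+ 2 + p * (A * A) + q * (A * (A - A)))| <= K ->
  `|F - (a + c * A + b * A + g / 2 * A ^+ 2 + e / 2 * A ^+ 2 + q * (A * A) + p * (A * (A - A)))| <= K ->
  `|(p - q) * A ^+ 2| <= K + K.
Proof.
move=> S1 S2; rewrite -normrN in S2; have := ler_normD2 S1 S2.
by rewrite -normrN [X in `|X|](_ : _ = (p - q) * A ^+ 2); last by ring.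
Qed.

(** Going first along [n] and then along [tau], or the other way round, one reaches the same point.
    The two staircase expansions differ by the difference of the mixed derivatives times [A ^+ 2],
    while their errors are of order [A ^+ 3]. *)
Lemma mixed_derivatives_eq Omega f x tau n : open Omega -> smooth_bounded_on_closure Omega f ->
  unit_bounded tau -> unit_bounded n -> Omega x ->
  'D_n ('D_tau f) x = 'D_tau ('D_n f) x.
Proof.
move=> oO sf t1 n1 Ox.
have [M M1 HM] := iter_derive_bounded_le 3 oO sf.
have M0 : 0 <= M := le_trans ler01 M1.
have /nbhs_ballP[d /= d0 Hd] := open_nbhs_nbhs (conj oO Ox).
have box (tau' n' : R * R) (a b : R) : unit_bounded tau' -> unit_bounded n' ->
    `|a| < d / 2 -> `|b| < d / 2 -> Omega (frame x tau' n' a b).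
  move=> [h1 h2] [h3 h4] ad bd; apply: Hd; rewrite /frame; split; rewrite /ball/= /GRing.scale/=.
    rewrite (_ : _ - _ = - (a * tau'.1 + b * n'.1)); last by ring.
    rewrite normrN; apply: le_lt_trans (ler_normD2 (ler_normM2 (lexx _) h1) (ler_normM2 (lexx _) h3)) _.
    by move: ad bd; clear; lra.
  rewrite (_ : _ - _ = - (a * tau'.2 + b * n'.2)); last by ring.
  rewrite normrN; apply: le_lt_trans (ler_normD2 (ler_normM2 (lexx _) h2) (ler_normM2 (lexx _) h4)) _.
  by move: ad bd; clear; lra.
have stairs (tau' n' : R * R) (A : R) : unit_bounded tau' -> unit_bounded n' -> 0 < A < d / 2 ->
    `|f (frame x tau' n' A A) - (f x + 'D_tau' f x * A + 'D_n' f x * A + 'D_tau' ('D_tau' f) x / 2 * A ^+ 2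
      + 'D_n' ('D_n' f) x / 2 * A ^+ 2 + 'D_n' ('D_tau' f) x * (A * A) + 'D_tau' ('D_n' f) x * (A * (A - A)))|
    <= 22 * M * A ^+ 3.
  move=> t' n1' /andP[A0 Ad].
  have AA : `|A| <= A by rewrite gtr0_norm.
  have Ad' : `|A| < d / 2 := le_lt_trans AA Ad.
  apply: (frame_staircase sf HM M0) => //.
  - move=> b /andP[b0 bA]; apply: box; rewrite ?normr0 ?divr_gt0//.
    by rewrite ger0_norm// (le_lt_trans bA).
  - by move=> a aA; apply: box => //; exact: le_lt_trans Ad'.
  - by move=> b bA; apply: box => //; rewrite (_ : b = A)//; apply/le_anti; rewrite andbC.
apply: contrapT => /eqP ne.
set del := 'D_n ('D_tau f) x - 'D_tau ('D_n f) x.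
have del0 : 0 < `|del| by rewrite normr_gt0 subr_eq0.
have Mp : 0 < M := lt_le_trans ltr01 M1.
have M44 : 0 < 45 * M by rewrite mulr_gt0.
(* The two errors add up to [44 * M * A ^+ 3]; the 45 makes the resulting inequality
   contradictory. *)
pose A : R := Num.min (d / 4) (`|del| / (45 * M)).
have A0 : 0 < A by rewrite /A lt_min; apply/andP; split; apply: divr_gt0.
have Ad : A < d / 2 by rewrite /A gt_min; apply/orP; left; move: d0; clear; lra.
have AI : 0 < A < d / 2 by rewrite A0.
have S1 := stairs tau n A t1 n1 AI; have S2 := stairs n tau A n1 t1 AI.
rewrite (_ : frame x n tau A A = frame x tau n A A) in S2; last by rewrite /frame addrAC.
have H : `|del| * A ^+ 2 <= 44 * M * A ^+ 3.
  rewrite -(ger0_norm (exprn_ge0 2 (ltW A0))) -normrM.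
  apply: (le_trans (mixed_difference S1 S2)); rewrite le_eqVlt; apply/orP; left; apply/eqP.
  by clear; ring.
have : 45 * M * A <= `|del|.
  by rewrite mulrC -ler_pdivlMr// /A ge_min lexx orbT.
move=> /(ler_wpM2r (exprn_ge0 2 (ltW A0))).
have : 0 < M * A ^+ 3 by rewrite mulr_gt0 ?exprn_gt0.
move: H; rewrite (exprS _ 2); clear; lra.
Qed.

End SmoothFunctions.

Section DomainTaylor.
Context {R : realType}.
Implicit Types (Omega : set (R * R)) (f : R * R -> R) (x y tau n : R * R).

Lemma frame_shift x0 x tau n (r u v : R) :
  x = frame x0 tau n 0 r -> frame x tau n u v = frame x0 tau n u (v + r).
Proof. by move=> ->; apply/pair_equal_spec; split; rewrite /= /GRing.scale/=; ring. Qed.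

(** The staircase climbs to [A], the larger of [|u|] and [|v|]. As [|q a| <= |a| / 2], the crossing
    at height [A] stays above the graph, and the descent stays above its end point, which lies in
    the domain. Equality of the mixed derivatives then merges the two staircase terms into the
    single one in [u * v], and [A] disappears from the polynomial. *)
Lemma domain_taylor Omega f x0 x tau n (M rho r : R) (q : R -> R) :
  open Omega -> smooth_bounded_on_closure Omega f -> 0 <= M ->
  (forall vs x, (size vs <= 3)%N -> (forall v, v \in vs -> unit_bounded v) ->
    Omega x -> `|iter_derive vs f x| <= M) ->
  unit_bounded tau -> unit_bounded n -> Omega x ->
  0 < rho -> 0 < r <= rho / 4 -> x = frame x0 tau n 0 r ->
  (forall u : R, `|u| <= rho -> `|q u| <= `|u| / 2) ->
  (forall u v : R, `|u| <= rho -> `|v| <= rho -> (Omega (frame x0 tau n u v) <-> q u < v)) ->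
  forall u v : R, `|u| <= rho / 4 -> `|v| <= rho / 4 -> Omega (frame x tau n u v) ->
  `|f (frame x tau n u v) - quad (f x) ('D_tau f x) ('D_n f x) ('D_tau ('D_tau f) x)
      ('D_tau ('D_n f) x) ('D_n ('D_n f) x) u v| <= 22 * M * (`|u| + `|v|) ^+ 3.
Proof.
move=> oO sf M0 HM t1 n1 Ox rho0 /andP[r0 rr] xE q2 OE u v ur vr Ouv.
pose A := Num.max `|u| `|v|.
have uA : `|u| <= A by rewrite le_max lexx.
have vA : `|v| <= A by rewrite le_max lexx orbT.
have A0 : 0 <= A := le_trans (normr_ge0 u) uA.
have Ar : A <= rho / 4 by rewrite ge_max ur.
have rho4 (a : R) : `|a| <= rho / 4 -> `|a| <= rho.
  by move=> h; apply: (le_trans h); move: rho0; clear; lra.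
have inside (a b : R) : `|a| <= rho / 4 -> - (rho / 4) <= b <= rho / 4 -> q a < b + r -> Omega (frame x tau n a b).
  move=> ar /andP[b1 b2] qa; rewrite (frame_shift _ _ xE); apply/OE => //; first exact: rho4.
  by rewrite ler_norml; apply/andP; split; move: r0 rr b1 b2 rho0; clear; lra.
have S : `|f (frame x tau n u v) - (f x + 'D_tau f x * u + 'D_n f x * v
     + 'D_tau ('D_tau f) x / 2 * u ^+ 2 + 'D_n ('D_n f) x / 2 * v ^+ 2
     + 'D_n ('D_tau f) x * (A * u) + 'D_tau ('D_n f) x * (u * (v - A)))| <= 22 * M * A ^+ 3.
  apply: (frame_staircase sf HM M0) => //.
  - move=> b /andP[b0 bA]; apply: inside.
    + by rewrite normr0 divr_ge0// ltW.
    + by rewrite (le_trans bA Ar) andbT; move: rho0 b0; clear; lra.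
    + have := q2 0; rewrite normr0 (ltW rho0) mul0r normr_le0 => /(_ isT)/eqP->.
      by rewrite ltr_wpDl.
  - move=> a au; have aA := le_trans au uA; apply: inside.
    + exact: le_trans aA Ar.
    + by rewrite Ar andbT; move: rho0 A0; clear; lra.
    + have := q2 a (rho4 _ (le_trans aA Ar)); have := ler_norm (q a).
      by move: r0 aA A0 (normr_ge0 a); clear; lra.
  - move=> b /andP[vb bA].
    have v4 : - (rho / 4) <= v by move: vr; rewrite ler_norml => /andP[].
    apply: inside => //; first by rewrite (le_trans v4 vb) (le_trans bA Ar).
    have := Ouv; rewrite (frame_shift _ _ xE) OE; last 2 first.
    + exact: rho4.
    + move: vr; rewrite !ler_norml => /andP[h1 h2]; apply/andP; split; move: r0 rr h1 h2 rho0; clear; lra.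
    by move=> h; apply: (lt_le_trans h); rewrite lerD2r.
rewrite (mixed_derivatives_eq oO sf t1 n1 Ox) in S.
have AA : 22 * M * A ^+ 3 <= 22 * M * (`|u| + `|v|) ^+ 3.
  apply: ler_wpM2l; first exact: mulr_ge0.
  apply: lerXn2r; rewrite ?nnegrE ?addr_ge0//.
  by rewrite /A ge_max lerDl lerDr !normr_ge0.
apply: le_trans AA; apply: le_trans S; rewrite le_eqVlt; apply/orP; left; apply/eqP; congr `|_|.
move: ('D_tau ('D_n f) x) ('D_tau f x) ('D_n f x) ('D_tau ('D_tau f) x) ('D_n ('D_n f) x) (f x) (f _).
by move=> *; rewrite /quad; clear; ring.
Qed.

End DomainTaylor.

(** * The volume potential *)

Section InnerIntegral.
Context {R : realType}.
Notation mu := (@lebesgue_measure R).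
Notation lam := (mu \x mu)%E.
Implicit Types (Omega : set (R * R)) (f : R * R -> R) (x y tau n : R * R).

Lemma measurable_frame x tau n : measurable_fun setT (fun z : R * R => frame x tau n z.1 z.2).
Proof.
have -> : (fun z : R * R => frame x tau n z.1 z.2) =
    (fun z => (x.1 + z.1 * tau.1 + z.2 * n.1, x.2 + z.1 * tau.2 + z.2 * n.2)).
  by apply/funext => z; apply/pair_equal_spec; split.
by apply: measurable_fun_pair; (apply: measurable_funD; [apply: measurable_funD => //|]); exact: measurable_funM.
Qed.

Definition kernel (alpha t : R) x y : R :=
  expR (- (enorm (x - y) ^+ 2 / (4 * t)) - alpha ^+ 2 * t) / (4 * pi * t).

Lemma enorm_sqr y : enorm y ^+ 2 = dotp y y.
Proof. by rewrite sqr_sqrtr// /dotp addr_ge0// -expr2 sqr_ge0. Qed.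

Lemma measurable_kernel (alpha t : R) x : measurable_fun setT (kernel alpha t x).
Proof.
have -> : kernel alpha t x = fun y => expR (- ((x.1 - y.1) ^+ 2 + (x.2 - y.2) ^+ 2) / (4 * t) - alpha ^+ 2 * t) / (4 * pi * t).
  by apply/funext => y; rewrite /kernel enorm_sqr /dotp/= -!expr2 mulNr.
apply: measurable_funM => //; apply: measurableT_comp => //; apply: measurable_funB => //.
apply: measurable_funM => //; apply: measurableT_comp => //; apply: measurable_funD; apply: measurable_funX; exact: measurable_funB.
Qed.

Lemma kernel_frame (alpha e : R) x tau n (u v : R) : 0 < e -> orthonormal_pair tau n ->
  e ^+ 2 * kernel alpha (e ^+ 2) x (frame x tau n (e * u) (e * v)) =
  expR (- (alpha * e) ^+ 2) * (gam u * gam v).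
Proof.
move=> e0 [t1 n1 tn]; have en : e != 0 by rewrite gt_eqF.
rewrite /kernel enorm_sqr.
have -> : dotp (x - frame x tau n (e * u) (e * v)) (x - frame x tau n (e * u) (e * v)) = e ^+ 2 * (u ^+ 2 + v ^+ 2).
  transitivity (e ^+ 2 * (u ^+ 2 * dotp tau tau + v ^+ 2 * dotp n n + 2 * u * v * dotp tau n)).
    by rewrite /dotp/= /GRing.scale/=; ring.
  by rewrite t1 n1 tn; ring.
have -> : - (e ^+ 2 * (u ^+ 2 + v ^+ 2) / (4 * e ^+ 2)) - alpha ^+ 2 * e ^+ 2 =
    - (alpha * e) ^+ 2 + (- (u ^+ 2 / 4) + - (v ^+ 2 / 4)) by field.
rewrite !expRD /gam.
have pn : Num.sqrt (pi : R) != 0 by rewrite gt_eqF// sqrtpi_gt0.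
have pE : (pi : R) = Num.sqrt pi ^+ 2 by rewrite sqr_sqrtr// pi_ge0.
by rewrite {1}pE; field; rewrite en pn.
Qed.

Lemma inner_integral Omega f (alpha e M : R) x tau n : open Omega -> 0 < e ->
  orthonormal_pair tau n -> measurable_fun setT (f \_ Omega) ->
  (forall y, `|(f \_ Omega) y| <= M) ->
  \int[lam]_(y in Omega) (kernel alpha (e ^+ 2) x y * f y) =
  expR (- (alpha * e) ^+ 2) * \int[lam]_z (gam z.1 * gam z.2 * (f \_ Omega) (frame x tau n (e * z.1) (e * z.2))).
Proof.
move=> oO e0 on mf fM.
pose F u v := (f \_ Omega) (frame x tau n u v).
have mF : measurable_fun setT (fun z : R * R => F z.1 z.2).
  by apply: (measurableT_comp mf); exact: measurable_frame.
have [_ _ Fi _] := @plane_integral_iterated R F M e mF (fun u v => fM _).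
pose G y := kernel alpha (e ^+ 2) x y * (f \_ Omega) y.
have mG : measurable_fun setT G by apply: measurable_funM => //; exact: measurable_kernel.
have -> : \int[lam]_(y in Omega) (kernel alpha (e ^+ 2) x y * f y) = \int[lam]_y G y.
  rewrite /Rintegral integral_mkcond; congr fine; apply: eq_integral => y _.
  by rewrite /G /patch; case: ifPn => // _; rewrite mulr0.
pose phi (z : R * R) : R * R := frame x tau n (e * z.1) (e * z.2).
have e2n : e ^+ 2 != 0 by rewrite expf_neq0// gt_eqF.
have Gphi z : e ^+ 2 * G (phi z) = expR (- (alpha * e) ^+ 2) * (gam z.1 * gam z.2 * F (e * z.1) (e * z.2)).
  by rewrite /G mulrA kernel_frame// -mulrA.
have GphiE : (fun z => G (phi z)) = (fun z => (expR (- (alpha * e) ^+ 2) / e ^+ 2) * (gam z.1 * gam z.2 * F (e * z.1) (e * z.2))).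
  by apply/funext => z; apply: (mulfI e2n); rewrite Gphi; field; rewrite gt_eqF.
have Gphii : lam.-integrable setT (EFin \o (G \o phi)).
  rewrite (_ : G \o phi = fun z => G (phi z))// GphiE.
  exact: (@integrableZl _ _ _ lam setT measurableT (expR (- (alpha * e) ^+ 2) / e ^+ 2) _ Fi).
have det : `|(e * tau.1) * (e * n.2) - (e * n.1) * (e * tau.2)| = e ^+ 2.
  have /eqP := orthonormal_det on; rewrite sqrf_eq1 => h.
  rewrite (_ : _ - _ = e ^+ 2 * (tau.1 * n.2 - tau.2 * n.1)); last by ring.
  by rewrite normrM; case/orP: h => /eqP ->; rewrite ?normrN normr1 mulr1 ger0_norm// exprn_ge0// ltW.
have det0 : (e * tau.1) * (e * n.2) - (e * n.1) * (e * tau.2) != 0 by rewrite -normr_gt0 det exprn_gt0.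
have change (g : R * R -> \bar R) : measurable_fun setT g -> (forall z, 0 <= g z)%E ->
    (\int[lam]_z g z = (e ^+ 2)%:E * \int[lam]_z g (phi z))%E.
  move=> mg g0; rewrite (ge0_integral_linear x.1 x.2 det0 mg g0) det.
  congr (_ * _)%E; apply: eq_integral => z _; congr g.
  by apply/pair_equal_spec; split; rewrite /= /GRing.scale/=; ring.
(* Integrability is pulled back through the change of variables from the rescaled integrand, where
   the Gaussian weights are explicit. *)
have Gi : lam.-integrable setT (EFin \o G).
  apply/integrableP; split; first exact/measurable_EFinP.
  rewrite (change (fun y => `|(G y)%:E|)%E)//; last first.
    by apply: measurableT_comp => //; exact/measurable_EFinP.
  by have /integrableP[_] := Gphii; move=> h; rewrite lte_mul_pinfty// lee_fin exprn_ge0// ltW.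
rewrite (@Rintegral_change R _ _ _ _ lam lam (e ^+ 2) phi change G Gi Gphii).
have -> : \int[lam]_z G (phi z) = expR (- (alpha * e) ^+ 2) / e ^+ 2 *
    \int[lam]_z (gam z.1 * gam z.2 * F (e * z.1) (e * z.2)).
  rewrite -(RintegralZl _ _ Fi)//.
  by congr (Rintegral _ _ _); exact: GphiE.
by rewrite mulrA; congr (_ * _); field; rewrite gt_eqF.
Qed.

End InnerIntegral.

(** * Integration in time and the assembled expansion *)

Section Main.
Context {R : realType}.
Notation mu := (@lebesgue_measure R).
Notation lam := (mu \x mu)%E.
Implicit Types (Omega : set (R * R)) (f : R * R -> R) (x y tau n : R * R).

Lemma smooth_measurable_restrict Omega f : open Omega -> smooth_bounded_on_closure Omega f ->
  measurable_fun setT (f \_ Omega).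
Proof.
move=> oO sf; apply/(measurable_restrictT _ _).1; first exact: open_measurable_plane.
apply: open_continuous_measurable_plane => // p Op.
exact: (@smooth_continuous R Omega f [::] p oO sf Op).
Qed.

(** The time integral needs measurability in [e]; as an iterated integral the mean is a parameter
    integral of a jointly measurable function, twice. *)
Lemma measurable_gaussian_mean Omega f x tau n (M : R) : measurable_fun setT (f \_ Omega) ->
  (forall y, `|(f \_ Omega) y| <= M) ->
  measurable_fun setT (fun e : R => \int[lam]_z
    (gam z.1 * gam z.2 * (f \_ Omega) (frame x tau n (e * z.1) (e * z.2)))).
Proof.
move=> mf fM.
pose F u v := (f \_ Omega) (frame x tau n u v).
have mF : measurable_fun setT (fun z : R * R => F z.1 z.2).
  by apply: (measurableT_comp mf); exact: measurable_frame.
have -> : (fun e : R => \int[lam]_z (gam z.1 * gam z.2 * F (e * z.1) (e * z.2))) =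
    (fun e => \int[mu]_a (gam a * \int[mu]_b (gam b * F (e * a) (e * b)))).
  by apply/funext => e; have [_ _ _] := @plane_integral_iterated R F M e mF (fun u v => fM _).
pose h (p : R * R * R) := gam p.2 * F (p.1.1 * p.1.2) (p.1.1 * p.2).
have mh : measurable_fun setT h.
  apply: measurable_funM; first by apply: measurableT_comp => //; exact: measurable_gam.
  apply: (measurableT_comp mF (g := fun p : R * R * R => (p.1.1 * p.1.2, p.1.1 * p.2))).
  have m1 : measurable_fun setT (fun p : R * R * R => p.1.1) by apply: measurableT_comp.
  have m2 : measurable_fun setT (fun p : R * R * R => p.1.2) by apply: measurableT_comp.
  by apply: measurable_fun_pair; apply: measurable_funM.
pose k (p : R * R) := gam p.2 * \int[mu]_b h (p, b).
have mk : measurable_fun setT k.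
  apply: measurable_funM; first by apply: measurableT_comp => //; exact: measurable_gam.
  apply: (measurableT_comp (_ : measurable_fun setT fine)) => //.
  have := @measurable_parameter_integral R _ _ (measurableTypeR R * measurableTypeR R)%type
    (measurableTypeR R) (EFin \o h) mu.
  by apply; exact/measurable_EFinP.
apply: (measurableT_comp (_ : measurable_fun setT fine)) => //.
have := @measurable_parameter_integral R _ _ (measurableTypeR R) (measurableTypeR R) (EFin \o k) mu.
by apply; exact/measurable_EFinP.
Qed.

Lemma Rintegral_open_itv_bound (h : R -> R) (d K : R) : 0 < d ->
  measurable_fun `]0, d[ h -> (forall t, 0 < t < d -> `|h t| <= K) ->
  mu.-integrable `]0, d[ (EFin \o h) /\ `|\int[mu]_(t in `]0%R, d[) h t| <= K * d.
Proof.
move=> d0 mh hK.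
have mI : measurable (`]0, d[%classic : set R) by exact: measurable_itv.
have fin : (mu `]0%R, d[ < +oo)%E by rewrite lebesgue_measure_itv/= lte_fin d0 -EFinB ltry.
have Ki : mu.-integrable `]0, d[ (EFin \o cst K).
  apply/integrableP; split; first exact/measurable_EFinP.
  rewrite [ltLHS](_ : _ = (\int[mu]_(t in `]0%R, d[) (cst (`|K|%:E) t))%E)//.
  by rewrite integral_cst//= lebesgue_measure_itv/= lte_fin d0 -EFinB -EFinM ltry.
have hK' t : `]0, d[%classic t -> `|h t| <= cst K t by rewrite /= in_itv/=; exact: hK.
split; first exact: (dominated_integrable_R mI mh Ki hK').
apply: (le_trans (Rintegral_norm_le mI mh Ki hK')).
by rewrite Rintegral_cst//= lebesgue_measure_itv/= lte_fin d0 -EFinB subr0.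
Qed.

Lemma sqrt_pow3 (d : R) : 0 < d -> d `^ (3 / 2) = Num.sqrt d ^+ 3.
Proof.
move=> d0; rewrite -[in LHS](sqr_sqrtr (ltW d0)) -powR_mulrn ?sqrtr_ge0// -powRrM.
rewrite (_ : 2%:R * (3 / 2) = 3%:R); last by field.
by rewrite powR_mulrn ?sqrtr_ge0.
Qed.

Lemma sqrt_pow5 (d : R) : 0 < d -> d `^ (5 / 2) = Num.sqrt d ^+ 5.
Proof.
move=> d0; rewrite -[in LHS](sqr_sqrtr (ltW d0)) -powR_mulrn ?sqrtr_ge0// -powRrM.
rewrite (_ : 2%:R * (5 / 2) = 5%:R); last by field.
by rewrite powR_mulrn ?sqrtr_ge0.
Qed.

(** The error at time [t] is at most [C * s ^+ 3] throughout, and the time interval has length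
    [s ^+ 2]. *)
Lemma potential_expansion Omega f (alpha d r C M x0 x1 x2 : R) x tau n :
  open Omega -> 0 < d <= 1 -> 0 < alpha -> 0 < r -> orthonormal_pair tau n -> 0 <= C ->
  measurable_fun setT (f \_ Omega) -> (forall y, `|(f \_ Omega) y| <= M) ->
  (forall e : R, 0 < e <= 1 ->
    `|\int[lam]_z (gam z.1 * gam z.2 * (f \_ Omega) (frame x tau n (e * z.1) (e * z.2)))
      - (x0 * tailg (- (r / e)) + x1 * (e * gam (r / e)) + x2 * (e ^+ 2 * tailg (- (r / e))))|
    <= C * e ^+ 3) ->
  let s := Num.sqrt d in
  `|local_volume_potential alpha Omega f d x
    - (x0 * H0_fun alpha r s + x1 * H1_fun alpha r s + x2 * H2_fun alpha r s)| <= C * s ^+ 5.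
Proof.
move=> oO dI alpha0 r0 on C0 mf fM HI.
have [d0 d1] := andP dI.
set s := Num.sqrt d.
rewrite /=.
pose I (e : R) := \int[lam]_z (gam z.1 * gam z.2 * (f \_ Omega) (frame x tau n (e * z.1) (e * z.2))).
pose S (t : R) := x0 * dens0 alpha r (Num.sqrt t) + x1 * dens1 alpha r (Num.sqrt t) + x2 * dens2 alpha r (Num.sqrt t).
have [Si SE] := time_integral alpha0 r0 x0 x1 x2 d0.
pose J (t : R) := expR (- (alpha * Num.sqrt t) ^+ 2) * I (Num.sqrt t).
have JE : local_volume_potential alpha Omega f d x = \int[mu]_(t in `]0%R, d[) J t.
  apply: eq_Rintegral => t; rewrite inE/= in_itv/= => /andP[t0 _].
  rewrite /J /I -(inner_integral alpha x oO _ on mf fM) ?sqrtr_gt0//.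
  by rewrite sqr_sqrtr ?ltW.
have ms : measurable_fun setT (@Num.sqrt R) by apply: continuous_measurable_fun; exact: sqrt_continuous.
have mJ : measurable_fun setT J.
  apply: measurable_funM.
    apply: measurableT_comp => //; apply: measurableT_comp => //.
    by apply: measurable_funX; exact: measurable_funM.
  by apply: (measurableT_comp (f := I)) => //; exact: measurable_gaussian_mean mf fM.
have mS : measurable_fun `]0, d[ S by apply/measurable_EFinP; exact: (measurable_int _ Si).
have sd : s ^+ 2 = d by rewrite sqr_sqrtr// ltW.
have s0 : 0 < s by rewrite sqrtr_gt0.
have bound t : 0 < t < d -> `|J t - S t| <= C * s ^+ 3.
  move=> /andP[t0 td].
  have e0 : 0 < Num.sqrt t by rewrite sqrtr_gt0.
  have es : Num.sqrt t <= s by rewrite ler_wsqrtr// ltW.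
  have e1 : 0 < Num.sqrt t <= 1.
    by rewrite e0 -[leRHS]sqrtr1 ler_wsqrtr// (le_trans (ltW td)).
  rewrite /J /S /dens0 /dens1 /dens2.
  set E := expR _; set e := Num.sqrt t in e0 es e1 *.
  rewrite (_ : _ - _ = E * (I e - (x0 * tailg (- (r / e)) + x1 * (e * gam (r / e)) + x2 * (e ^+ 2 * tailg (- (r / e)))))); last by ring.
  rewrite normrM (ger0_norm (expR_ge0 _)).
  have E1 : E <= 1 by rewrite -expR0 ler_expR oppr_le0 sqr_ge0.
  apply: (le_trans (ler_pM (expR_ge0 _) (normr_ge0 _) E1 (HI e e1))); rewrite mul1r.
  by apply: ler_wpM2l => //; apply: lerXn2r => //; rewrite nnegrE ltW.
have mJS : measurable_fun `]0, d[ (fun t => J t - S t) by apply: measurable_funB => //; exact: measurable_funTS.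
have [hi hb] := Rintegral_open_itv_bound d0 mJS bound.
have Ji : mu.-integrable `]0, d[ (EFin \o J).
  rewrite (_ : J = fun t => (J t - S t) + S t); last by apply/funext => t; rewrite subrK.
  exact: integrable_add.
rewrite JE -SE -RintegralB//.
by apply: (le_trans hb); rewrite -mulrA -sd -exprD.
Qed.

End Main.

Theorem lemma4p8 (R : realType) (alpha : R) (Omega : set (R * R))
    (f : R * R -> R) :
  0 < alpha ->
  interior_or_exterior_domain Omega ->
  (exists c L, smooth_closed_curve c L (boundary Omega)) ->
  smooth_bounded_on_closure Omega f ->
  exists C : R, \forall d \near 0^'+,
    forall (x x0 tau n : R * R) (kappa : R),
      Omega x ->
      unique (closest_point (boundary Omega) x) x0 ->
      unit_tangent Omega x0 tau ->
      inward_unit_normal Omega x0 n ->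
      boundary_curvature Omega x x0 tau n kappa ->
      let r := enorm (x - x0) in
      let c1 := r / Num.sqrt d in
      let c2 := alpha * Num.sqrt d in
      let fx := f x in
      let f01 := 'D_n f x in
      let f02 := 'D_n ('D_n f) x in
      let f20 := 'D_tau ('D_tau f) x in
      r <= Num.sqrt d * (12 + 2 * alpha * Num.sqrt d) ->
      `| local_volume_potential alpha Omega f d x
         - (d * (fx / 4) * W0 c1 c2
            + d `^ (3 / 2) * ((2 * f01 - fx * kappa) / 8) * Q c1 c2 0
            + d ^+ 2 *
              ((f01 * kappa / 8 - 3 * fx * kappa ^+ 2 / 32 - f02 / 8)
                 * Q c1 c2 1
               + (f02 + f20) / 8 * W1 c1 c2)) |
      <= C * d `^ (5 / 2).
Proof.
move=> alpha0 dO [c [L sc]] sf.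
have [[oO _ _] _] := dO.
have [C1 C11 [rho /andP[rho0 rho1] HG]] := domain_frame dO sc.
have [M0 M01 HM] := iter_derive_bounded_le 3 oO sf.
have M00 : 0 <= M0 := le_trans ler01 M01.
(* One constant for the Taylor remainder, the derivatives of [f] and the coefficients and remainder
   of the graph. *)
pose M := 22 * M0 + C1.
have M1 : 1 <= M by rewrite /M; move: M00 C11; clear; lra.
have M0M : M0 <= M by rewrite /M; move: M00 C11; clear; lra.
have M22 : 22 * M0 <= M by rewrite /M; move: C11; clear; lra.
have C1M : C1 <= M by rewrite /M; move: M00; clear; lra.
have rho40 : 0 < rho / 4 by rewrite divr_gt0.
have [C C0 HP] := plane_integral_expansion M1 rho40.
have mf := smooth_measurable_restrict oO sf.
have fM y : `|(f \_ Omega) y| <= M.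
  rewrite /patch; case: ifPn => [|_]; last by rewrite normr0 (le_trans ler01).
  rewrite inE => Oy; apply: le_trans M0M; exact: (HM [::] y).
exists C.
have a120 : 0 < 12 + 2 * alpha by rewrite addr_gt0// mulr_gt0.
(* For [d] below this threshold and 1, the bound on the distance puts the target within [rho / 4] of
   the boundary, so that its box of half-side [rho / 4] lies in the box of half-side [rho] at
   [x0]. *)
have sq0 : 0 < (rho / 4 / (12 + 2 * alpha)) ^+ 2 by rewrite exprn_gt0// divr_gt0.
near=> d; move=> x x0 tau n kappa Ox [cp _] ut nO bc /= rd.
set r := enorm (x - x0) in rd *.
have d0 : 0 < d by near: d; exact: nbhs_right_gt.
have d1 : d <= 1 by near: d; exact: nbhs_right_le.
have d2 : d <= (rho / 4 / (12 + 2 * alpha)) ^+ 2 by near: d; exact: nbhs_right_le.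
pose s := Num.sqrt d.
have s0 : 0 < s by rewrite sqrtr_gt0.
have s1 : s <= 1 by rewrite -[leRHS]sqrtr1 ler_wsqrtr.
have s2 : s <= rho / 4 / (12 + 2 * alpha).
  rewrite -[leRHS]ger0_norm; last by rewrite divr_ge0 ?ltW.
  by rewrite -sqrtr_sqr ler_wsqrtr.
have rr : r <= rho / 4.
  apply: (le_trans rd); rewrite -/s.
  apply: (@le_trans _ _ (s * (12 + 2 * alpha))).
    apply: ler_wpM2l; first exact: ltW.
    by rewrite lerD2l ler_piMr// mulr_ge0// ltW.
  by rewrite -ler_pdivlMr.
have rrho : r < rho by apply: (le_lt_trans rr); move: rho0; clear; lra.
(* The base parameter is reduced to one period, where the uniform constants are available. *)
have [s00 s0L x0E] : exists2 t, 0 <= t <= L & x0 = c t.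
  have [L0 _ _ [_ _ rB]] := sc.
  have [+ _] := cp; rewrite -rB => -[t _ <-].
  have [w /andP[w0 wL] [k ->]] := curve_reduce sc 0 t.
  by exists w; rewrite ?w0 ?ltW// (curve_period sc) add0r.
have [on r0 xE [g [q [kC gC qe q2 OE]]]] :=
  target_frame oO sc rho0 (fun tau' n' => HG s00 tau' n' s0L) x0E Ox cp ut nO bc rrho.
rewrite -/r in r0 xE.
have [t1 t2 n1 n2] := orthonormal_le1 on.
have ut' : unit_bounded tau by [].
have un : unit_bounded n by [].
have HM' w : (size w <= 3)%N -> `|iter_derive (frame_word tau n w) f x| <= M.
  move=> w3; apply: le_trans M0M; apply: HM => //; first by rewrite size_map.
  by move=> z /mapP[[] _ ->].
have r4 : 0 < r <= rho / 4 by rewrite r0.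
have rho4 (a : R) : `|a| <= rho / 4 -> `|a| <= rho.
  by move=> h; apply: (le_trans h); move: rho0; clear; lra.
pose F (u v : R) := (f \_ Omega) (frame x tau n u v).
have FE u v : Omega (frame x tau n u v) -> F u v = f (frame x tau n u v).
  by move=> O; rewrite /F /patch mem_set.
have F0 u v : ~ Omega (frame x tau n u v) -> F u v = 0.
  by move=> O; rewrite /F /patch memNset.
have vr (v : R) : `|v| <= rho / 4 -> `|v + r| <= rho.
  rewrite !ler_norml => /andP[h1 h2]; apply/andP; split; move: r0 rr h1 h2 rho0; clear; lra.
have OE' u v : `|u| <= rho / 4 -> `|v| <= rho / 4 -> Omega (frame x tau n u v) <-> q u - r < v.
  move=> /rho4 uh /vr vh; rewrite (frame_shift u v xE) OE//.
  by rewrite ltrBlDr.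
have mF : measurable_fun setT (fun z : R * R => F z.1 z.2).
  by apply: (measurableT_comp mf); exact: measurable_frame.
(* Seen from the target, the boundary is the graph of [q - r]. *)
have HI (e : R) : 0 < e <= 1 -> _ := fun e01 => HP F (fun u => q u - r) (f x) ('D_tau f x) ('D_n f x)
  ('D_tau ('D_tau f) x) ('D_tau ('D_n f) x) ('D_n ('D_n f) x) kappa g r e (HM' [::] isT) (HM' [:: true] isT) (HM' [:: false] isT)
  (HM' [:: true; true] isT) (HM' [:: true; false] isT) (HM' [:: false; false] isT)
  (le_trans kC C1M) (le_trans gC C1M) (ltW r0) e01 mF (fun u v => fM _).
have B1 u v : `|u| <= rho / 4 -> `|v| <= rho / 4 -> q u - r < v ->
    `|F u v - quad (f x) ('D_tau f x) ('D_n f x) ('D_tau ('D_tau f) x) ('D_tau ('D_n f) x)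
      ('D_n ('D_n f) x) u v| <= M * (`|u| + `|v|) ^+ 3.
  move=> uh vh /(OE' u v uh vh) Ouv; rewrite FE//.
  apply: (le_trans (domain_taylor oO sf M00 HM ut' un Ox rho0 r4 xE q2 OE uh vh Ouv)).
  by apply: ler_wpM2r => //; rewrite exprn_ge0// addr_ge0.
have B2 u v : `|u| <= rho / 4 -> `|v| <= rho / 4 -> v <= q u - r -> F u v = 0.
  move=> uh vh vq; apply: F0 => /(OE' u v uh vh); rewrite ltNge vq; exact/negP.
have B3 u : `|u| <= rho / 4 -> `|q u - r - parabola r kappa g u| <= M * u ^+ 4.
  move=> uh; have := qe u (rho4 _ uh).
  rewrite (_ : q u - r - parabola r kappa g u = q u - kappa / 2 * u ^+ 2 - g / 6 * u ^+ 3).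
    move=> h; apply: (le_trans h); apply: ler_wpM2r => //.
    by rewrite -[4%N]/(2 * 2)%N exprM sqr_ge0.
  by rewrite /parabola; ring.
have E (e : R) (e01 : 0 < e <= 1) := HI e e01 B1 B2 B3.
have {}E (e : R) : 0 < e <= 1 ->
    `|\int[(lebesgue_measure \x lebesgue_measure)%E]_z
        (gam z.1 * gam z.2 * (f \_ Omega) (frame x tau n (e * z.1) (e * z.2)))
      - (f x * tailg (- (r / e)) + ((2 * 'D_n f x - f x * kappa) +
        ('D_n f x * kappa - 3 / 4 * f x * kappa ^+ 2 - 'D_n ('D_n f) x) * r) * (e * gam (r / e))
        + ('D_tau ('D_tau f) x + 'D_n ('D_n f) x) * (e ^+ 2 * tailg (- (r / e))))|
    <= C * e ^+ 3.
  move=> /E h; apply: le_trans h; rewrite le_eqVlt; apply/orP; left; apply/eqP.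
  congr (`|_ - _|).
  move: ('D_n f x) ('D_n ('D_n f) x) ('D_tau ('D_tau f) x) (f x) => a1 a2 a3 a4.
  by clear; ring.
have d01 : 0 < d <= 1 by rewrite d0.
have := potential_expansion oO d01 alpha0 r0 on C0 mf fM E.
rewrite -/s /= sqrt_pow3// sqrt_pow5// -/s => h; apply: le_trans h.
have [w0 w1 w2 w3] := coefficient_closed_forms r alpha0 s0.
(* Both boundary terms share the time integral [H1_fun]; the extra factor [r] of the second one
   turns [Q 0] into [Q 1] and supplies the power [s ^+ 4]. *)
have split_r (a b h : R) : (a + b * r) * h = a * h + b * (r * h) by ring.
rewrite split_r -w0 -w2 -w1 -w3.
rewrite le_eqVlt; apply/orP; left; apply/eqP; congr (`|_ - _|).
have dE : d = s ^+ 2 by rewrite sqr_sqrtr// ltW.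
move: ('D_n f x) ('D_n ('D_n f) x) ('D_tau ('D_tau f) x) (f x) (W0 _ _) (W1 _ _) (Q _ _ 0) (Q _ _ 1).
move=> a1 a2 a3 a4 b0 b1 b2 b3; rewrite dE.
by clear; field.
Unshelve. all: by end_near. Qed.
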